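(* Let $D$ be the Koornwinder operator in $z\in\mathbb C^n$ with parameters $t=q^{-k}$, $a=q^{-l}$, $b=q^{-l'}$, $c=q^{-m}$, $d=q^{-m'}$, where $k\in\mathbb Z_{\ge0}$, $l,l',m,m'\in\frac12\mathbb Z_{\ge0}$, $\frac12+l+l'\in\mathbb Z$, $\frac12+m+m'\in\mathbb Z$. Define $$\psi(x,z)=\prod_\nu\bigl(D-\mathfrak m(x+\nu)\bigr)\left[q^{2(x,z)}Q(z)\right],$$ where $\mathfrak m(x)=\sum_{i=1}^n(q^{2x_i}+q^{-2x_i})$, $Q(z)=(-1)^{n(l+l'+\frac12)}q^{2(\rho,z)}c(z,M)c(-z,M)$, and the product is over all $\nu\ne0$ of the form $\nu=\sum_{\alpha\in R_+}l_\alpha\alpha$ with $l_\alpha\in\{0,\dots,m_\alpha\}$. Then: (i) $\psi$ is a Baker--Akhiezer function for the Koornwinder operator; (ii) the coefficient $\psi_{-\rho}$ in its expansion $\psi=q^{2(x,z)}\sum_\nu\psi_\nu(x)q^{2(\nu,z)}$ equals $\prod_\nu(\mathfrak m(x)-\mathfrak m(x+\nu))\ne0$; (iii) as a function of $z$, $\psi$ is an eigenfunction of $D$: $D\psi=\mathfrak m(x)\psi$.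
   Context: $q\in\mathbb C^\times$ is not a root of unity, $\log q$ fixed, $q^a=e^{a\log q}$, $[a]=q^a-q^{-a}$; $(\cdot,\cdot)$ is the standard bilinear form on $\mathbb C^n$, $e_1,\dots,e_n$ the standard basis; $T_i^s$ is the shift by $s$ in $z_i$. Koornwinder operator: $$D=\sum_{i=1}^n\bigl(v_i^+(T_i-1)+v_i^-(T_i^{-1}-1)\bigr)+abcdq^{-1}\frac{1-t^{2n}}{1-t^2}+(abcd)^{-1}q\frac{1-t^{-2n}}{1-t^{-2}}$$ (the fractions being read as $\sum_{i=0}^{n-1}t^{\pm2i}$), where $$v_i^\pm(z)=v^\pm(z_i)\prod_{j\ne i}\frac{(tq^{\pm z_i-z_j}-t^{-1}q^{\mp z_i+z_j})(tq^{\pm z_i+z_j}-t^{-1}q^{\mp z_i-z_j})}{(q^{\pm z_i-z_j}-q^{\mp z_i+z_j})(q^{\pm z_i+z_j}-q^{\mp z_i-z_j})},$$ $$v^+(u)=\frac{(aq^u-a^{-1}q^{-u})(bq^u-b^{-1}q^{-u})(cq^u+c^{-1}q^{-u})(dq^u+d^{-1}q^{-u})}{(q^u-q^{-u})(q^{\frac12+u}-q^{-\frac12-u})(q^u+q^{-u})(q^{\frac12+u}+q^{-\frac12-u})},\quad v^-(u)=v^+(-u).$$ $R=\{\pm e_i\}\cup\{\pm e_i\pm e_j:i\ne j\}$, $R_+=\{e_i\}\cup\{e_i\pm e_j:i<j\}$, $R^0_+=\{e_i\}$, $R^1_+=\{e_i\pm e_j:i<j\}$. $M=(k,l,l',m,m')$;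 $m_\alpha=k$ for $\alpha=\pm e_i\pm e_j$, $m_\alpha=1+l+l'+m+m'$ for $\alpha=\pm e_i$; $\rho=\frac12\sum_{\alpha\in R_+}m_\alpha\alpha$. The notation $u\preccurlyeq(v,w)$ means that at least one of $v-u$, $w-u$ is a nonnegative integer. Put $$c(\lambda,M)=\prod_{\alpha\in R_+^0}\Bigl(\prod_{0<j\preccurlyeq(l,l')}[j-(\alpha,\lambda)]\prod_{0<j\preccurlyeq(m,m')}\bigl(q^{j-(\alpha,\lambda)}+q^{-j+(\alpha,\lambda)}\bigr)\Bigr)\prod_{\alpha\in R^1_+}\prod_{j=1}^k[j-(\alpha,\lambda)].$$ A Baker--Akhiezer function for the Koornwinder operator with parameters $M$ is a (nonzero) function $\psi(x,z)=q^{2(x,z)}\sum_{\nu}\psi_\nu(x)q^{2(\nu,z)}$, the sum over $\nu\in\rho+\mathbb Z^n$ lying in the polytope $\mathcal N=\{\sum_{\alpha\in R_+}l_\alpha\alpha:-\frac12m_\alpha\le l_\alpha\le\frac12m_\alpha\}$, satisfying in $z$, for all $x$: (1) $(T_i^s-T_i^{-s})\psi=0$ for $q^{2z_i}=1$, all $i$ and $0<s\preccurlyeq(l,l')$; (2) $(T_i^s-T_i^{-s})\psi=0$ for $q^{2z_i}=-1$, all $i$ and $0<s\preccurlyeq(m,m')$; (3) $(T_i^s-T_j^s)\psi=0$ for $q^{2z_i}=q^{2z_j}$, all $i<j$, $s=1,\dots,k$; (4) $(T_i^s-T_j^{-s})\psi=0$ for $q^{2z_i}=q^{-2z_j}$,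 all $i<j$, $s=1,\dots,k$. *)

(* Defs.v *)
From HB Require Import structures.
From mathcomp Require Import all_boot all_order all_algebra.
From mathcomp Require Import complex.
From mathcomp Require Import all_classical all_reals all_analysis.

Set Implicit Arguments.
Unset Strict Implicit.
Unset Printing Implicit Defensive.

Import Order.TTheory GRing.Theory Num.Theory.

Local Open Scope classical_set_scope.
Local Open Scope ring_scope.
Local Open Scope complex_scope.

Section Koornwinder.
Variable R : realType.
Local Notation C := R[i].

Definition cexp (w : C) : C :=
  (expR (complex.Re w) * cos (complex.Im w))
    +i* (expR (complex.Re w) * sin (complex.Im w)).

(* q^a = e^(a log q), for the chosen value [logq] of log q. *)
Definition qpow (logq a : C) : C := cexp (a * logq).

(* [a] = q^a - q^-a, and its companion q^a + q^-a. *)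
Definition qminus (logq a : C) : C := qpow logq a - qpow logq (- a).
Definition qplus (logq a : C) : C := qpow logq a + qpow logq (- a).

Section Rank.
Variable n : nat.

Definition dotp (u v : 'rV[C]_n) : C := \sum_i u 0 i * v 0 i.

Definition basis_vec (i : 'I_n) : 'rV[C]_n := delta_mx 0 i.

(* T_i^s, acting on functions of z. *)
Definition zshift (i : 'I_n) (s : C) (f : 'rV[C]_n -> C) (z : 'rV[C]_n) : C :=
  f (z + s *: basis_vec i).

(* u ≼ (v, w) *)
Definition preccurly (u v w : R) : bool :=
  (v - u \is a Num.nat) || (w - u \is a Num.nat).

Section Operator.
Variables (logq t a b c d : C).
Local Notation "q^ e" := (qpow logq e) (at level 2, e at level 1).

Definition v_num (u : C) : C :=
  (a * q^u - a^-1 * q^(- u)) * (b * q^u - b^-1 * q^(- u))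
  * (c * q^u + c^-1 * q^(- u)) * (d * q^u + d^-1 * q^(- u)).

Definition v_den (u : C) : C :=
  (q^u - q^(- u)) * (q^(2^-1 + u) - q^(- 2^-1 - u))
  * (q^u + q^(- u)) * (q^(2^-1 + u) + q^(- 2^-1 - u)).

Definition pair_num (u w : C) : C :=
  (t * q^(u - w) - t^-1 * q^(- u + w)) * (t * q^(u + w) - t^-1 * q^(- u - w)).

Definition pair_den (u w : C) : C :=
  (q^(u - w) - q^(- u + w)) * (q^(u + w) - q^(- u - w)).

(* v_i^+ and v_i^- are the values of the same expression at u = z_i and
   u = - z_i. *)
Definition v_at (i : 'I_n) (u : C) (z : 'rV[C]_n) : C :=
  v_num u / v_den u
  * \prod_(j < n | j != i) (pair_num u (z 0 j) / pair_den u (z 0 j)).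

Definition v_plus (i : 'I_n) (z : 'rV[C]_n) : C := v_at i (z 0 i) z.
Definition v_minus (i : 'I_n) (z : 'rV[C]_n) : C := v_at i (- z 0 i) z.

Definition koornwinder (f : 'rV[C]_n -> C) (z : 'rV[C]_n) : C :=
  \sum_i (v_plus i z * (zshift i 1 f z - f z)
          + v_minus i z * (zshift i (- 1) f z - f z))
  + (a * b * c * d * q^(- 1) * (\sum_(i < n) t ^+ (2 * i))
     + (a * b * c * d)^-1 * q^1 * (\sum_(i < n) t ^- (2 * i))) * f z.

End Operator.

Definition regular_at (logq : C) (z : 'rV[C]_n) : Prop :=
  forall (i : 'I_n) (u : C), u = z 0 i \/ u = - z 0 i ->
    v_den logq u != 0 /\
    (forall j : 'I_n, j != i -> pair_den logq u (z 0 j) != 0).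

(* The points all of whose Z^n-translates avoid the poles of the coefficients
   of the operator.  They form the complement of countably many complex
   hyperplanes, hence a dense subset of C^n, stable under the shifts T_i, on
   which every iterate of the operator is given by its formula (no division by
   zero occurs).  Two meromorphic functions that are regular there are equal
   iff they agree at all these points. *)
Definition generic (logq : C) (z : 'rV[C]_n) : Prop :=
  forall mu : 'rV[int]_n, regular_at logq (z + map_mx intr mu).

Definition mero_eq (logq : C) (f g : 'rV[C]_n -> C) : Prop :=
  forall z, generic logq z -> f z = g z.

(* Index types for R_+^0 = {e_i}, R_+^1 = {e_i ± e_j : i < j} and their
   union R_+; the boolean selects the minus sign. *)
Definition posroot0 : finType := 'I_n.
Definition posroot1 : finType :=
  ({p : 'I_n * 'I_n | (p.1 < p.2)%N} * bool)%type.
Definition posroot : finType := (posroot0 + posroot1)%type.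

Definition rootv0 (al : posroot0) : 'rV[C]_n := basis_vec al.
Definition rootv1 (al : posroot1) : 'rV[C]_n :=
  basis_vec (val al.1).1 + (-1) ^+ al.2 *: basis_vec (val al.1).2.
Definition rootv (al : posroot) : 'rV[C]_n :=
  match al with inl be => rootv0 be | inr be => rootv1 be end.

Definition mfrak (logq : C) (x : 'rV[C]_n) : C :=
  \sum_i (qpow logq (2 * x 0 i) + qpow logq (- (2 * x 0 i))).

End Rank.

Record params := Params
  { par_k : nat; par_l : R; par_l' : R; par_m : R; par_m' : R }.

Section BakerAkhiezer.
Variables (n : nat) (M : params) (logq : C).
Local Notation k := (par_k M).
Local Notation l := (par_l M).
Local Notation l' := (par_l' M).
Local Notation m := (par_m M).
Local Notation m' := (par_m' M).

Definition multr (al : posroot n) : R :=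
  match al with inl _ => 1 + l + l' + m + m' | inr _ => k%:R end.

Definition rho : 'rV[C]_n :=
  2^-1 *: \sum_(al : posroot n) (multr al)%:C *: rootv al.

(* The product of F j over 0 < j ≼ (v, w), for v, w in (1/2)Z_{>=0}: such j are
   half-integers p/2 with 0 < p <= 2 max(v, w). *)
Definition prec_prod (v w : R) (F : R -> C) : C :=
  \prod_(1 <= p < (Num.truncn (2 * Num.max v w)).+1
          | preccurly (p%:R / 2) v w) F (p%:R / 2).

Definition cfun (lam : 'rV[C]_n) : C :=
  \prod_(al : posroot0 n)
    (prec_prod l l' (fun j => qminus logq (j%:C - dotp (rootv0 al) lam))
     * prec_prod m m' (fun j => qplus logq (j%:C - dotp (rootv0 al) lam)))
  * \prod_(al : posroot1 n) \prod_(1 <= j < k.+1)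
      qminus logq (j%:R - dotp (rootv1 al) lam).

Definition polytope : set 'rV[C]_n :=
  [set nu | exists2 la : posroot n -> R,
     (forall al, - (multr al / 2) <= la al <= multr al / 2) &
     nu = \sum_al (la al)%:C *: rootv al].

Definition rho_lattice : set 'rV[C]_n :=
  [set nu | exists mu : 'rV[int]_n, nu = rho + map_mx intr mu].

(* q^(2(x,z)) sum_nu psi_nu(x) q^(2(nu,z)); the index set is finite. *)
Definition expansion (coef : 'rV[C]_n -> 'rV[C]_n -> C) (x z : 'rV[C]_n) : C :=
  qpow logq (2 * dotp x z)
  * \sum_(nu \in rho_lattice `&` polytope)
      (coef nu x * qpow logq (2 * dotp nu z)).

Definition BA_conditions (f : 'rV[C]_n -> C) : Prop :=
  [/\ forall (z : 'rV[C]_n) (i : 'I_n) (s : R),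
        qpow logq (2 * z 0 i) = 1 -> 0 < s -> preccurly s l l' ->
        zshift i s%:C f z - zshift i (- s%:C) f z = 0,
      forall (z : 'rV[C]_n) (i : 'I_n) (s : R),
        qpow logq (2 * z 0 i) = - 1 -> 0 < s -> preccurly s m m' ->
        zshift i s%:C f z - zshift i (- s%:C) f z = 0,
      forall (z : 'rV[C]_n) (i j : 'I_n) (s : nat), (i < j)%N ->
        qpow logq (2 * z 0 i) = qpow logq (2 * z 0 j) -> (1 <= s <= k)%N ->
        zshift i s%:R f z - zshift j s%:R f z = 0 &
      forall (z : 'rV[C]_n) (i j : 'I_n) (s : nat), (i < j)%N ->
        qpow logq (2 * z 0 i) = qpow logq (- (2 * z 0 j)) -> (1 <= s <= k)%N ->
        zshift i s%:R f z - zshift j (- s%:R) f z = 0].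

(* psi is a Baker-Akhiezer function with coefficients psi_nu(x) = coef nu x. *)
Definition is_BA (psi : 'rV[C]_n -> 'rV[C]_n -> C)
    (coef : 'rV[C]_n -> 'rV[C]_n -> C) : Prop :=
  [/\ forall x z, psi x z = expansion coef x z,
      exists x z, psi x z != 0 &
      forall x, BA_conditions (psi x)].

(* The distinct nonzero nu = sum_al l_al al with l_al in {0, ..., m_al}. *)
Definition nu_seq : seq 'rV[C]_n :=
  [seq nu <- undup [seq \sum_(al : posroot n) (la al)%:R *: rootv al
      | la : {dffun forall al : posroot n, 'I_(Num.truncn (multr al)).+1}]
  | nu != 0].

Definition Qfun (z : 'rV[C]_n) : C :=
  (-1) ^+ (n * Num.truncn (l + l' + 2^-1))
  * qpow logq (2 * dotp rho z) * cfun z * cfun (- z).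

Definition koornwinderM : ('rV[C]_n -> C) -> 'rV[C]_n -> C :=
  koornwinder logq (qpow logq (- k%:R)) (qpow logq (- l%:C))
    (qpow logq (- l'%:C)) (qpow logq (- m%:C)) (qpow logq (- m'%:C)).

(* The factors D - m(x + nu) commute as operators on meromorphic functions, so
   the order in which they are applied is irrelevant. *)
Definition psi_formula (x : 'rV[C]_n) : 'rV[C]_n -> C :=
  foldr (fun nu f z => koornwinderM f z - mfrak logq (x + nu) * f z)
    (fun z => qpow logq (2 * dotp x z) * Qfun z) nu_seq.

End BakerAkhiezer.
End Koornwinder.

(* Main.v *)
Require Import Defs.
From HB Require Import structures.
From mathcomp Require Import all_boot all_order all_algebra.
From mathcomp Require Import complex.
From mathcomp Require Import all_classical all_reals all_analysis.
From mathcomp Require Import ring zify.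
Import Order.TTheory GRing.Theory Num.Theory.
Local Open Scope ring_scope.
Local Open Scope complex_scope.

(** Divide by the plane wave q^(2(x+rho,z)) and put Z_i = q^(2 z_i), so that
    functions become Laurent polynomials in Z with exponents mu, and x enters
    through Y_i = q^((x+rho)_i).  Conditions (1)-(4) are exactly what makes the
    apparent poles of D f cancel, and D f inherits them; hence D acts on the
    finite-dimensional space of Laurent polynomials that satisfy the conditions
    and whose exponents obey the bounds attained by Q.

    Degenerating along Z y^h as y -> 0, for a regular integral direction h,
    shows that D multiplies the coefficient at an extreme exponent mu by m(x
    + nu) with nu = mu + rho + rho_h, where rho_h is the image of rho in the
    chamber of h. The exponents allowed by all the bounds are the lattice
    points of a zonotope, i.e. the nu = sum l_al al with 0 <= l_al <= m_al.
    So for generic x, when the values m(x + nu) are distinct, the product of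
    D - m(x + nu) over all nu, zero included, annihilates the space: leaving
    out nu = 0 gives an eigenfunction with eigenvalue m(x), and its extreme
    exponents are forced into the polytope. All coefficients are rational in
    Y, so the identities extend to every x. At the lowest exponent of Q the
    operator acts as the scalar m(x), which yields the product formula for
    the coefficient at -rho. *)

Set Implicit Arguments.
Unset Strict Implicit.
Unset Printing Implicit Defensive.

(** The operator is a formula with denominators, and since division by zero returns 0 this formula
    is meaningless on the polar hyperplanes. Identities are therefore proved at regular points and
    extended by density, with limits of rational functions in place of analysis. The condition for
    the shift 1/2 is the delicate one to inherit: both of its shifted points lie on polar
    hyperplanes, so it holds for D f only as a limit.

    That the product of the D - m(x + nu) annihilates the space also requires D to have no Jordan
    block there. For generic x, the extreme exponents of an eigenvector in all directions come from
    a single nu, so eigenvalue and direction determine the exponent. If F = (D - e) H is a nonzero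
    eigenvector for e, then H has its extreme exponent at that same place, where D - e has just
    erased it; yet F must be nonzero there.

    A last obstacle is that the bounds only give inequalities, while the product runs over
    combinations with integer coefficients. The two sets agree because every point of the right
    parity below the vertex of its chamber is reached from that vertex by moves along roots that
    stay inside the zonotope. *)

(** * Cofinite sets and limits of rational functions *)

Section AlgebraicLimits.
Variable K : numFieldType.
Implicit Types (F G : K -> K) (P : K -> Prop) (y a b : K).

(** Cofiniteness witnessed by a polynomial: conjunctions multiply the witnesses, and substitution in
    the variable is composition of polynomials. *)
Definition cofin P := exists2 E : {poly K}, E != 0 & forall y, E.[y] != 0 -> P y.

Lemma cofinT P : (forall y, P y) -> cofin P.
Proof. by move=> HP; exists 1; rewrite ?oner_eq0 // => y _. Qed.

Lemma cofinW P1 P2 : cofin P1 -> (forall y, P1 y -> P2 y) -> cofin P2.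
Proof. by case=> E E0 H1 H2; exists E => // y /H1 /H2. Qed.

Lemma cofinI P1 P2 : cofin P1 -> cofin P2 -> cofin (fun y => P1 y /\ P2 y).
Proof.
case=> E1 E10 H1 [E2 E20 H2]; exists (E1 * E2); first by rewrite mulf_neq0.
by move=> y; rewrite hornerM mulf_eq0 negb_or => /andP[/H1 ? /H2 ?].
Qed.

Lemma cofin_poly (E : {poly K}) : E != 0 -> cofin (fun y => E.[y] != 0).
Proof. by move=> E0; exists E. Qed.

Lemma cofin_neq a : cofin (fun y => y != a).
Proof.
exists ('X - a%:P); first by rewrite polyXsubC_eq0.
by move=> y; rewrite hornerXsubC subr_eq0.
Qed.

Lemma cofin_imp (Q : Prop) P : (Q -> cofin P) -> cofin (fun y => Q -> P y).
Proof.
move=> H; case: (pselect Q) => [/H HP|nQ]; last by apply: cofinT.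
by apply: cofinW HP _.
Qed.

Lemma cofin_forall_seq (T : eqType) (s : seq T) (P : T -> K -> Prop) :
  (forall i, i \in s -> cofin (P i)) ->
  cofin (fun y => forall i, i \in s -> P i y).
Proof.
elim: s => [|x s IH] H; first by apply: cofinT.
have /cofinI/(_ (IH _)) : cofin (P x) by apply: H; rewrite mem_head.
case=> [i si|E E0 HE]; first by apply: H; rewrite inE si orbT.
exists E => // y /HE[Hx Hs] i; rewrite inE => /orP[/eqP->//|]; exact: Hs.
Qed.

Lemma cofin_forall (T : finType) (P : T -> K -> Prop) :
  (forall i, cofin (P i)) -> cofin (fun y => forall i, P i y).
Proof.
move=> H; have := @cofin_forall_seq T (enum T) P (fun i _ => H i).
by move/cofinW; apply=> y Hy i; apply: Hy; rewrite mem_enum.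
Qed.

Lemma cofin_exprz_neq (e : int) a b : a != 0 -> e != 0 ->
  cofin (fun y => a * y ^ e != b).
Proof.
move=> a0 e0; apply: cofinW (cofinI (cofin_neq 0) _) _ => [|y [/= y0 H]]; last exact: H.
case: e e0 => [[|k] // _|k _].
  exists (a *: 'X^(k.+1) - b%:P).
    apply/negP => /eqP /(congr1 (fun p : {poly K} => p`_k.+1)).
    rewrite coefB coefZ coefXn coefC /= eqxx mulr1 subr0 coef0 => /eqP.
    by rewrite (negPf a0).
  by move=> y; rewrite hornerD hornerZ hornerXn hornerN hornerC subr_eq0.
have [->|b0] := eqVneq b 0.
  exists 'X; first by rewrite polyX_eq0.
  by move=> y; rewrite hornerX => y0; rewrite mulf_neq0 // expfz_neq0.
exists ((b *: 'X^(k.+1) - a%:P) * 'X).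
  rewrite mulf_neq0 ?polyX_eq0 //.
  apply/negP => /eqP /(congr1 (fun p : {poly K} => p`_k.+1)).
  rewrite coefB coefZ coefXn coefC /= eqxx mulr1 subr0 coef0 => /eqP.
  by rewrite (negPf b0).
move=> y; rewrite hornerM hornerX hornerD hornerZ hornerXn hornerN hornerC.
rewrite mulf_eq0 negb_or => /andP[H y0].
apply: contraNN H => /eqP <-.
by rewrite NegzE -exprz_inv -exprnP exprVn -mulrA mulVf ?expf_neq0 // mulr1 subrr.
Qed.

(** Characteristic zero enters here: the first [size E] natural numbers are distinct in K, too many
    to be all roots of E. *)
Lemma cofin_nat P : cofin P -> exists T : nat, P T%:R.
Proof.
case=> E E0 HE; apply: contrapT => H.
have: (size [seq (i%:R : K) | i <- iota 0 (size E)] < size E)%N.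
  apply: max_poly_roots => //; last first.
    by rewrite map_inj_uniq ?iota_uniq //; apply: mulrIn; rewrite oner_neq0.
  apply/allP => _ /mapP[i _ ->]; rewrite rootE; case: (eqVneq E.[i%:R] 0) => // /HE Hi.
  by case: H; exists i.
by rewrite size_map size_iota ltnn.
Qed.

Lemma cofin_ex P : cofin P -> exists y, P y.
Proof. by case/cofin_nat => T; exists T%:R. Qed.

Lemma cofin_seq P (M : nat) : cofin P ->
  exists2 ys : seq K, uniq ys /\ size ys = M & forall y, y \in ys -> P y.
Proof.
move=> HP; elim: M => [|M [ys [uys sys] Hys]]; first by exists [::].
have H1 : cofin (fun y => forall z, z \in ys -> y != z).
  by apply: cofin_forall_seq => z _; apply: cofin_neq.
have /cofin_ex[y [Py Hy]] := cofinI HP H1.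
exists (y :: ys); first split.
- by rewrite /= uys andbT; apply/negP => /Hy; rewrite eqxx.
- by rewrite /= sys.
by move=> z; rewrite inE => /orP[/eqP->//|]; exact: Hys.
Qed.

(* The limit at [y] of a function which is rational off a finite set. *)
Definition rlim F y a := exists P S : {poly K},
  [/\ S.[y] != 0, P.[y] = a * S.[y] & cofin (fun z => F z * S.[z] = P.[z])].

Lemma rlim_near F G y a : cofin (fun z => F z = G z) -> rlim F y a -> rlim G y a.
Proof.
move=> FG [P [S [S0 PS H]]]; exists P, S; split=> //.
by apply: cofinW (cofinI FG H) _ => z [<-].
Qed.

Lemma rlim_poly (P : {poly K}) y : rlim (fun z => P.[z]) y P.[y].
Proof.
exists P, 1; rewrite hornerC oner_eq0 mulr1; split=> //.
by apply: cofinT => z; rewrite hornerC mulr1.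
Qed.

Lemma rlim_cst a y : rlim (fun=> a) y a.
Proof.
have := rlim_poly a%:P y; rewrite hornerC; apply: rlim_near.
by apply: cofinT => z; rewrite hornerC.
Qed.

Lemma rlim_id y : rlim id y y.
Proof.
have := rlim_poly 'X y; rewrite hornerX; apply: rlim_near.
by apply: cofinT => z; rewrite hornerX.
Qed.

Lemma rlimD F G y a b : rlim F y a -> rlim G y b -> rlim (fun z => F z + G z) y (a + b).
Proof.
move=> [P [S [S0 PS H]]] [P' [S' [S'0 PS' H']]].
exists (P * S' + P' * S), (S * S'); split.
- by rewrite hornerM mulf_neq0.
- by rewrite hornerD !hornerM PS PS'; ring.
by apply: cofinW (cofinI H H') _ => z [HP HP']; rewrite hornerD !hornerM -HP -HP'; ring.
Qed.

Lemma rlimM F G y a b : rlim F y a -> rlim G y b -> rlim (fun z => F z * G z) y (a * b).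
Proof.
move=> [P [S [S0 PS H]]] [P' [S' [S'0 PS' H']]].
exists (P * P'), (S * S'); split.
- by rewrite hornerM mulf_neq0.
- by rewrite !hornerM PS PS'; ring.
by apply: cofinW (cofinI H H') _ => z [HP HP']; rewrite !hornerM -HP -HP'; ring.
Qed.

Lemma rlimMl c F y a : rlim F y a -> rlim (fun z => c * F z) y (c * a).
Proof. exact/rlimM/rlim_cst. Qed.

Lemma rlimN F y a : rlim F y a -> rlim (fun z => - F z) y (- a).
Proof.
move=> /(rlimMl (-1)); rewrite mulN1r; apply: rlim_near.
by apply: cofinT => z; rewrite mulN1r.
Qed.

Lemma rlimB F G y a b : rlim F y a -> rlim G y b -> rlim (fun z => F z - G z) y (a - b).
Proof. by move=> HF /rlimN HG; apply: rlimD. Qed.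

Lemma rlimV F y a : a != 0 -> rlim F y a -> rlim (fun z => (F z)^-1) y a^-1.
Proof.
move=> a0 [P [S [S0 PS H]]].
have P0 : P.[y] != 0 by rewrite PS mulf_neq0.
exists S, P; split=> //; first by rewrite PS mulKf.
have : P != 0 by apply: contraNneq P0 => ->; rewrite horner0.
move/cofin_poly/(cofinI H)/cofinW; apply=> z [<-].
by rewrite mulf_eq0 negb_or => /andP[Fz Sz]; rewrite mulKf.
Qed.

Lemma rlimX F y a k : rlim F y a -> rlim (fun z => F z ^+ k) y (a ^+ k).
Proof.
move=> HF; elim: k => [|k IH]; first exact: rlim_cst.
have := rlimM HF IH; rewrite -exprS; apply: rlim_near.
by apply: cofinT => z; rewrite exprS.
Qed.

Lemma rlim_exprz F y a (e : int) : a != 0 -> rlim F y a ->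
  rlim (fun z => F z ^ e) y (a ^ e).
Proof.
move=> a0 HF; case: e => k; first exact: rlimX.
by apply: rlimV; rewrite ?expf_neq0 //; exact: rlimX.
Qed.

Lemma rlim_sum (I : Type) (r : seq I) (Q : pred I) (F : I -> K -> K) y (a : I -> K) :
  (forall i, Q i -> rlim (F i) y (a i)) ->
  rlim (fun z => \sum_(i <- r | Q i) F i z) y (\sum_(i <- r | Q i) a i).
Proof.
move=> H; elim: r => [|i r IH].
  rewrite big_nil; apply: rlim_near (rlim_cst 0 y).
  by apply: cofinT => z; rewrite big_nil.
rewrite big_cons; case: ifP => Qi.
  by apply: rlim_near (rlimD (H i Qi) IH); apply: cofinT => z; rewrite big_cons Qi.
by apply: rlim_near IH; apply: cofinT => z; rewrite big_cons Qi.
Qed.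

Lemma rlim_prod (I : Type) (r : seq I) (Q : pred I) (F : I -> K -> K) y (a : I -> K) :
  (forall i, Q i -> rlim (F i) y (a i)) ->
  rlim (fun z => \prod_(i <- r | Q i) F i z) y (\prod_(i <- r | Q i) a i).
Proof.
move=> H; elim: r => [|i r IH].
  rewrite big_nil; apply: rlim_near (rlim_cst 1 y).
  by apply: cofinT => z; rewrite big_nil.
rewrite big_cons; case: ifP => Qi.
  by apply: rlim_near (rlimM (H i Qi) IH); apply: cofinT => z; rewrite big_cons Qi.
by apply: rlim_near IH; apply: cofinT => z; rewrite big_cons Qi.
Qed.

Lemma cofin_polyeq (P Q : {poly K}) : cofin (fun y => P.[y] = Q.[y]) -> P = Q.
Proof.
move=> H; apply/eqP; rewrite -subr_eq0; apply: contraT => /cofin_poly/(cofinI H)/cofin_ex.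
by case=> y [E]; rewrite hornerD hornerN E subrr eqxx.
Qed.

(** Cross-multiplication gives two polynomials that agree off a finite set, hence everywhere.
    Uniqueness is what carries an identity valid off a finite set to the point itself. *)
Lemma rlim_uniq F y a b : rlim F y a -> rlim F y b -> a = b.
Proof.
move=> [P [S [S0 PS H]]] [P' [S' [S'0 PS' H']]].
have : P * S' = P' * S.
  apply: cofin_polyeq; apply: cofinW (cofinI H H') _ => z [HP HP'].
  by rewrite !hornerM -HP -HP'; ring.
move/(congr1 (fun p : {poly K} => p.[y])); rewrite !hornerM PS PS' => E.
apply: (mulIf S0); apply: (mulIf S'0); rewrite E; ring.
Qed.

Lemma rlim_eq0 F y a : cofin (fun z => F z = 0) -> rlim F y a -> a = 0.
Proof.
move=> F0 Fa; apply: rlim_uniq Fa _; apply: rlim_near (rlim_cst 0 y).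
by apply: cofinW F0 _.
Qed.

(** A limit 0 makes the numerator divisible by X - y. This is how a simple pole with residue zero is
    recognised as removable. *)
Lemma rlim_div_root F y : rlim F y 0 -> exists b, rlim (fun z => F z / (z - y)) y b.
Proof.
case=> P [S [S0 PS H]].
have : root P y by rewrite rootE PS mul0r.
move/factor_theorem => [P' EP].
exists (P'.[y] / S.[y]), P', S; split=> //; first by rewrite divfK.
apply: cofinW (cofinI H (cofin_neq y)) _ => z [HP zy].
have zy0 : z - y != 0 by rewrite subr_eq0.
apply: (mulIf zy0); rewrite mulrAC divfK // HP EP hornerM !hornerE //.
Qed.

End AlgebraicLimits.

(** * Laurent functions *)

Section LaurentFunctions.
Variables (K : numFieldType) (n : nat).
Local Notation pt := ('I_n -> K).
Local Notation sidx := ('I_n * bool)%type.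
Local Notation expo := {ffun 'I_n -> int}.
Implicit Types (Z : pt) (a b : sidx) (mu h : expo) (f g : pt -> K).

(* Signed indices: [(i, false)] stands for [e_i] and [(i, true)] for [- e_i];
   [co Z a] is [Z_i] or its inverse accordingly. *)
Definition opp a : sidx := (a.1, ~~ a.2).
Definition sgi a (p : int) : int := if a.2 then - p else p.
Definition co Z a : K := if a.2 then (Z a.1)^-1 else Z a.1.
Definition eco mu a : int := sgi a (mu a.1).
Definition unitv a (p : int) : expo := [ffun j => if j == a.1 then sgi a p else 0].
Definition dot mu h : int := \sum_i mu i * h i.
Definition mon Z mu : K := \prod_i Z i ^ mu i.
Definition tor Z := forall i, Z i != 0.
(** The orbit of Z under a one-parameter subgroup. It serves density (y at 1), leading terms (y at
    0) and, at y = q, the shifts themselves. *)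
Definition cv Z h (y : K) : pt := fun i => Z i * y ^ h i.
Definition setc Z a (w : K) : pt :=
  fun j => if j == a.1 then (if a.2 then w^-1 else w) else Z j.

(** Laurent polynomials as functions built up inductively, so that divisibility and limits follow by
    induction on the construction. [LF_ext] makes the values off the torus irrelevant. *)
Inductive LF : (pt -> K) -> Prop :=
| LF_cst c : LF (fun=> c)
| LF_var i : LF (fun Z => Z i)
| LF_varV i : LF (fun Z => (Z i)^-1)
| LFD f g : LF f -> LF g -> LF (fun Z => f Z + g Z)
| LFM f g : LF f -> LF g -> LF (fun Z => f Z * g Z)
| LF_ext f g : (forall Z, tor Z -> f Z = g Z) -> LF f -> LF g.

Lemma LFN f : LF f -> LF (fun Z => - f Z).
Proof.
move=> /(LFM (LF_cst (-1))); apply: LF_ext => Z _; exact: mulN1r.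
Qed.

Lemma LFB f g : LF f -> LF g -> LF (fun Z => f Z - g Z).
Proof. by move=> Hf /LFN; apply: LFD. Qed.

Lemma LF_sum (I : Type) (r : seq I) (Q : pred I) (F : I -> pt -> K) :
  (forall i, Q i -> LF (F i)) -> LF (fun Z => \sum_(i <- r | Q i) F i Z).
Proof.
move=> H; elim: r => [|i r IH].
  by apply: LF_ext (LF_cst 0) => Z _; rewrite big_nil.
case Qi : (Q i); last by apply: LF_ext IH => Z _; rewrite big_cons Qi.
by apply: LF_ext (LFD (H i Qi) IH) => Z _; rewrite big_cons Qi.
Qed.

Lemma LF_prod (I : Type) (r : seq I) (Q : pred I) (F : I -> pt -> K) :
  (forall i, Q i -> LF (F i)) -> LF (fun Z => \prod_(i <- r | Q i) F i Z).
Proof.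
move=> H; elim: r => [|i r IH].
  by apply: LF_ext (LF_cst 1) => Z _; rewrite big_nil.
case Qi : (Q i); last by apply: LF_ext IH => Z _; rewrite big_cons Qi.
by apply: LF_ext (LFM (H i Qi) IH) => Z _; rewrite big_cons Qi.
Qed.

Lemma LF_co a : LF (fun Z => co Z a).
Proof. by case: a => i []; [apply: LF_varV|apply: LF_var]. Qed.

Lemma LF_exp f k : LF f -> LF (fun Z => f Z ^+ k).
Proof.
move=> Hf; elim: k => [|k IH]; first exact: LF_ext (LF_cst 1).
by apply: LF_ext (LFM Hf IH) => Z _; rewrite exprS.
Qed.

Lemma LF_mon mu : LF (fun Z => mon Z mu).
Proof.
apply: LF_prod => i _; case: (mu i) => k; first exact/LF_exp/LF_var.
apply: LF_ext (LF_exp k.+1 (LF_varV i)) => Z _.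
by rewrite NegzE -exprz_inv.
Qed.

Lemma LF_comp f (phi : pt -> pt) : LF f -> (forall Z, tor Z -> tor (phi Z)) ->
  (forall i, LF (fun Z => phi Z i)) -> (forall i, LF (fun Z => (phi Z i)^-1)) ->
  LF (fun Z => f (phi Z)).
Proof.
move=> Hf tphi H HV; elim: Hf => {f}.
- exact: LF_cst.
- exact: H.
- exact: HV.
- by move=> f g _ Hf _ Hg; exact: LFD Hf Hg.
- by move=> f g _ Hf _ Hg; exact: LFM Hf Hg.
- by move=> f g E _ IH; apply: LF_ext IH => Z /tphi /E.
Qed.

Lemma tor_cv Z h y : y != 0 -> tor Z -> tor (cv Z h y).
Proof. by move=> y0 tZ i; rewrite mulf_neq0 ?expfz_neq0. Qed.

Lemma LF_cv f h y : y != 0 -> LF f -> LF (fun Z => f (cv Z h y)).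
Proof.
move=> y0 Hf; apply: LF_comp Hf _ _ _ => [Z|i|i]; first exact: tor_cv.
- exact: LFM (LF_var i) (LF_cst _).
- by apply: LF_ext (LFM (LF_varV i) (LF_cst (y ^ h i)^-1)) => Z _; rewrite invfM.
Qed.

Lemma tor_setc Z a w : w != 0 -> tor Z -> tor (setc Z a w).
Proof.
move=> w0 tZ i; rewrite /setc; case: (i =P a.1) => _; last exact: tZ.
by case: a.2; rewrite ?invr_eq0.
Qed.

Lemma co_neq0 Z a : tor Z -> co Z a != 0.
Proof. by move=> tZ; rewrite /co; case: a.2; rewrite ?invr_eq0. Qed.

Lemma co_opp Z a : co Z (opp a) = (co Z a)^-1.
Proof. by case: a => i []; rewrite /co /= ?invrK. Qed.

Lemma oppK : involutive opp.
Proof. by case=> i []. Qed.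

Lemma co_setc Z a w : co (setc Z a w) a = w.
Proof. by case: a => i []; rewrite /co /setc /= eqxx ?invrK. Qed.

Lemma co_setc_neq Z a b w : b.1 != a.1 -> co (setc Z a w) b = co Z b.
Proof. by rewrite /co /setc => /negPf ->. Qed.

Lemma setc_co Z a : setc Z a (co Z a) = Z.
Proof.
apply/funext => j; rewrite /setc /co; case: (j =P a.1) => // ->.
by case: a.2; rewrite ?invrK.
Qed.

Lemma LF_setc f a (w : pt -> K) : LF f -> LF w -> LF (fun Z => (w Z)^-1) ->
  (forall Z, tor Z -> w Z != 0) -> LF (fun Z => f (setc Z a (w Z))).
Proof.
move=> Hf Hw HwV w0; apply: LF_comp Hf _ _ _ => [Z tZ|i|i].
- by apply: tor_setc => //; apply: w0.
- by rewrite /setc; case: (i =P a.1) => _; [case: a.2|apply: LF_var].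
- rewrite /setc; case: (i =P a.1) => _; last exact: LF_varV.
  by case: a.2 => //; apply: LF_ext Hw => Z _; rewrite invrK.
Qed.

(** The factor theorem in one coordinate: divisibility of the difference is clear for constants and
    coordinates and passes to sums and, by a discrete Leibniz rule, to products. *)
Lemma LF_divide f a (w : pt -> K) : LF f -> LF w -> LF (fun Z => (w Z)^-1) ->
  (forall Z, tor Z -> w Z != 0) ->
  exists2 g, LF g &
    forall Z, tor Z -> f Z - f (setc Z a (w Z)) = (co Z a - w Z) * g Z.
Proof.
move=> Hf Hw HwV w0.
have HU : LF (fun Z => - (co Z (opp a) * (w Z)^-1)).
  by apply/LFN/LFM => //; apply: LF_co.
have EU Z : tor Z -> (co Z a)^-1 - (w Z)^-1 = (co Z a - w Z) * - (co Z (opp a) * (w Z)^-1).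
  move=> tZ; rewrite co_opp; have := w0 _ tZ; have := co_neq0 a tZ.
  by move=> ? ?; field; apply/andP.
elim: Hf => {f}.
- by move=> c; exists (fun=> 0); [apply: LF_cst|move=> Z _; rewrite subrr mulr0].
- move=> i; have [->|ia] := eqVneq i a.1; last first.
    exists (fun=> 0); first exact: LF_cst.
    by move=> Z _; rewrite /setc (negPf ia) subrr mulr0.
  case Ea : a.2; last first.
    exists (fun=> 1); first exact: LF_cst.
    by move=> Z _; rewrite /setc /co Ea eqxx mulr1.
  eexists; first exact: HU.
  by move=> Z /EU <-; rewrite /setc /co eqxx Ea invrK.
- move=> i; have [->|ia] := eqVneq i a.1; last first.
    exists (fun=> 0); first exact: LF_cst.
    by move=> Z _; rewrite /setc (negPf ia) subrr mulr0.
  case Ea : a.2.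
    exists (fun=> 1); first exact: LF_cst.
    by move=> Z _; rewrite /setc /co Ea eqxx mulr1 invrK.
  eexists; first exact: HU.
  by move=> Z /EU <-; rewrite /setc /co eqxx Ea.
- move=> f1 f2 _ [g1 L1 H1] _ [g2 L2 H2].
  exists (fun Z => g1 Z + g2 Z); first exact: LFD.
  by move=> Z tZ; rewrite mulrDr -H1 // -H2 //; ring.
- move=> f1 f2 Lf1 [g1 L1 H1] Lf2 [g2 L2 H2].
  exists (fun Z => f1 Z * g2 Z + g1 Z * f2 (setc Z a (w Z))).
    by apply: LFD; apply: LFM => //; apply: LF_setc.
  by move=> Z tZ; rewrite mulrDr mulrCA -H2 // mulrA -H1 //; ring.
- move=> f1 f2 E _ [g L H]; exists g => // Z tZ.
  by rewrite -H // -!E //; apply: tor_setc => //; apply: w0.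
Qed.

Lemma rlim_LF f (c : K -> pt) y Z : LF f -> tor Z -> cofin (fun z => tor (c z)) ->
  (forall i, rlim (fun z => c z i) y (Z i)) -> rlim (fun z => f (c z)) y (f Z).
Proof.
move=> Hf t0 tc Hc; elim: Hf => {f}.
- by move=> k; apply: rlim_cst.
- exact: Hc.
- by move=> i; apply: rlimV.
- by move=> f g _ Hf _ Hg; apply: rlimD.
- by move=> f g _ Hf _ Hg; apply: rlimM.
- move=> f g E _; rewrite E //; apply: rlim_near.
  by apply: cofinW tc _ => z; apply: E.
Qed.

Lemma cofin_tor_cv Z h : tor Z -> cofin (fun y => tor (cv Z h y)).
Proof. by move=> tZ; apply: cofinW (cofin_neq 0) _ => y y0; apply: tor_cv. Qed.

Lemma cofin_tor_setc Z a : tor Z -> cofin (fun y => tor (setc Z a y)).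
Proof. by move=> tZ; apply: cofinW (cofin_neq 0) _ => y y0; apply: tor_setc. Qed.

Lemma rlim_LF_cv f Z h y : LF f -> tor Z -> y != 0 ->
  rlim (fun z => f (cv Z h z)) y (f (cv Z h y)).
Proof.
move=> Lf tZ y0; apply: (rlim_LF Lf (c := cv Z h)).
- exact: tor_cv.
- exact: cofin_tor_cv.
- by move=> i; apply/rlimM/rlim_exprz/rlim_id => //; apply: rlim_cst.
Qed.

Lemma rlim_LF_setc f Z a y : LF f -> tor Z -> y != 0 ->
  rlim (fun z => f (setc Z a z)) y (f (setc Z a y)).
Proof.
move=> Lf tZ y0; apply: (rlim_LF Lf (c := setc Z a)).
- exact: tor_setc.
- exact: cofin_tor_setc.
- move=> i; rewrite /setc; case: (i =P a.1) => _; last exact: rlim_cst.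
  by case: a.2; [apply: rlimV|]; rewrite ?y0 //; apply: rlim_id.
Qed.

Lemma mon0 Z : mon Z 0 = 1.
Proof. by rewrite /mon big1 // => i _; rewrite ffunE. Qed.

Lemma monD Z mu nu : tor Z -> mon Z (mu + nu) = mon Z mu * mon Z nu.
Proof.
move=> tZ; rewrite /mon -big_split; apply: eq_bigr => i _.
by rewrite ffunE expfzDr.
Qed.

Lemma mon_neq0 Z mu : tor Z -> mon Z mu != 0.
Proof. by move=> tZ; apply/prodf_neq0 => i _; rewrite expfz_neq0. Qed.

Lemma mon_unitv Z a p : mon Z (unitv a p) = co Z a ^ p.
Proof.
rewrite /mon (bigD1 a.1) //= big1 => [|i ia]; last by rewrite ffunE (negPf ia).
by rewrite ffunE eqxx mulr1 /sgi /co; case: a.2 => //; rewrite exprz_inv.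
Qed.

Lemma expfz_sum (y : K) (I : Type) (r : seq I) (Q : pred I) (F : I -> int) : y != 0 ->
  y ^ (\sum_(i <- r | Q i) F i) = \prod_(i <- r | Q i) y ^ F i.
Proof.
move=> y0; elim: r => [|i r IH]; first by rewrite !big_nil.
by rewrite !big_cons; case: ifP => _; rewrite ?expfzDr // IH.
Qed.

Lemma mon_cv Z h y mu : y != 0 -> mon (cv Z h y) mu = mon Z mu * y ^ dot mu h.
Proof.
move=> y0; rewrite /mon /dot expfz_sum // -big_split; apply: eq_bigr => i _.
by rewrite /cv expfzMl exprz_exp mulrC [h i * _]mulrC mulrC.
Qed.

Lemma co_cv Z h y a : co (cv Z h y) a = co Z a * y ^ eco h a.
Proof.
rewrite /co /cv /eco /sgi; case: a.2 => //.
by rewrite invfM -invr_expz.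
Qed.

Lemma LF_normal f : LF f -> exists s : seq (K * expo),
  forall Z, tor Z -> f Z = \sum_(t <- s) t.1 * mon Z t.2.
Proof.
elim=> {f}.
- by move=> c; exists [:: (c, 0)] => Z _; rewrite big_seq1 mon0 mulr1.
- move=> i; exists [:: (1, unitv (i, false) 1)] => Z _.
  by rewrite big_seq1 mon_unitv mul1r.
- move=> i; exists [:: (1, unitv (i, true) 1)] => Z _.
  by rewrite big_seq1 mon_unitv mul1r.
- move=> f g _ [s Hs] _ [s' Hs']; exists (s ++ s') => Z tZ.
  by rewrite big_cat Hs // Hs'.
- move=> f g _ [s Hs] _ [s' Hs'].
  exists [seq (t.1 * u.1, t.2 + u.2) | t <- s, u <- s'] => Z tZ.
  rewrite big_allpairs_dep Hs // Hs' // mulr_suml; apply: eq_bigr => t _.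
  rewrite mulr_sumr; apply: eq_bigr => u _ /=.
  by rewrite monD //; ring.
- by move=> f g E _ [s Hs]; exists s => Z tZ; rewrite -E // Hs.
Qed.

End LaurentFunctions.

(** * Density of generic points on the torus and on hyperplanes *)

Section Density.
Variables (K : numFieldType) (n : nat).
Local Notation pt := ('I_n -> K).
Local Notation sidx := ('I_n * bool)%type.
Local Notation expo := {ffun 'I_n -> int}.
Implicit Types (Z : pt) (a b c d : sidx) (mu h : expo) (f g : pt -> K) (S : seq K).

Lemma cofin_co_cv Z h a (s : K) : tor Z -> eco h a != 0 ->
  cofin (fun y => co (cv Z h y) a != s).
Proof.
move=> tZ ha; apply: cofinW (cofin_exprz_neq s (co_neq0 a tZ) ha) _ => y.
by rewrite co_cv.
Qed.

Lemma cofin_co2_cv Z h a b (s : K) : tor Z -> eco h a != eco h b ->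
  cofin (fun y => co (cv Z h y) a != s * co (cv Z h y) b).
Proof.
move=> tZ hab.
have c0 : co Z a / co Z b != 0 by rewrite mulf_neq0 ?invr_eq0 ?co_neq0.
have e0 : eco h a - eco h b != 0 by rewrite subr_eq0.
apply: cofinW (cofinI (cofin_neq 0) (cofin_exprz_neq s c0 e0)) _ => y [y0].
apply: contraNneq; rewrite !co_cv expfzDr // -invr_expz mulrACA -invfM => ->.
by rewrite mulfK // mulf_neq0 ?co_neq0 ?expfz_neq0.
Qed.

(** The curve Z y^h passes through Z at y = 1 and leaves every exceptional hyperplane that h does
    not preserve, so the value at Z is the limit of values at generic points. *)
Lemma dens f S h Z : LF f -> tor Z ->
  (forall y, y != 0 ->
    (forall a, eco h a != 0 -> co (cv Z h y) a \notin S) ->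
    (forall a b, a.1 != b.1 -> eco h a != eco h b ->
       forall s, s \in S -> co (cv Z h y) a != s * co (cv Z h y) b) ->
    f (cv Z h y) = 0) ->
  f Z = 0.
Proof.
move=> Lf tZ H.
have E1 : cv Z h 1 = Z by apply/funext => i; rewrite /cv exp1rz mulr1.
rewrite -E1; apply: rlim_eq0 (rlim_LF_cv h Lf tZ (oner_neq0 K)).
have C1 : cofin (fun y => forall a, eco h a != 0 -> co (cv Z h y) a \notin S).
  apply: cofin_forall => a; apply: cofin_imp => ha.
  have := @cofin_forall_seq _ K S _ (fun s _ => cofin_co_cv s tZ ha).
  by move/cofinW; apply=> y Hy; apply/negP => /Hy; rewrite eqxx.
have C2 : cofin (fun y => forall a b, a.1 != b.1 -> eco h a != eco h b ->
       forall s, s \in S -> co (cv Z h y) a != s * co (cv Z h y) b).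
  apply: cofin_forall => a; apply: cofin_forall => b.
  apply: cofin_imp => _; apply: cofin_imp => hab.
  by apply: cofin_forall_seq => s _; apply: cofin_co2_cv.
apply: cofinW (cofinI (cofin_neq 0) (cofinI C1 C2)) _ => y [y0 [H1 H2]].
exact: H.
Qed.

Definition stdh : expo := [ffun j : 'I_n => (j.+1)%:Z].

Lemma eco_std a : eco stdh a = sgi a (a.1.+1)%:Z.
Proof. by rewrite /eco ffunE. Qed.

Lemma sgi_eq0 a p : (sgi a p == 0) = (p == 0).
Proof. by rewrite /sgi; case: a.2; rewrite ?oppr_eq0. Qed.

Lemma sgiK a : involutive (sgi a).
Proof. by move=> p; rewrite /sgi; case: a.2; rewrite ?opprK. Qed.

Lemma sgi_std_neq a b : a.1 != b.1 -> sgi a (a.1.+1)%:Z != sgi b (b.1.+1)%:Z.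
Proof.
move=> ab; apply: contraNneq ab => E; apply/eqP/val_inj => /=.
by move: E; rewrite /sgi; case: a.2; case: b.2; lia.
Qed.

Definition sep S Z := forall b d, b.1 != d.1 -> forall s, s \in S -> co Z b != s * co Z d.

(** A direction with component 0 at a stays on the hyperplane; its other components have distinct
    nonzero absolute values, so it leaves all other exceptional hyperplanes. *)
Lemma densc f S a (k : K) : LF f ->
  (forall Z, tor Z -> co Z a = k -> (forall b, b.1 != a.1 -> co Z b \notin S) ->
     sep S Z -> f Z = 0) ->
  forall Z, tor Z -> co Z a = k -> f Z = 0.
Proof.
move=> Lf H Z tZ Ea.
pose h : expo := [ffun j => if j == a.1 then 0 else stdh j].
have hN b : b.1 != a.1 -> eco h b = sgi b (b.1.+1)%:Z.
  by move=> ba; rewrite /eco !ffunE (negPf ba).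
have h0 b : b.1 = a.1 -> eco h b = 0.
  by move=> ba; rewrite /eco !ffunE ba eqxx /sgi; case: b.2.
apply: (@dens f S h) => // y y0 H1 H2; apply: H.
- exact: tor_cv.
- by rewrite co_cv h0 // expr0z mulr1.
- by move=> b ba; apply: H1; rewrite hN // sgi_eq0.
- move=> b d bd; apply: H2 => //.
  have [ba|ba] := eqVneq b.1 a.1.
    by rewrite h0 // hN -?ba 1?eq_sym ?sgi_eq0 // eq_sym.
  have [da|da] := eqVneq d.1 a.1.
    by rewrite (h0 d) // hN // sgi_eq0.
  by rewrite !hN // sgi_std_neq.
Qed.

Lemma densd f S a b : a.1 != b.1 -> LF f ->
  (forall Z, tor Z -> co Z a = co Z b -> (forall c, co Z c \notin S) ->
     (forall c d, c.1 != d.1 ->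
        (c, d) \notin [:: (a, b); (b, a); (opp a, opp b); (opp b, opp a)] ->
        forall s, s \in S -> co Z c != s * co Z d) -> f Z = 0) ->
  forall Z, tor Z -> co Z a = co Z b -> f Z = 0.
Proof.
move=> ab Lf H Z tZ Eab.
(* The signs are chosen so that [eco h a = eco h b], which keeps the curve on the diagonal; only the
   four listed pairs then have a constant ratio. *)
pose h : expo := [ffun j => if j == a.1 then sgi a (sgi b (b.1.+1)%:Z) else stdh j].
have hN c : c.1 != a.1 -> eco h c = sgi c (c.1.+1)%:Z.
  by move=> ca; rewrite /eco !ffunE (negPf ca).
have h0 c : c.1 = a.1 -> eco h c = sgi c (sgi a (sgi b (b.1.+1)%:Z)).
  by move=> ca; rewrite /eco !ffunE ca eqxx.
apply: (@dens f S h) => // y y0 H1 H2; apply: H.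
- exact: tor_cv.
- by rewrite !co_cv h0 // hN 1?eq_sym // sgiK Eab.
- move=> c; apply: H1; have [ca|ca] := eqVneq c.1 a.1.
    by rewrite h0 // !sgi_eq0.
  by rewrite hN // sgi_eq0.
- move=> c d cd Ncd; apply: H2 => //.
  have [ca|ca] := eqVneq c.1 a.1; have [da|da] := eqVneq d.1 a.1.
  + by rewrite ca da eqxx in cd.
  + rewrite h0 // hN //; apply: contraNneq Ncd.
    case: c d a b {h hN h0 H1 Eab} ab cd ca da => [c c'] [d d'] [a a'] [b b'] /=.
    move=> ab cd ca da E; rewrite !inE /opp /= !xpair_eqE ca.
    have /eqP -> : d == b by apply/eqP/val_inj; move: E; rewrite /sgi /=; do !case: ifP => _; lia.
    have : (c' (+) a' == b' (+) d').
      by move: E; rewrite /sgi /=; case: c'; case: a'; case: b'; case: d' => //=; lia.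
    by clear E; rewrite !eqxx; case: c'; case: a'; case: b'; case: d'; rewrite ?andbT ?orbT.
  + rewrite hN // h0 //; apply: contraNneq Ncd.
    case: c d a b {h hN h0 H1 Eab} ab cd ca da => [c c'] [d d'] [a a'] [b b'] /=.
    move=> ab cd ca da E; rewrite !inE /opp /= !xpair_eqE da.
    have /eqP -> : c == b by apply/eqP/val_inj; move: E; rewrite /sgi /=; do !case: ifP => _; lia.
    have : (d' (+) a' == b' (+) c').
      by move: E; rewrite /sgi /=; case: c'; case: a'; case: b'; case: d' => //=; lia.
    by clear E; rewrite !eqxx; case: c'; case: a'; case: b'; case: d'; rewrite ?andbT ?orbT.
  + by rewrite !hN // sgi_std_neq.
Qed.
End Density.

(** * Removal of poles *)

Section PoleRemoval.
Variables (K : numFieldType) (n : nat).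
Local Notation pt := ('I_n -> K).
Local Notation sidx := ('I_n * bool)%type.
Local Notation expo := {ffun 'I_n -> int}.
Implicit Types (Z : pt) (a b c d : sidx) (mu h : expo) (f g : pt -> K) (S C : seq K).

(* The hyperplanes [Z_a = c] and [Z_a = Z_b]. *)
Definition hyp : Type := ((sidx * K) + (sidx * sidx))%type.
Definition hval (H : hyp) Z : K :=
  match H with inl p => co Z p.1 - p.2 | inr p => co Z p.1 - co Z p.2 end.
Definition hypin C (H : hyp) : Prop :=
  match H with inl p => p.2 \in C | inr p => p.1.1 != p.2.1 end.
Definition hfirst (H : hyp) : sidx := match H with inl p => p.1 | inr p => p.1 end.

Definition reg C Z :=
  (forall a, co Z a \notin C) /\ (forall a b, a.1 != b.1 -> co Z a != co Z b).

Lemma reg_hval C H Z : reg C Z -> hypin C H -> hval H Z != 0.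
Proof.
case=> R1 R2; case: H => [[a k]|[a b]] /=; rewrite subr_eq0; last exact: R2.
by move=> kC; apply: contraNneq (R1 a) => ->.
Qed.

Lemma LF_hval H : LF (hval H).
Proof. by case: H => p; apply: LFB; do ?[exact: LF_co|exact: LF_cst]. Qed.

Definition hprod (s : seq hyp) Z := \prod_(H <- s) hval H Z.

(** Meromorphic functions with poles along allowed hyperplanes only, counted with multiplicity in
    the list. The equation is asked at regular points, so F may take any value on its poles. *)
Definition MF C (F : pt -> K) := exists s : seq hyp, exists G,
  [/\ forall H, H \in s -> hypin C H, LF G &
      forall Z, tor Z -> reg C Z -> hprod s Z * F Z = G Z].

Lemma LF_hprod s : LF (hprod s).
Proof. by apply: LF_prod => H _; apply: LF_hval. Qed.

Lemma hprod_cat s s' Z : hprod (s ++ s') Z = hprod s Z * hprod s' Z.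
Proof. exact: big_cat. Qed.

Lemma MF_LF C f : LF f -> MF C f.
Proof. by move=> Lf; exists [::], f; split=> // Z _ _; rewrite /hprod big_nil mul1r. Qed.

Lemma MFM C f g : MF C f -> MF C g -> MF C (fun Z => f Z * g Z).
Proof.
move=> [s [G [Hs LG E]]] [s' [G' [Hs' LG' E']]].
exists (s ++ s'), (fun Z => G Z * G' Z); split.
- by move=> H; rewrite mem_cat => /orP[/Hs|/Hs'].
- exact: LFM.
- by move=> Z tZ rZ; rewrite -E // -E' // hprod_cat; ring.
Qed.

Lemma MFD C f g : MF C f -> MF C g -> MF C (fun Z => f Z + g Z).
Proof.
move=> [s [G [Hs LG E]]] [s' [G' [Hs' LG' E']]].
exists (s ++ s'), (fun Z => G Z * hprod s' Z + hprod s Z * G' Z); split.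
- by move=> H; rewrite mem_cat => /orP[/Hs|/Hs'].
- by apply: LFD; apply: LFM => //; apply: LF_hprod.
- by move=> Z tZ rZ; rewrite -E // -E' // hprod_cat; ring.
Qed.

Lemma MF_sum C (I : Type) (r : seq I) (Q : pred I) (F : I -> pt -> K) :
  (forall i, Q i -> MF C (F i)) -> MF C (fun Z => \sum_(i <- r | Q i) F i Z).
Proof.
move=> H; elim: r => [|i r IH].
  by apply: MF_LF; apply: LF_ext (LF_cst n 0) => Z _; rewrite big_nil.
case Qi : (Q i).
  have [s [G [Hs LG E]]] := MFD (H i Qi) IH; exists s, G; split=> // Z tZ rZ.
  by rewrite big_cons Qi E.
have [s [G [Hs LG E]]] := IH; exists s, G; split=> // Z tZ rZ.
by rewrite big_cons Qi E.
Qed.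

Lemma MF_prod C (I : Type) (r : seq I) (Q : pred I) (F : I -> pt -> K) :
  (forall i, Q i -> MF C (F i)) -> MF C (fun Z => \prod_(i <- r | Q i) F i Z).
Proof.
move=> H; elim: r => [|i r IH].
  by apply: MF_LF; apply: LF_ext (LF_cst n 1) => Z _; rewrite big_nil.
case Qi : (Q i).
  have [s [G [Hs LG E]]] := MFM (H i Qi) IH; exists s, G; split=> // Z tZ rZ.
  by rewrite big_cons Qi E.
have [s [G [Hs LG E]]] := IH; exists s, G; split=> // Z tZ rZ.
by rewrite big_cons Qi E.
Qed.

Lemma MF_hvalV C H : hypin C H -> MF C (fun Z => (hval H Z)^-1).
Proof.
move=> HC; exists [:: H], (fun=> 1); split.
- by move=> H'; rewrite inE => /eqP ->.
- exact: LF_cst.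
- by move=> Z tZ rZ; rewrite /hprod big_seq1 mulfV // (reg_hval rZ).
Qed.

Lemma co_setc_same Z a b y : b.1 = a.1 ->
  co (setc Z a y) b = if b == a then y else y^-1.
Proof.
case: a b => [a a'] [b b'] /= ->; rewrite /co /setc /= eqxx xpair_eqE eqxx /=.
by case: b' a' => [] [] //=; rewrite invrK.
Qed.

Lemma cofin_co_setc Z a b (k : K) : (b.1 != a.1 -> co Z b != k) ->
  cofin (fun y => co (setc Z a y) b != k).
Proof.
have [ba _|ba] := eqVneq b.1 a.1; last first.
  by move=> /(_ isT) H; apply: cofinT => y; rewrite co_setc_neq.
apply: cofinW (cofinI (cofin_neq k) (cofin_neq k^-1)) _ => y [H1 H2].
rewrite co_setc_same //; case: (b =P a) => // _.
by apply: contra_neq H2 => <-; rewrite invrK.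
Qed.

Lemma cofin_reg_setc C Z a : tor Z -> (forall b, b.1 != a.1 -> co Z b \notin C) ->
  (forall b d, b.1 != d.1 -> b.1 != a.1 -> d.1 != a.1 -> co Z b != co Z d) ->
  cofin (fun y => reg C (setc Z a y)).
Proof.
move=> tZ H1 H2; apply: cofinI.
  apply: cofin_forall => b.
  have H : cofin (fun y => forall k, k \in C -> co (setc Z a y) b != k).
    apply: cofin_forall_seq => k kC; apply: cofin_co_setc => /H1.
    by apply: contraNneq => ->.
  by apply: cofinW H _ => y Hy; apply/negP => /Hy; rewrite eqxx.
apply: cofin_forall => b; apply: cofin_forall => d; apply: cofin_imp => bd.
have [da|da] := eqVneq d.1 a.1; last first.
  have := @cofin_co_setc Z a b (co Z d) (fun ba => H2 b d bd ba da).
  by move/cofinW; apply=> y; rewrite (co_setc_neq _ _ da).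
have ba : b.1 != a.1 by rewrite -da.
have : cofin (fun y => co (setc Z a y) d != co Z b).
  by apply: cofin_co_setc; rewrite da eqxx.
by move/cofinW; apply=> y; rewrite (co_setc_neq _ _ ba) eq_sym.
Qed.

Section Removal.
Variables (C S : seq K) (F : pt -> K).
Hypotheses (C0 : 0 \notin C) (CS : {subset C <= S}) (S1 : 1 \in S).
Hypothesis Fc : forall a k Z, k \in C -> tor Z -> co Z a = k ->
  (forall b, b.1 != a.1 -> co Z b \notin S) -> sep S Z ->
  exists l, rlim (fun y => F (setc Z a y)) k l.
Hypothesis Fd : forall a b Z, a.1 != b.1 -> tor Z -> co Z a = co Z b ->
  (forall c, co Z c \notin S) ->
  (forall c d, c.1 != d.1 ->
     (c, d) \notin [:: (a, b); (b, a); (opp a, opp b); (opp b, opp a)] ->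
     forall s, s \in S -> co Z c != s * co Z d) ->
  exists l, rlim (fun y => F (setc Z a y)) (co Z a) l.

(** At a generic point of the hyperplane F has a finite limit along the coordinate [hfirst H], while
    the factor [hval H] tends to 0. So G vanishes there, and by density on the whole hyperplane. *)
Lemma removal_step H s G : hypin C H -> LF G ->
  (forall Z, tor Z -> reg C Z -> hval H Z * (hprod s Z * F Z) = G Z) ->
  forall Z, tor Z -> hval H Z = 0 -> G Z = 0.
Proof.
move=> HC LG E.
have lim0 Z l : tor Z -> hval H Z = 0 -> cofin (fun y => reg C (setc Z (hfirst H) y)) ->
    rlim (fun y => F (setc Z (hfirst H) y)) (co Z (hfirst H)) l -> G Z = 0.
  move=> tZ Z0 Hr Hl; have c0 := co_neq0 (hfirst H) tZ.
  have L1 := rlim_LF_setc (hfirst H) (LF_hval H) tZ c0.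
  have L2 := rlim_LF_setc (hfirst H) (LF_hprod s) tZ c0.
  have L3 := rlim_LF_setc (hfirst H) LG tZ c0.
  have := rlimM L1 (rlimM L2 Hl); move: L3; rewrite !setc_co Z0 mul0r.
  move=> L3 L4; apply: rlim_uniq L3 _; apply: rlim_near L4.
  by apply: cofinW (cofinI (cofin_tor_setc (hfirst H) tZ) Hr) _ => y [ty ry]; apply: E.
case: H HC E lim0 => [[a k]|[a b]] /= HC E lim0.
  suff H0 Z : tor Z -> co Z a = k -> G Z = 0.
    by move=> Z tZ /eqP; rewrite subr_eq0 => /eqP; apply: H0.
  move: Z; apply: (@densc K n G S a k LG) => Z tZ Ea R1 R2.
  have [l Hl] := Fc HC tZ Ea R1 R2.
  apply: (lim0 Z l) => //; rewrite ?Ea ?subrr //.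
  apply: cofin_reg_setc => // [b /R1|b d bd _ _]; last by rewrite -[co Z d]mul1r R2.
  by apply: contraNN; apply: CS.
suff H0 Z : tor Z -> co Z a = co Z b -> G Z = 0.
  by move=> Z tZ /eqP; rewrite subr_eq0 => /eqP; apply: H0.
move: Z; apply: (@densd K n G S a b HC LG) => Z tZ Ea R1 R2.
have [l Hl] := Fd HC tZ Ea R1 R2.
apply: (lim0 Z l) => //; rewrite ?Ea ?subrr //.
apply: cofin_reg_setc => // [c _|c d cd ca da].
  by apply: contraNN (R1 c); apply: CS.
rewrite -[co Z d]mul1r R2 //.
rewrite !inE; apply/negP => /or4P[] /eqP Ecd.
- by move/(congr1 (fun p => p.1.1)): Ecd ca => /= ->; rewrite eqxx.
- by move/(congr1 (fun p => p.2.1)): Ecd da => /= ->; rewrite eqxx.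
- by move/(congr1 (fun p => p.1.1)): Ecd ca => /= ->; rewrite eqxx.
- by move/(congr1 (fun p => p.2.1)): Ecd da => /= ->; rewrite eqxx.
Qed.

(** The factors of the denominator are divided out of G one at a time by [LF_divide]. The value
    substituted for a coordinate must be invertible, whence the hypothesis that 0 is not in C. *)
Lemma pole_removal : MF C F ->
  exists2 G, LF G & forall Z, tor Z -> reg C Z -> F Z = G Z.
Proof.
case=> s [G [Hs LG E]]; elim: s G Hs LG E => [|H s IH] G Hs LG E.
  by exists G => // Z tZ rZ; rewrite -E // /hprod big_nil mul1r.
have HC : hypin C H by apply: Hs; rewrite mem_head.
have E' Z : tor Z -> reg C Z -> hval H Z * (hprod s Z * F Z) = G Z.
  by move=> tZ rZ; rewrite -E // /hprod big_cons mulrA.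
have G0 := removal_step HC LG E'.
pose w Z := match H with inl p => p.2 | inr p => co Z p.2 end.
have w0 Z : tor Z -> w Z != 0.
  move=> tZ; rewrite /w; case: (H) HC => [[a k]|[a b]] /= HC; last exact: co_neq0.
  by apply: contraNneq C0 => <-.
have Lw : LF w.
  by rewrite /w; case: (H) => [[a k]|[a b]] /=; [apply: LF_cst|apply: LF_co].
have LwV : LF (fun Z => (w Z)^-1).
  rewrite /w; case: (H) => [[a k]|[a b]] /=; first exact: LF_cst.
  by apply: LF_ext (LF_co K (opp b)) => Z _; rewrite co_opp.
have [g Lg Eg] := LF_divide (hfirst H) LG Lw LwV w0.
have hw Z : co Z (hfirst H) - w Z = hval H Z.
  by rewrite /w; case: (H) => [[a k]|[a b]].
apply: (IH g) => //.
  by move=> H' sH'; apply: Hs; rewrite inE sH' orbT.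
move=> Z tZ rZ; have h0 := reg_hval rZ HC.
apply: (mulfI h0); rewrite E' // -hw -Eg // [G (setc _ _ _)]G0 ?subr0 //.
  by apply: tor_setc; rewrite ?w0.
rewrite /w; case: (H) HC => [[a k]|[a b]] /= HC; first by rewrite co_setc subrr.
by rewrite co_setc co_setc_neq 1?eq_sym // subrr.
Qed.
End Removal.
End PoleRemoval.

(** * The operator on the torus *)

Section TorusOperator.
Variables (K : numFieldType) (n : nat) (q : K).
Hypotheses (q0 : q != 0) (hq : forall N : nat, (0 < N)%N -> q ^+ N != 1).
Variables (k : nat) (LL : bool -> nat * nat) (kap cst : K) (Y : 'I_n -> K).
Hypotheses (HLL : forall b, odd ((LL b).1 + (LL b).2)) (tY : tor Y).
Local Notation pt := ('I_n -> K).
Local Notation sidx := ('I_n * bool)%type.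
Local Notation expo := {ffun 'I_n -> int}.
Implicit Types (Z : pt) (a b c d : sidx) (mu nu h : expo) (f g : pt -> K) (e : bool).

Definition tr mu Z : pt := cv Z mu q.
(** Conjugation by the plane wave turns the shift by mu/2 in z into this operator: Z_i is multiplied
    by q^(mu_i) and the wave contributes Y^mu. The unit shifts are thus mu = 2 e_a. *)
Definition TT mu f Z : K := mon Y mu * f (tr mu Z).
Definition sgK e : K := (-1) ^+ e.
Definition pnum (w : K) : K := q ^ (- k%:Z) * w - q ^ k%:Z.
(** This is (t w^(1/2) - t^-1 w^(-1/2)) / (w^(1/2) - w^(-1/2)) at t = q^-k, freed of square
    roots. *)
Definition pf (w : K) : K := pnum w / (w - 1).
(** [LL] stands for the doubled parameters, (2l, 2l') at [false] and (2m, 2m') at [true], and U for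
    q^(2u). The monomials split off from v^+ are collected in [kap]. *)
Definition vfac e (U : K) : K :=
  (U - sgK e * q ^ (LL e).1%:Z) * (U - sgK e * q ^ (LL e).2%:Z).
Definition vv (U : K) : K :=
  kap * \prod_(e : bool) (vfac e U / ((U - sgK e) * (U - sgK e * q^-1))).
Definition vc a Z : K :=
  vv (co Z a) * \prod_(b : sidx | b.1 != a.1) pf (co Z a * co Z b).
Definition Dop f Z : K :=
  \sum_(a : sidx) vc a Z * (TT (unitv a 2) f Z - f Z) + cst * f Z.

(** The relation 0 < p/2 ≼ (l, l'), or (m, m') when e is true, in doubled parameters. *)
Definition adm e (p : nat) : bool :=
  (0 < p)%N && (((p <= (LL e).1) && ~~ odd ((LL e).1 - p)) ||
                ((p <= (LL e).2) && ~~ odd ((LL e).2 - p)))%N.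
Definition cond1 f := forall Z a e p, tor Z -> co Z a = sgK e -> adm e p ->
  TT (unitv a p%:Z) f Z = TT (unitv a (- p%:Z)) f Z.
Definition cond2 f := forall Z a b s, tor Z -> a.1 != b.1 -> co Z a = co Z b ->
  (1 <= s <= k)%N -> TT (unitv a (2 * s%:Z)) f Z = TT (unitv b (2 * s%:Z)) f Z.

Definition poles : seq K :=
  [:: sgK false; sgK true; sgK false * q^-1; sgK true * q^-1].

Lemma polesP U : reflect (forall e, U != sgK e /\ U != sgK e * q^-1) (U \notin poles).
Proof.
rewrite !inE !negb_or; apply: (iffP and4P) => [[h1 h2 h3 h4] []//|H].
by case: (H true) => ? ?; case: (H false).
Qed.

Lemma sgKK e : sgK e * sgK e = 1.
Proof. by rewrite -expr2 sqrr_sign. Qed.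

Lemma sgK_neq0 e : sgK e != 0. Proof. by rewrite signr_eq0. Qed.

Lemma sgKV e : (sgK e)^-1 = sgK e.
Proof. by apply: (mulfI (sgK_neq0 e)); rewrite mulfV ?sgK_neq0 ?sgKK. Qed.

Lemma sgK_inj e e' : (sgK e == sgK e') = (e == e').
Proof.
exact: (inj_eq (@signr_inj K)).
Qed.

Lemma qz1 (p : int) : q ^ p = 1 -> p = 0.
Proof.
case: p => [[|N] //|N] E; first by have := hq (ltn0Sn N); rewrite -E eqxx.
have := hq (ltn0Sn N); suff -> : q ^+ N.+1 = 1 by rewrite eqxx.
by apply: invr_inj; rewrite invr1.
Qed.

Lemma qz_inj (p r : int) : q ^ p = q ^ r -> p = r.
Proof.
move=> E; apply/eqP; rewrite -subr_eq0; apply/eqP/qz1.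
by rewrite expfzDr // -invr_expz E mulfV // expfz_neq0.
Qed.

(** Squaring removes the signs, and q is not a root of unity. *)
Lemma sgKq_inj e e' (p r : int) : sgK e * q ^ p = sgK e' * q ^ r -> p = r.
Proof.
move=> E; have /qz_inj : q ^ (p * 2) = q ^ (r * 2).
  rewrite -!exprz_exp -[LHS]mul1r -[RHS]mul1r -{1}(sgKK e) -(sgKK e').
  by rewrite -!exprnP -!expr2 -!exprMn E.
lia.
Qed.

Lemma sgKq_poles e (p : int) : p != 0 -> p != -1 -> sgK e * q ^ p \notin poles.
Proof.
move=> p0 p1; apply/polesP => e'; split.
  by apply: contraNneq p0 => E; apply/eqP/(@sgKq_inj e e'); rewrite E mulr1.
by apply: contraNneq p1 => E; apply/eqP/(@sgKq_inj e e').
Qed.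

Lemma trD mu nu Z : tr (mu + nu) Z = tr mu (tr nu Z).
Proof.
by apply/funext => i; rewrite /tr /cv ffunE expfzDr // -mulrA [X in _ * X]mulrC.
Qed.

Lemma tr0 Z : tr 0 Z = Z.
Proof. by apply/funext => i; rewrite /tr /cv ffunE mulr1. Qed.

Lemma tor_tr mu Z : tor Z -> tor (tr mu Z).
Proof. exact: tor_cv. Qed.

Lemma TT_tr mu nu f Z : mon Y nu * TT mu f (tr nu Z) = TT (mu + nu) f Z.
Proof. by rewrite /TT mulrA -monD // trD addrC. Qed.

Lemma co_tr mu Z a : co (tr mu Z) a = co Z a * q ^ eco mu a.
Proof. exact: co_cv. Qed.

Lemma TT_congr mu f g Z : f (tr mu Z) = g (tr mu Z) -> TT mu f Z = TT mu g Z.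
Proof. by rewrite /TT => ->. Qed.

Lemma LF_TT mu f : LF f -> LF (TT mu f).
Proof. by move=> Lf; apply: LFM (LF_cst n _) (LF_cv _ _ Lf). Qed.

Lemma eco_unitv a p b :
  eco (unitv a p) b = if b.1 == a.1 then (if b == a then p else - p) else 0.
Proof.
case: a b => [a a'] [b b']; rewrite /eco ffunE /sgi /= xpair_eqE.
case: (b =P a) => _ /=; last by rewrite oppr0 if_same.
by case: a' b' => [] [] //=; rewrite opprK.
Qed.

Lemma unitv_opp a p : unitv (opp a) p = unitv a (- p).
Proof.
apply/ffunP => i; rewrite !ffunE /opp /sgi /=.
by case: ifP => // _; case: a.2 => //=; rewrite opprK.
Qed.

Lemma unitvD a p r : unitv a p + unitv a r = unitv a (p + r).
Proof.
by apply/ffunP => i; rewrite !ffunE /sgi; case: ifP => // _; case: a.2; rewrite ?opprD.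
Qed.

Lemma unitv0 a : unitv a 0 = 0.
Proof. by apply/ffunP => i; rewrite !ffunE /sgi; case: a.2; rewrite ?oppr0 if_same. Qed.

Lemma TT_Dop mu f Z : TT mu (Dop f) Z =
  \sum_(a : sidx) vc a (tr mu Z) * (TT (mu + unitv a 2) f Z - TT mu f Z)
  + cst * TT mu f Z.
Proof.
rewrite {1}/TT /Dop mulrDr mulr_sumr; congr (_ + _); last by rewrite mulrCA.
apply: eq_bigr => a _; rewrite mulrCA mulrBr; congr (_ * (_ - _)).
by rewrite TT_tr addrC.
Qed.

Lemma vc_equiv (s : sidx -> sidx) Z Z' : involutive s ->
  (forall c d, ((s c).1 == (s d).1) = (c.1 == d.1)) ->
  (forall c, co Z' (s c) = co Z c) -> forall c, vc (s c) Z' = vc c Z.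
Proof.
move=> sK s1 E c; rewrite /vc E; congr (_ * _).
rewrite (reindex_inj (inv_inj sK)) /=.
by apply: eq_big => [d|d _]; rewrite ?s1 // E.
Qed.

(** The coefficients of D are equivariant under signed permutations. When s carries one shifted
    point to the other, an identity for D f reduces to comparing the terms c and s c, except where
    the coefficient is zero. *)
Lemma Dop_sym f (s : sidx -> sidx) mu nu Z : involutive s ->
  (forall c d, ((s c).1 == (s d).1) = (c.1 == d.1)) ->
  (forall c, co (tr nu Z) (s c) = co (tr mu Z) c) ->
  TT mu f Z = TT nu f Z ->
  (forall c, vc c (tr mu Z) = 0 \/
     TT (mu + unitv c 2) f Z = TT (nu + unitv (s c) 2) f Z) ->
  TT mu (Dop f) Z = TT nu (Dop f) Z.
Proof.
move=> sK s1 E E1 E2; rewrite !TT_Dop E1; congr (_ + _).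
rewrite [RHS](reindex_inj (inv_inj sK)) /=; apply: eq_bigr => c _.
rewrite (vc_equiv sK s1 E).
by case: (E2 c) => ->; rewrite ?mul0r.
Qed.

(** The reflections of the hyperoctahedral group acting on signed indices: [flipi] in e_i, and
    [swapi] in e_a - e_b for signed a and b. *)
Definition flipi (i : 'I_n) (c : sidx) : sidx := if c.1 == i then opp c else c.
Definition swapi a b (c : sidx) : sidx :=
  if c == a then b else if c == b then a
  else if c == opp a then opp b else if c == opp b then opp a else c.

Lemma flipiK i : involutive (flipi i).
Proof.
move=> c; rewrite /flipi; case h : (c.1 == i); last by rewrite h.
by rewrite /= h oppK.
Qed.

Lemma flipi1 i c d : ((flipi i c).1 == (flipi i d).1) = (c.1 == d.1).
Proof. by rewrite /flipi; case: (c.1 == i); case: (d.1 == i). Qed.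

Lemma swapiE a b c : a.1 != b.1 -> swapi a b c =
  if c.1 == a.1 then (b.1, (c.2 (+) a.2) (+) b.2)
  else if c.1 == b.1 then (a.1, (c.2 (+) b.2) (+) a.2) else c.
Proof.
case: a b c => [a a'] [b b'] [c c'] /= ab; rewrite /swapi /opp /= !xpair_eqE.
case: (c =P a) => [->|_] /=.
  by rewrite (negPf ab) /=; case: a' b' c' => [] [] [].
by case: (c =P b) => [->|_] //=; case: a' b' c' => [] [] [].
Qed.

Lemma swapiK a b : a.1 != b.1 -> involutive (swapi a b).
Proof.
move=> ab c; rewrite !swapiE //; case: (c.1 =P a.1) => [ca|ca] /=.
  rewrite eq_sym (negPf ab) eqxx -ca; case: c {ca} => x y /=.
  by case: a.2; case: b.2; case: y.
case: (c.1 =P b.1) => [cb|cb] /=; last by move/eqP/negPf: ca => ->; move/eqP/negPf: cb => ->.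
rewrite eqxx -cb; case: c {ca cb} => x y /=.
by case: a.2; case: b.2; case: y.
Qed.

Lemma swapi1 a b : a.1 != b.1 ->
  forall c d, ((swapi a b c).1 == (swapi a b d).1) = (c.1 == d.1).
Proof.
move=> ab c d; rewrite !swapiE //.
case: (c.1 =P a.1) => [ca|/eqP ca]; case: (d.1 =P a.1) => [da|/eqP da] /=;
  rewrite ?ca ?da ?eqxx //.
- case: (d.1 =P b.1) => [db|/eqP db] /=; first by rewrite db eq_sym.
  by rewrite ![_ == d.1]eq_sym (negPf da) (negPf db).
- case: (c.1 =P b.1) => [cb|/eqP cb] /=; first by rewrite cb eq_sym.
  by rewrite (negPf ca) (negPf cb).
- case: (c.1 =P b.1) => [cb|/eqP cb]; case: (d.1 =P b.1) => [db|/eqP db] /=;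
    rewrite ?cb ?db ?eqxx //.
  + by rewrite ![_ == d.1]eq_sym (negPf da) (negPf db).
  + by rewrite (negPf ca) (negPf cb).
Qed.
End TorusOperator.

(** * Conditions (3) and (4) are inherited by D f *)

Section PairConditions.
Variables (K : numFieldType) (n : nat) (q : K).
Hypotheses (q0 : q != 0) (hq : forall N : nat, (0 < N)%N -> q ^+ N != 1).
Variables (k : nat) (LL : bool -> nat * nat) (kap cst : K) (Y : 'I_n -> K).
Hypotheses (HLL : forall b, odd ((LL b).1 + (LL b).2)) (tY : tor Y).
Local Notation pt := ('I_n -> K).
Local Notation sidx := ('I_n * bool)%type.
Local Notation expo := {ffun 'I_n -> int}.
Local Notation tr := (tr q).
Local Notation TT := (TT q Y).
Local Notation pnum := (pnum q k).
Local Notation pf := (pf q k).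
Local Notation vc := (vc q k LL kap).
Local Notation Dop := (Dop q k LL kap cst Y).
Local Notation cond2 := (cond2 q k Y).
Local Notation poles := (poles q).
Implicit Types (Z : pt) (a b c d : sidx) (mu nu h : expo) (f g : pt -> K) (e : bool).

Lemma same_fst a c : c.1 = a.1 -> c = a \/ c = opp a.
Proof.
case: a c => [a a'] [c c'] /= ->; rewrite /opp /=.
by case: a'; case: c'; [left|right|right|left].
Qed.

Variant swapi_spec a b c : sidx -> Prop :=
| Swapi1 of c = a : swapi_spec a b c b
| Swapi2 of c = b : swapi_spec a b c a
| Swapi3 of c = opp a : swapi_spec a b c (opp b)
| Swapi4 of c = opp b : swapi_spec a b c (opp a)
| Swapi5 of c.1 != a.1 & c.1 != b.1 : swapi_spec a b c c.

Lemma swapiP a b c : swapi_spec a b c (swapi a b c).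
Proof.
rewrite /swapi; case: eqP => [?|h1]; first exact: Swapi1.
case: eqP => [?|h2]; first exact: Swapi2.
case: eqP => [?|h3]; first exact: Swapi3.
case: eqP => [?|h4]; first exact: Swapi4.
by apply: Swapi5; apply/eqP => /same_fst[].
Qed.

Lemma opp_fst a : (opp a).1 = a.1. Proof. by []. Qed.

Lemma opp_neq a : (opp a == a) = false.
Proof. by case: a => i []; rewrite /opp xpair_eqE eqxx. Qed.

Lemma co_swapi Z a b c : co Z a = co Z b -> co Z (swapi a b c) = co Z c.
Proof. by move=> E; case: swapiP => [->|->|->|->|//]; rewrite ?co_opp E. Qed.

Lemma eco_unitv_swapi a b p c : a.1 != b.1 ->
  eco (unitv b p) (swapi a b c) = eco (unitv a p) c.
Proof.
move=> ab; have ba : b.1 != a.1 by rewrite eq_sym.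
case: swapiP => [->|->|->|->|ca cb]; rewrite !eco_unitv ?opp_fst ?eqxx ?opp_neq //.
- by rewrite (negPf ab) (negPf ba).
- by rewrite (negPf ab) (negPf ba).
- by rewrite (negPf ca) (negPf cb).
Qed.

Lemma cond2_shift f Z a b s nu : cond2 f -> tor Z -> a.1 != b.1 -> co Z a = co Z b ->
  (s <= k)%N -> eco nu a = eco nu b ->
  TT (unitv a (2 * s%:Z) + nu) f Z = TT (unitv b (2 * s%:Z) + nu) f Z.
Proof.
move=> H tZ ab E; case: s => [|s] sk Enu; first by rewrite mulr0 !unitv0.
rewrite -!TT_tr //; congr (_ * _); apply: H => //; first exact: tor_tr.
by rewrite !co_tr // E Enu.
Qed.

(** The point w = q^(2k) is the zero of the numerator of [pf]; this is what allows the range of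
    shifts to stop at k. *)
Lemma vc_zero Z c d : d.1 != c.1 -> co Z c * co Z d = q ^ (2 * k%:Z) -> vc c Z = 0.
Proof.
move=> dc E; rewrite /vc (bigD1 d) //= E /pf /pnum -expfzDr //.
by rewrite (_ : - k%:Z + 2 * k%:Z = k%:Z) ?subrr ?mul0r ?mulr0 //; lia.
Qed.

(** Up to a common translation, the terms of D compare shifts by s - 1, s or s + 1. For s = k the
    terms that would require k + 1 have coefficient 0 by [vc_zero], and shifts by 0 compare
    trivially. *)
Lemma TT_Dop_swap f Z a b s : cond2 f -> tor Z -> a.1 != b.1 -> co Z a = co Z b ->
  (1 <= s <= k)%N ->
  TT (unitv a (2 * s%:Z)) (Dop f) Z = TT (unitv b (2 * s%:Z)) (Dop f) Z.
Proof.
move=> H tZ ab E /andP[s1 sk].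
have ba : b.1 != a.1 by rewrite eq_sym.
have Cb : co (tr (unitv a (2 * s%:Z)) Z) (opp b) = (co Z a)^-1.
  by rewrite co_tr // eco_unitv opp_fst (negPf ba) expr0z mulr1 co_opp E.
have Ca : co (tr (unitv a (2 * s%:Z)) Z) a = co Z a * q ^ (2 * s%:Z).
  by rewrite co_tr // eco_unitv !eqxx.
have a0 := co_neq0 a tZ.
apply: (@Dop_sym _ _ _ q0 _ _ _ _ _ tY f (swapi a b)) => //.
- exact: swapiK.
- exact: swapi1.
- by move=> c; rewrite !co_tr // eco_unitv_swapi // co_swapi.
- by apply: H; rewrite ?s1.
have up : s = k \/ (s.+1 <= k)%N by lia.
have S1 : 2 * s%:Z + 2 = 2 * s.+1%:Z by lia.
have S2 : 2 * s%:Z = 2 * s.-1%:Z + 2 by lia.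
move=> c; case: swapiP => [->|->|->|->|ca cb].
- case: up => [Es|sk1].
    left; apply: (@vc_zero _ _ (opp b)); rewrite ?opp_fst //.
    by rewrite Ca Cb Es mulrAC mulfV // mul1r.
  right; rewrite !unitvD S1 -[unitv a _]addr0 -[unitv b _]addr0.
  by apply: cond2_shift => //; rewrite /eco !ffunE /sgi; case: a.2; case: b.2; rewrite ?oppr0.
- right.
  have D p : unitv p (2 * s%:Z) = unitv p (2 * s.-1%:Z) + unitv p 2.
    by rewrite unitvD -S2.
  rewrite !D -!addrA [unitv b 2 + _]addrC.
  apply: cond2_shift => //; first lia.
  by rewrite /eco !ffunE -!/(eco _ _); rewrite /sgi; case: a.2; case: b.2; rewrite !eqxx (negPf ab) (negPf ba) /=; lia.
- right; rewrite !unitv_opp !unitvD S2 !addrK -[unitv a _]addr0 -[unitv b _]addr0.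
  apply: cond2_shift => //; first lia.
  by rewrite /eco !ffunE /sgi; case: a.2; case: b.2; rewrite ?oppr0.
- case: up => [Es|sk1].
    left; apply: (@vc_zero _ _ a); rewrite ?opp_fst //.
    by rewrite Ca Cb Es mulrA mulVf // mul1r.
  right; rewrite !unitv_opp.
  have D p : unitv p (2 * s%:Z) = unitv p (2 * s.+1%:Z) + unitv p (- 2).
    by rewrite unitvD; congr unitv; lia.
  rewrite !D -!addrA [unitv b (-2) + _]addrC.
  apply: cond2_shift => //.
  by rewrite /eco !ffunE /sgi; case: a.2; case: b.2; rewrite !eqxx (negPf ab) (negPf ba) /=; lia.
- right; apply: cond2_shift => //.
  by rewrite !eco_unitv [_ == c.1]eq_sym (negPf ca) [_ == c.1]eq_sym (negPf cb).
Qed.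

(** Values to be avoided by coordinates, or by ratios of coordinates, so that shifts by at most N
    steps of q stay regular: the base values [poles] keep coordinates off the poles, and 1 keeps
    them distinct. *)
Definition qshifts (N : nat) : seq K :=
  [seq x * q ^ (j%:Z - N%:Z) | x <- 1 :: poles, j <- iota 0 (N + N).+1].

Lemma mem_qshifts N x (p : int) : x \in 1 :: poles -> `|p| <= N%:Z -> x * q ^ p \in qshifts N.
Proof.
move=> xp pN; apply/allpairsP; exists (x, absz (p + N%:Z)%R); split=> //.
  by rewrite mem_iota /=; lia.
by rewrite /=; congr (_ * _ ^ _); lia.
Qed.

Lemma qshifts1 N (p : int) : `|p| <= N%:Z -> q ^ p \in qshifts N.
Proof. by move=> pN; rewrite -[_ ^ _]mul1r mem_qshifts ?mem_head. Qed.

Lemma qshifts_poles N : {subset poles <= qshifts N}.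
Proof.
move=> x xp; rewrite -[x]mulr1 -[1](expr0z q) mem_qshifts ?normr0 //.
by rewrite inE xp orbT.
Qed.

Lemma co_tr_poles N Z mu c : co Z c \notin qshifts N -> `|eco mu c| <= N%:Z ->
  co (tr mu Z) c \notin poles.
Proof.
move=> H mN; rewrite co_tr //; apply: contraNN H => H.
rewrite -[co Z c](mulfK (expfz_neq0 (eco mu c) q0)) invr_expz.
by apply: mem_qshifts; rewrite ?normrN // inE H orbT.
Qed.

Lemma co_tr_neq N Z mu c d : tor Z ->
  (forall s, s \in qshifts N -> co Z c != s * co Z d) ->
  `|eco mu d - eco mu c| <= N%:Z -> co (tr mu Z) c != co (tr mu Z) d.
Proof.
move=> tZ H mN; rewrite !co_tr //; apply: contra_neq (H _ (qshifts1 mN)) => E.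
apply: (mulIf (expfz_neq0 (eco mu c) q0)).
by rewrite E mulrAC -expfzDr // subrK mulrC.
Qed.

Lemma eco_unitv_le a p b : `|eco (unitv a p) b| <= `|p|.
Proof. by rewrite eco_unitv; case: ifP => _; [case: ifP => _; rewrite ?normrN|rewrite normr0]. Qed.

(** Although Z lies on the polar hyperplane Z_a = Z_b, the shift moves only one of the two
    coordinates, and q^(2s) != 1 separates them. *)
Lemma reg_tr_swap Z a b (s : nat) : tor Z -> a.1 != b.1 -> co Z a = co Z b -> (0 < s)%N ->
  (forall c, co Z c \notin qshifts (4 * s)) ->
  (forall c d, c.1 != d.1 ->
     (c, d) \notin [:: (a, b); (b, a); (opp a, opp b); (opp b, opp a)] ->
     forall r, r \in qshifts (4 * s) -> co Z c != r * co Z d) ->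
  reg poles (tr (unitv a (2 * s%:Z)) Z).
Proof.
move=> tZ ab E s0 R1 R2; have ba : b.1 != a.1 by rewrite eq_sym.
have lt c : `|eco (unitv a (2 * s%:Z)) c| <= 2 * s%:Z.
  by apply: le_trans (eco_unitv_le _ _ _) _; lia.
split=> [c|c d cd].
  by apply: co_tr_poles (R1 c) _; apply: le_trans (lt c) _; lia.
case M : ((c, d) \in [:: (a, b); (b, a); (opp a, opp b); (opp b, opp a)]); last first.
  apply: co_tr_neq (R2 _ _ cd _) _; rewrite ?M //.
  by move: (lt c) (lt d); lia.
have q2 : q ^ (2 * s%:Z) != 1 by apply/eqP => /(qz1 hq); lia.
have a0 := co_neq0 a tZ; have b0 := co_neq0 b tZ.
move: M; rewrite !inE => /or4P[] /eqP[-> ->];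
  rewrite !co_tr // !eco_unitv ?opp_fst ?eqxx ?opp_neq ?(negPf ab) ?(negPf ba) ?expr0z ?mulr1 ?co_opp ?E.
- by apply: contra_neq q2 => /(canRL (mulKf b0)); rewrite mulVf.
- by apply: contra_neq q2 => /esym/(canRL (mulKf b0)); rewrite mulVf.
- apply: contra_neq q2; rewrite -invr_expz -{2}[(co Z b)^-1]mulr1 => /(mulfI (invr_neq0 b0)).
  by move/(congr1 (@GRing.inv K)); rewrite invrK invr1.
- apply: contra_neq q2; rewrite -invr_expz -{1}[(co Z b)^-1]mulr1 => /(mulfI (invr_neq0 b0)).
  by move/(congr1 (@GRing.inv K)); rewrite invrK invr1.
Qed.

Lemma cond2_Dop f g : cond2 f -> LF g ->
  (forall Z, tor Z -> reg poles Z -> g Z = Dop f Z) -> cond2 g.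
Proof.
move=> H Lg E Z a b s tZ ab Eab /andP[s1 sk].
apply/eqP; rewrite -subr_eq0; apply/eqP.
have LG := LFB (LF_TT q0 Y (unitv a (2 * s%:Z)) Lg) (LF_TT q0 Y (unitv b (2 * s%:Z)) Lg).
move: Z tZ Eab; apply: (@densd _ _ _ (qshifts (4 * s)) a b ab LG) => Z tZ Eab R1 R2.
have ba : b.1 != a.1 by rewrite eq_sym.
have ra : reg poles (tr (unitv a (2 * s%:Z)) Z) by apply: reg_tr_swap R1 R2.
have rb : reg poles (tr (unitv b (2 * s%:Z)) Z).
  apply: (@reg_tr_swap _ _ a) => // c d cd M; apply: R2 => //.
  by move: M; rewrite !inE !negb_or => /and4P[-> -> -> ->].
have := @TT_Dop_swap f Z a b s H tZ ab Eab; rewrite s1 sk => /(_ isT).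
by rewrite -!(TT_congr Y (E _ (tor_tr q0 _ tZ) _)) // => ->; rewrite subrr.
Qed.
End PairConditions.

(** * Local behaviour of the coefficients and cancellation of simple poles *)

Section LocalAnalysis.
Variables (K : numFieldType) (n : nat) (q : K).
Hypotheses (q0 : q != 0) (hq : forall N : nat, (0 < N)%N -> q ^+ N != 1).
Variables (k : nat) (LL : bool -> nat * nat) (kap cst : K) (Y : 'I_n -> K).
Hypotheses (HLL : forall b, odd ((LL b).1 + (LL b).2)) (tY : tor Y).
Local Notation pt := ('I_n -> K).
Local Notation sidx := ('I_n * bool)%type.
Local Notation expo := {ffun 'I_n -> int}.
Local Notation tr := (tr q).
Local Notation TT := (TT q Y).
Local Notation sgK := (sgK K).
Local Notation pnum := (pnum q k).
Local Notation pf := (pf q k).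
Local Notation vfac := (vfac q LL).
Local Notation vv := (vv q LL kap).
Local Notation vc := (vc q k LL kap).
Local Notation poles := (poles q).
Implicit Types (Z : pt) (a b c d : sidx) (mu nu h : expo) (f g : pt -> K) (e : bool).

Definition rcurve (ga : K -> pt) y Z :=
  [/\ tor Z, cofin (fun z => tor (ga z)) & forall i, rlim (fun z => ga z i) y (Z i)].

Lemma rcurve_LF ga y Z f : rcurve ga y Z -> LF f -> rlim (fun z => f (ga z)) y (f Z).
Proof. by case=> *; apply: rlim_LF. Qed.

Lemma rcurve_setc Z a y : tor Z -> y != 0 -> rcurve (setc Z a) y (setc Z a y).
Proof.
move=> tZ y0; split; [exact: tor_setc|exact: cofin_tor_setc|] => i.
exact: (rlim_LF_setc a (LF_var _ i) tZ y0).
Qed.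

Lemma rcurve_tr ga y Z mu : rcurve ga y Z -> rcurve (fun z => tr mu (ga z)) y (tr mu Z).
Proof.
move=> Hc; case: (Hc) => tZ tc _; split; first exact: tor_tr.
  by apply: cofinW tc _ => z; apply: tor_tr.
by move=> i; exact: (rcurve_LF Hc (LF_cv mu q0 (LF_var K i))).
Qed.

Definition pole e (r : bool) : K := sgK e * (if r then q^-1 else 1).
(** The cofactor of the simple pole [pole e r] in [vv], regular at that point. *)
Definition vres e (r : bool) (U : K) : K :=
  kap * (vfac e U / (U - pole e (~~ r))) *
  (vfac (~~ e) U / ((U - sgK (~~ e)) * (U - sgK (~~ e) * q^-1))).
Definition vpr a Z : K := \prod_(b : sidx | b.1 != a.1) pf (co Z a * co Z b).

Lemma vv_res e r U : vv U = vres e r U / (U - pole e r).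
Proof.
rewrite /vv /vres /pole /= big_bool /=.
by case: e; case: r; rewrite /= ?mulr1 !invfM; ring.
Qed.

Lemma rlim_vfac u y U e : rlim u y U -> rlim (fun z => vfac e (u z)) y (vfac e U).
Proof. by move=> Hu; apply: rlimM; apply: rlimB => //; apply: rlim_cst. Qed.

Lemma rlim_sub u y U (s : K) : rlim u y U -> rlim (fun z => u z - s) y (U - s).
Proof. by move=> Hu; apply: rlimB => //; apply: rlim_cst. Qed.

Lemma rlim_div F G y (A B : K) : B != 0 -> rlim F y A -> rlim G y B ->
  rlim (fun z => F z / G z) y (A / B).
Proof. by move=> B0 HF HG; apply/rlimM/rlimV. Qed.

Lemma rlim_vv u y U : U \notin poles -> rlim u y U -> rlim (fun z => vv (u z)) y (vv U).
Proof.
move=> /polesP H Hu; apply: rlimMl.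
apply: rlim_prod => e _; case: (H e) => h1 h2.
apply: rlim_div; first by rewrite mulf_neq0 ?subr_eq0.
  exact: rlim_vfac.
by apply: rlimM; apply: rlim_sub.
Qed.

Lemma sgK_qV e e' : sgK e * q^-1 != sgK e'.
Proof.
apply/eqP => E; suff /(sgKq_inj q0 hq) : sgK e * q ^ (-1) = sgK e' * q ^ 0 by [].
by rewrite expr0z mulr1.
Qed.

Lemma pole_neq e r : pole e r != pole e (~~ r).
Proof.
have H : sgK e * q ^ 0 != sgK e * q ^ (-1).
  by apply/eqP => /(sgKq_inj q0 hq).
by rewrite /pole; case: r => //=; rewrite eq_sym.
Qed.

Lemma pole_neqC e r : pole e r != sgK (~~ e) /\ pole e r != sgK (~~ e) * q^-1.
Proof.
have s0 : sgK e != sgK (~~ e) by rewrite sgK_inj; case: e.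
have H r1 r2 : pole e r1 != pole (~~ e) r2.
  rewrite /pole; case: r1; case: r2; rewrite ?mulr1 //.
  - by apply: contra_neq s0 => /(mulIf (invr_neq0 q0)).
  - exact: sgK_qV.
  - by rewrite eq_sym sgK_qV.
by split; [have := H r false|have := H r true]; rewrite /pole ?mulr1.
Qed.

Lemma rlim_vres u y e r : rlim u y (pole e r) ->
  rlim (fun z => vres e r (u z)) y (vres e r (pole e r)).
Proof.
move=> Hu; case: (pole_neqC e r) => h1 h2.
apply: rlimM; first apply: rlimMl.
  apply: rlim_div; rewrite ?subr_eq0 ?pole_neq //; [exact: rlim_vfac|exact: rlim_sub].
apply: rlim_div; first by rewrite mulf_neq0 ?subr_eq0.
  exact: rlim_vfac.
by apply: rlimM; apply: rlim_sub.
Qed.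

Lemma rlim_pnum w y (W : K) : rlim w y W -> rlim (fun z => pnum (w z)) y (pnum W).
Proof. by move=> Hw; apply/rlim_sub/rlimMl. Qed.

Lemma rlim_pf w y (W : K) : W != 1 -> rlim w y W -> rlim (fun z => pf (w z)) y (pf W).
Proof.
by move=> W1 Hw; apply: rlim_div; rewrite ?subr_eq0 //; [apply: rlim_pnum|apply: rlim_sub].
Qed.

Lemma rlim_co2 ga y Z a b : rcurve ga y Z ->
  rlim (fun z => co (ga z) a * co (ga z) b) y (co Z a * co Z b).
Proof.
by move=> Hc; apply: rlimM; [exact: (rcurve_LF Hc (LF_co K a))|exact: (rcurve_LF Hc (LF_co K b))].
Qed.

Lemma rlim_vpr ga y Z a : rcurve ga y Z ->
  (forall b, b.1 != a.1 -> co Z a * co Z b != 1) ->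
  rlim (fun z => vpr a (ga z)) y (vpr a Z).
Proof.
by move=> Hc H; apply: rlim_prod => b ba; apply: rlim_pf (H b ba) _; apply: rlim_co2.
Qed.

Lemma rlim_vc ga y Z a : rcurve ga y Z -> co Z a \notin poles ->
  (forall b, b.1 != a.1 -> co Z a * co Z b != 1) ->
  rlim (fun z => vc a (ga z)) y (vc a Z).
Proof.
move=> Hc Ha Hb; apply: rlimM; last exact: rlim_vpr.
by apply: rlim_vv => //; exact: (rcurve_LF Hc (LF_co K a)).
Qed.

Lemma rlim_TT ga y Z mu f : rcurve ga y Z -> LF f ->
  rlim (fun z => TT mu f (ga z)) y (TT mu f Z).
Proof. by move=> Hc Lf; exact: (rcurve_LF Hc (LF_TT q0 Y mu Lf)). Qed.

(** With s = [sgK e] one has s^2 = 1 and 1/y - s = - (y - s) s/y, so equal limits of F and G give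
    opposite residues. *)
Lemma rlim_inv_pair F G e x : rlim F (sgK e) x -> rlim G (sgK e) x ->
  exists l, rlim (fun y => F y / (y - sgK e) + G y / (y^-1 - sgK e)) (sgK e) l.
Proof.
move=> HF HG.
have [|l Hl] := @rlim_div_root K (fun y => F y - sgK e * y * G y) (sgK e).
  have := rlimB HF (rlimM (rlimMl (sgK e) (rlim_id (sgK e))) HG).
  by rewrite sgKK mul1r subrr.
exists l; apply: rlim_near Hl.
apply: cofinW (cofinI (cofin_neq 0) (cofin_neq (sgK e))) _ => y [y0 y1].
have ys : y - sgK e != 0 by rewrite subr_eq0.
have E : y^-1 - sgK e = - (y - sgK e) * (sgK e / y).
  by rewrite mulrA mulNr mulrBl sgKK opprB mulrBl mul1r mulrAC mulfV // mul1r.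
rewrite E invfM invrN invfM invrK sgKV.
by field.
Qed.

(** In w the residues of pf(w) and pf(1/w) at w = 1 are [pnum 1] and its opposite. They cancel when
    the accompanying limits agree, and are zero anyway when [pnum 1 = 0], which is the case k =
    0. *)
Lemma rlim_pf_pair (w g A B al be : K -> K) y (g0 x x1 x2 : K) :
  cofin (fun z => w z - 1 = (z - y) * g z) -> cofin (fun z => w z != 0) ->
  rlim g y g0 -> g0 != 0 -> rlim A y x -> rlim B y x -> rlim al y x1 -> rlim be y x2 ->
  pnum 1 = 0 \/ x1 = x2 ->
  exists l, rlim (fun z => A z * pf (w z) * al z + B z * pf (w z)^-1 * be z) y l.
Proof.
move=> Hw w0 Hg g00 HA HB Hal Hbe H12.
have Lw : rlim w y 1.
  have := rlimD (rlimM (rlim_sub y (rlim_id y)) Hg) (rlim_cst 1 y).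
  rewrite subrr mul0r add0r; apply: rlim_near.
  by apply: cofinW Hw _ => z <-; rewrite subrK.
have LwV : rlim (fun z => (w z)^-1) y 1.
  by have := rlimV (oner_neq0 K) Lw; rewrite invr1.
have LN := rlim_div g00 (rlimB (rlimM (rlimM HA Hal) (rlim_pnum Lw))
   (rlimM (rlimM (rlimM HB Hbe) Lw) (rlim_pnum LwV))) Hg.
have [|l Hl] := rlim_div_root (F := fun z => (A z * al z * pnum (w z) - B z * be z * w z * pnum (w z)^-1) / g z) (y := y).
  suff <- : (x * x1 * pnum 1 - x * x2 * 1 * pnum 1) / g0 = 0 by [].
  by case: H12 => ->; rewrite ?mulr0 ?mulr1 ?subrr ?mul0r.
exists l; apply: rlim_near Hl.
have gn0 : cofin (fun z => g z != 0).
  case: (rlimV g00 Hg) => P [S [S0 PS HP]].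
  have P0 : P.[y] != 0 by rewrite PS mulf_neq0 // invr_eq0.
  have : P != 0 by apply: contraNneq P0 => ->; rewrite horner0.
  move/cofin_poly/(cofinI HP)/cofinW; apply=> z [<-].
  by apply: contraNneq => ->; rewrite invr0 mul0r.
apply: cofinW (cofinI (cofin_neq y) (cofinI gn0 (cofinI Hw w0))) _ => z [zy [gz [Ew wz]]].
have zy0 : z - y != 0 by rewrite subr_eq0.
rewrite /pf; have -> : (w z)^-1 - 1 = - ((w z) - 1) / w z.
  by rewrite mulNr mulrBl mulfV // mul1r opprB.
by rewrite Ew; field; apply/and3P.
Qed.
End LocalAnalysis.

(** * Cancellation of the poles at Z_a = 1, -1, 1/q, -1/q *)

Section PoleCancellation.
Variables (K : numFieldType) (n : nat) (q : K).
Hypotheses (q0 : q != 0) (hq : forall N : nat, (0 < N)%N -> q ^+ N != 1).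
Variables (k : nat) (LL : bool -> nat * nat) (kap cst : K) (Y : 'I_n -> K).
Hypotheses (HLL : forall b, odd ((LL b).1 + (LL b).2)) (tY : tor Y).
Local Notation pt := ('I_n -> K).
Local Notation sidx := ('I_n * bool)%type.
Local Notation expo := {ffun 'I_n -> int}.
Local Notation tr := (tr q).
Local Notation TT := (TT q Y).
Local Notation sgK := (sgK K).
Local Notation vfac := (vfac q LL).
Local Notation vc := (vc q k LL kap).
Local Notation Dop := (Dop q k LL kap cst Y).
Local Notation adm := (adm LL).
Local Notation cond1 := (cond1 q LL Y).
Local Notation poles := (poles q).
Local Notation vpr := (vpr q k).
Local Notation vres := (vres q LL kap).
Local Notation pole := (pole q).
Implicit Types (Z : pt) (a b c d : sidx) (mu nu h : expo) (f g : pt -> K) (e : bool).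

Lemma fst_eqE a c : (c.1 == a.1) = (c == a) || (c == opp a).
Proof.
case: a c => [a a'] [c c']; rewrite /opp !xpair_eqE /= -andb_orr.
by case: a'; case: c'; rewrite ?andbT.
Qed.

Lemma sum_sidx a (F : sidx -> K) :
  \sum_c F c = F a + F (opp a) + \sum_(c | c.1 != a.1) F c.
Proof.
rewrite (bigD1 a) //= (bigD1 (opp a)) ?opp_neq //= addrA; congr (_ + _).
by apply: eq_bigl => c; rewrite fst_eqE negb_or.
Qed.

Lemma co_mul_neq1 Z b d : tor Z -> co Z b != co Z (opp d) -> co Z b * co Z d != 1.
Proof.
move=> tZ; apply: contra_neq => E; rewrite co_opp.
by apply: (mulIf (co_neq0 d tZ)); rewrite E mulVf ?co_neq0.
Qed.

Lemma poles_pole x : x \in poles -> exists e r, x = pole e r.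
Proof.
rewrite !inE /pole => /or4P[] /eqP ->.
- by exists false, false; rewrite mulr1.
- by exists true, false; rewrite mulr1.
- by exists false, true.
- by exists true, true.
Qed.

Lemma poles1 : 1 \in poles. Proof. by rewrite !inE /sgK expr0 eqxx. Qed.

(** The two parameters have an odd sum, so one of them is odd and hence at least 1. *)
Lemma adm1 e : adm e 1.
Proof.
by have := HLL e; rewrite /adm; case: (LL e) => x y /=; clear; lia.
Qed.

(** Since the two parameters have opposite parity, p is bounded by the one of its own parity. If p +
    2 exceeds that bound and p does not, p is equal to it, which makes it a root of [vfac]. *)
Lemma vfac0 e (p : nat) : adm e p || (p == 0%N) ->
  ~~ adm e (p + 2) -> vfac e (sgK e * q ^ p%:Z) = 0.
Proof.
have := HLL e; rewrite /vfac /adm; case: (LL e) => x y /= o h1 h2.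
suff : (p == x) || (p == y) by case/orP => /eqP ->; rewrite subrr ?mul0r ?mulr0.
by clear -o h1 h2; lia.
Qed.

Definition exlim (F : K -> K) (y : K) := exists l, rlim F y l.

Lemma exlimD F G y : exlim F y -> exlim G y -> exlim (fun z => F z + G z) y.
Proof. by move=> [l Hl] [m Hm]; exists (l + m); apply: rlimD. Qed.

Lemma exlim_near F G y : cofin (fun z => F z = G z) -> exlim F y -> exlim G y.
Proof. by move=> FG [l Hl]; exists l; apply: rlim_near FG Hl. Qed.

Definition term f c Z := vc c Z * (TT (unitv c 2) f Z - f Z).

Lemma rlim_term ga y Z f c : rcurve ga y Z -> LF f -> co Z c \notin poles ->
  (forall b, b.1 != c.1 -> co Z c * co Z b != 1) ->
  rlim (fun z => term f c (ga z)) y (term f c Z).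
Proof.
move=> Hga Lf h1 h2; apply: rlimM; first exact: rlim_vc.
by apply: rlimB; [apply: rlim_TT|exact: (rcurve_LF Hga Lf)].
Qed.

(** At [sgK e / q] only the term of a is singular, and its difference vanishes by the condition for
    p = 1 at the half-shifted point. At [sgK e] the terms of a and [opp a] are both singular; their
    residues cancel by the condition for p = 2, or each is zero through [vfac0] when 2 is not
    admissible. *)
Lemma Dop_nopole_c f a x Z : LF f -> cond1 f -> x \in poles -> tor Z -> co Z a = x ->
  (forall b, b.1 != a.1 -> co Z b \notin poles) -> sep poles Z ->
  exlim (fun y => Dop f (setc Z a y)) x.
Proof.
move=> Lf Hf /poles_pole[e [r ->]] {x} tZ Ea R1 R2.
have x0 : pole e r != 0 by rewrite -Ea co_neq0.
have Hga : rcurve (setc Z a) (pole e r) Z.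
  by have := rcurve_setc a tZ x0; rewrite -{2}Ea setc_co.
have R2' b d : b.1 != d.1 -> co Z b * co Z d != 1.
  by move=> bd; apply: co_mul_neq1 => //; rewrite -[co Z (opp d)]mul1r R2 // poles1.
suff H : exlim (fun y => term f a (setc Z a y) + term f (opp a) (setc Z a y)) (pole e r).
  have HS : exlim (fun y => \sum_(c | c.1 != a.1) term f c (setc Z a y)) (pole e r).
    eexists; apply: rlim_sum => c ca; apply: (rlim_term Hga Lf); first exact: R1.
    by move=> b bc; apply: R2'; rewrite eq_sym.
  have HC : exlim (fun y => cst * f (setc Z a y)) (pole e r).
    by eexists; apply: rlimMl; exact: (rcurve_LF Hga Lf).
  apply: exlim_near (exlimD (exlimD H HS) HC); apply: cofinT => y.
  by rewrite /Dop (sum_sidx a).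
pose al c := fun y => TT (unitv c 2) f (setc Z a y) - f (setc Z a y).
have Lal c : rlim (al c) (pole e r) (TT (unitv c 2) f Z - f Z).
  by apply: rlimB; [apply: rlim_TT|exact: (rcurve_LF Hga Lf)].
have Lpr c : c.1 = a.1 -> rlim (fun y => vpr c (setc Z a y)) (pole e r) (vpr c Z).
  by move=> ca; apply: rlim_vpr => // b bc; apply: R2'; rewrite eq_sym.
have tE c y : term f c (setc Z a y) =
    vres e r (co (setc Z a y) c) * vpr c (setc Z a y) * al c y / (co (setc Z a y) c - pole e r).
  by rewrite /term {1}/vc (vv_res q LL kap e r) -/(vpr c _) -/(al c y); ring.
case: r x0 Ea Hga Lal Lpr tE => x0 Ea Hga Lal Lpr tE.
  apply: exlimD; last first.
    eexists; apply: (rlim_term Hga Lf); last by move=> b bc; apply: R2'; rewrite eq_sym.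
    rewrite co_opp Ea /pole invfM invrK sgKV -[X in _ * X]expr1z.
    exact: sgKq_poles.
  have [|l Hl] := @rlim_div_root K (fun y => vres e true y * vpr a (setc Z a y) * al a y) (pole e true).
    have := rlimM (rlimM (@rlim_vres K q q0 hq LL kap id _ e true (rlim_id (pole e true))) (Lpr a erefl)) (Lal a).
    suff -> : TT (unitv a 2) f Z - f Z = 0 by rewrite mulr0.
    pose Z' := tr (unitv a 1) Z.
    have tZ' : tor Z' by apply: tor_tr.
    have Ea' : co Z' a = sgK e.
      by rewrite /Z' co_tr // eco_unitv !eqxx Ea /pole expr1z mulfVK.
    have := Hf Z' a e 1%N tZ' Ea' (adm1 e).
    move/(congr1 (fun x => mon Y (unitv a 1) * x)); rewrite /Z' !TT_tr // !unitvD.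
    rewrite [X in TT (unitv a X)](_ : _ = 2) // [X in _ = TT (unitv a X) _ _](_ : _ = 0) //.
    by move=> ->; rewrite unitv0 /TT mon0 tr0 mul1r subrr.
  exists l; apply: rlim_near Hl; apply: cofinT => y.
  by rewrite tE co_setc.
have pE : pole e false = sgK e by rewrite /pole mulr1.
rewrite pE in x0 Ea Hga Lal Lpr tE *.
have Lv u : rlim u (sgK e) (sgK e) -> rlim (fun y => vres e false (u y)) (sgK e) (vres e false (sgK e)).
  by move=> Hu; have := @rlim_vres K q q0 hq LL kap u (sgK e) e false; rewrite pE; apply.
have LV : rlim (fun y : K => y^-1) (sgK e) (sgK e).
  by have := rlimV (sgK_neq0 K e) (rlim_id (sgK e)); rewrite sgKV.
have L1 := rlimM (rlimM (Lv id (rlim_id _)) (Lpr a erefl)) (Lal a).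
have L2 := rlimM (rlimM (Lv _ LV) (Lpr (opp a) erefl)) (Lal (opp a)).
have Epr : vpr (opp a) Z = vpr a Z.
  by rewrite /vpr co_opp Ea sgKV.
have El : vres e false (sgK e) * vpr (opp a) Z * (TT (unitv (opp a) 2) f Z - f Z)
        = vres e false (sgK e) * vpr a Z * (TT (unitv a 2) f Z - f Z).
  rewrite Epr; case A2 : (adm e 2).
    by rewrite unitv_opp (Hf Z a e 2%N tZ Ea A2).
  have v0 : vfac e (sgK e) = 0.
    have := @vfac0 e 0; rewrite expr0z mulr1; apply; rewrite ?A2 ?orbT //.
  by rewrite /vres v0 !mul0r mulr0 !mul0r.
rewrite El in L2.
have [l Hl] := rlim_inv_pair L1 L2.
exists l; apply: rlim_near Hl; apply: cofinT => y.
by rewrite !tE co_setc co_opp co_setc.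
Qed.
End PoleCancellation.

(** * Cancellation on the diagonals; D f is a Laurent polynomial *)

Section OperatorStability.
Variables (K : numFieldType) (n : nat) (q : K).
Hypotheses (q0 : q != 0) (hq : forall N : nat, (0 < N)%N -> q ^+ N != 1).
Variables (k : nat) (LL : bool -> nat * nat) (kap cst : K) (Y : 'I_n -> K).
Hypotheses (HLL : forall b, odd ((LL b).1 + (LL b).2)) (tY : tor Y).
Local Notation pt := ('I_n -> K).
Local Notation sidx := ('I_n * bool)%type.
Local Notation expo := {ffun 'I_n -> int}.
Local Notation TT := (TT q Y).
Local Notation sgK := (sgK K).
Local Notation pnum := (pnum q k).
Local Notation pf := (pf q k).
Local Notation vv := (vv q LL kap).
Local Notation vc := (vc q k LL kap).
Local Notation Dop := (Dop q k LL kap cst Y).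
Local Notation cond1 := (cond1 q LL Y).
Local Notation cond2 := (cond2 q k Y).
Local Notation poles := (poles q).
Local Notation term := (term q k LL kap Y).
Implicit Types (Z : pt) (a b c d : sidx) (mu nu h : expo) (f g : pt -> K) (e : bool).

Definition exceptional a b (p : sidx * sidx) : bool :=
  p \in [:: (a, b); (b, a); (opp a, opp b); (opp b, opp a)].

(** The singular factors are pf(w) and pf(1/w) with w = Z_c / Z_d, and A collects the rest of a
    coefficient. The reflection exchanging c and d shows that the two rests have the same limit, so
    [rlim_pf_pair] applies. *)
Lemma exlim_pair f ga y Z c d (g : K -> K) (g0 : K) : LF f -> cond2 f ->
  rcurve ga y Z -> c.1 != d.1 -> co Z c = co Z d ->
  (forall b, co Z b \notin poles) ->
  (forall a b, a.1 != b.1 -> ~~ exceptional c d (a, b) -> co Z a != co Z b) ->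
  cofin (fun z => co (ga z) c * co (ga z) (opp d) - 1 = (z - y) * g z) ->
  rlim g y g0 -> g0 != 0 ->
  exlim (fun z => term f c (ga z) + term f d (ga z)) y.
Proof.
move=> Lf Hf Hga cd E R1 R2 Hw Hg g00; have dc : d.1 != c.1 by rewrite eq_sym.
have [tZ tga _] := Hga.
pose A c d Z := vv (co Z c) * \prod_(b | (b.1 != c.1) && (b != opp d)) pf (co Z c * co Z b).
pose al c := fun z => TT (unitv c 2) f (ga z) - f (ga z).
have Lal a : rlim (al a) y (TT (unitv a 2) f Z - f Z).
  by apply: rlimB; [apply: rlim_TT|exact: (rcurve_LF Hga Lf)].
have tE a b z : b.1 != a.1 ->
    term f a (ga z) = A a b (ga z) * pf (co (ga z) a * co (ga z) (opp b)) * al a z.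
  move=> ba; rewrite /term /vc (bigD1 (opp b)) //= /A /al; ring.
have LA a b : a.1 != b.1 -> (forall x, x.1 != a.1 -> x != opp b -> ~~ exceptional c d (a, opp x)) ->
    rlim (fun z => A a b (ga z)) y (A a b Z).
  move=> ab H; apply: rlimM.
    exact: (rlim_vv LL kap (R1 a) (rcurve_LF Hga (LF_co K a))).
  apply: rlim_prod => x /andP[xa xb]; apply: rlim_pf; last exact: (rlim_co2 _ _ Hga).
  by apply: co_mul_neq1 => //; apply: R2; rewrite 1?eq_sym // H.
have LAc : rlim (fun z => A c d (ga z)) y (A c d Z).
  apply: LA => // x xc xd; rewrite /exceptional !inE !negb_or.
  apply/and4P; split; apply: contra_neq xd => -[].
  - by move=> <-; rewrite oppK.
  - by move=> cd'; rewrite cd' eqxx in cd.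
  - by move=> ca; have := opp_neq c; rewrite -ca eqxx.
  - by move=> ca; rewrite ca eqxx in cd.
have LAd : rlim (fun z => A d c (ga z)) y (A c d Z).
  have -> : A c d Z = A d c Z.
    rewrite /A E; congr (_ * _); rewrite [RHS](reindex_inj (inv_inj (swapiK cd))) /=.
    have sc : swapi c d c = d by rewrite /swapi eqxx.
    have sd : swapi c d (opp d) = opp c.
      have nd (a b : sidx) : a.1 != b.1 -> (a == b) = false.
        by move=> ab; apply: contraNF ab => /eqP ->.
      by rewrite /swapi nd // opp_neq nd // eqxx.
    apply: eq_big => [x|x _]; last by rewrite (co_swapi _ E).
    have -> : ((swapi c d x).1 == d.1) = (x.1 == c.1) by rewrite -(swapi1 cd x c) sc.
    by rewrite -(inj_eq (inv_inj (swapiK cd)) x (opp d)) sd.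
  apply: LA => // x xd xc; rewrite /exceptional !inE !negb_or.
  apply/and4P; split; apply: contra_neq xc => -[].
  - by move=> cd'; rewrite cd' eqxx in cd.
  - by move=> <-; rewrite oppK.
  - by move=> ca; rewrite ca eqxx in cd.
  - by move=> ca; have := opp_neq d; rewrite -ca eqxx.
have w0 : cofin (fun z => co (ga z) c * co (ga z) (opp d) != 0).
  by apply: cofinW tga _ => z tz; rewrite mulf_neq0 ?co_neq0.
(* For k > 0 the condition for s = 1 equates the two shifted values; for k = 0 there is no
   condition, and no residue either. *)
have Hk : pnum 1 = 0 \/ TT (unitv c 2) f Z - f Z = TT (unitv d 2) f Z - f Z.
  case: (posnP k) => [Ek|k0]; first by left; rewrite /pnum Ek mulr1; apply: subrr.
  by right; congr (_ - _); have := Hf Z c d 1%N tZ cd E; rewrite mulr1; apply.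
have [l Hl] := rlim_pf_pair Hw w0 Hg g00 LAc LAd (Lal c) (Lal d) Hk.
exists l; apply: rlim_near Hl; apply: cofinW tga _ => z tz.
by rewrite !(tE _ _ _ cd, tE _ _ _ dc) invfM -!co_opp oppK [co _ d * _]mulrC.
Qed.

Lemma sum_sidx2 a b (F : sidx -> K) : a.1 != b.1 ->
  \sum_c F c = (F a + F b) + (F (opp a) + F (opp b))
     + \sum_(c | (c.1 != a.1) && (c.1 != b.1)) F c.
Proof.
move=> ab; rewrite (sum_sidx a) (bigD1 b) 1?eq_sym //= (bigD1 (opp b)) /=; last first.
  by rewrite eq_sym ab opp_neq.
rewrite (eq_bigl (fun c => (c.1 != a.1) && (c.1 != b.1))); last first.
  by move=> c; rewrite (fst_eqE b) negb_or andbA.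
ring.
Qed.

(** At a generic point of Z_a = Z_b exactly four terms are singular, and they cancel in the pairs
    (a, b) and ([opp a], [opp b]). *)
Lemma Dop_nopole_d f a b Z : LF f -> cond2 f -> a.1 != b.1 -> tor Z -> co Z a = co Z b ->
  (forall c, co Z c \notin poles) ->
  (forall c d, c.1 != d.1 -> ~~ exceptional a b (c, d) ->
     forall s, s \in poles -> co Z c != s * co Z d) ->
  exlim (fun y => Dop f (setc Z a y)) (co Z a).
Proof.
move=> Lf Hf ab tZ E R1 R2; have ba : b.1 != a.1 by rewrite eq_sym.
have a0 := co_neq0 a tZ.
have R2' c d : c.1 != d.1 -> ~~ exceptional a b (c, d) -> co Z c != co Z d.
  by move=> cd h; rewrite -[co Z d]mul1r; apply: R2 => //; apply: poles1.
have Hga : rcurve (setc Z a) (co Z a) Z.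
  by have := rcurve_setc a tZ a0; rewrite setc_co.
have H1 : exlim (fun y => term f a (setc Z a y) + term f b (setc Z a y)) (co Z a).
  apply: (@exlim_pair f _ _ Z a b (fun=> (co Z b)^-1) (co Z b)^-1) => //.
  - apply: cofinT => y; rewrite co_setc co_setc_neq // co_opp mulrBl E mulfV //.
    by rewrite co_neq0.
  - exact: rlim_cst.
  - by rewrite invr_eq0 co_neq0.
have H2 : exlim (fun y => term f (opp a) (setc Z a y) + term f (opp b) (setc Z a y)) (co Z a).
  apply: (@exlim_pair f _ _ Z (opp a) (opp b) (fun y => - y^-1) (- (co Z a)^-1)) => //.
  - by rewrite !co_opp E.
  - move=> c d cd h; apply: R2' => //; apply: contraNN h.
    by rewrite /exceptional !inE !oppK => /or4P[] ->; rewrite ?orbT.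
  - apply: cofinW (cofin_neq 0) _ => y y0; rewrite oppK co_opp co_setc co_setc_neq // -E.
    by field.
  - by apply/rlimN/rlimV => //; apply: rlim_id.
  - by rewrite oppr_eq0 invr_eq0.
have HS : exlim (fun y => \sum_(c | (c.1 != a.1) && (c.1 != b.1)) term f c (setc Z a y)) (co Z a).
  exists (\sum_(c | (c.1 != a.1) && (c.1 != b.1)) term f c Z).
  apply: rlim_sum => c /andP[ca cb]; apply: rlim_term Hga Lf _ _ => //.
  move=> d dc; apply: co_mul_neq1 => //; apply: R2'; first by rewrite eq_sym.
  rewrite /exceptional !inE; apply/negP => /or4P[] /eqP[] Ec _.
  - by rewrite Ec eqxx in ca.
  - by rewrite Ec eqxx in cb.
  - by rewrite Ec eqxx in ca.
  - by rewrite Ec eqxx in cb.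
have HC : exlim (fun y => cst * f (setc Z a y)) (co Z a).
  by eexists; apply: rlimMl; exact: (rcurve_LF Hga Lf).
apply: exlim_near (exlimD (exlimD (exlimD H1 H2) HS) HC); apply: cofinT => y.
by rewrite /Dop (sum_sidx2 _ ab).
Qed.

Lemma MF_ext C f g : (forall Z, tor Z -> f Z = g Z) -> MF C f -> MF C g.
Proof.
move=> E [s [G [Hs LG H]]]; exists s, G; split=> // Z tZ rZ.
by rewrite -E // H.
Qed.

Lemma MF_vc c : MF poles (vc c).
Proof.
have MC (x : K) : MF poles (fun _ : pt => x) by apply/MF_LF/LF_cst.
have Mco a : MF poles (fun Z => co Z a) by apply/MF_LF/LF_co.
have MV (x : K) : x \in poles -> MF poles (fun Z => (co Z c - x)^-1).
  by move=> xp; apply: (@MF_hvalV K n poles (inl (c, x))).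
apply: MFM; first apply: MFM => //.
  apply: MF_prod => e _; apply: MFM.
    by apply: MF_LF; apply: LFM; apply: LFB; do ?[apply: LF_co|apply: LF_cst].
  apply: (MF_ext (f := fun Z => (co Z c - sgK e)^-1 * (co Z c - sgK e * q^-1)^-1)).
    by move=> Z _; rewrite invfM.
  by apply: MFM; apply: MV; rewrite !inE; case: e; rewrite eqxx ?orbT.
apply: MF_prod => d dc; apply: MFM.
  by apply: MF_LF; apply: LFB; [apply: LFM; [apply: LF_cst|apply: LFM; apply: LF_co]|apply: LF_cst].
apply: (MF_ext (f := fun Z => co Z (opp d) * (co Z c - co Z (opp d))^-1)).
  move=> Z tZ; rewrite co_opp -invfM mulrBr mulfV ?co_neq0 //; congr (_ - _)^-1.
  by rewrite mulrC.
apply: MFM => //; apply: (@MF_hvalV K n poles (inr (c, opp d))).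
by rewrite /= eq_sym.
Qed.

Lemma MF_Dop f : LF f -> MF poles (Dop f).
Proof.
move=> Lf; apply: MFD; last by apply/MF_LF/LFM => //; apply: LF_cst.
apply: MF_sum => c _; apply: MFM; first exact: MF_vc.
by apply/MF_LF/LFB => //; apply: LF_TT.
Qed.

Lemma Dop_LF f : LF f -> cond1 f -> cond2 f ->
  exists2 g, LF g & forall Z, tor Z -> reg poles Z -> Dop f Z = g Z.
Proof.
move=> Lf H1 H2; apply: (@pole_removal K n poles poles (Dop f)) => //.
- by rewrite !inE ![0 == _]eq_sym !mulf_eq0 !invr_eq0 !(negPf q0) !(negPf (sgK_neq0 _ _)).
- exact: poles1.
- by move=> a x Z xp tZ Ea R1 R2; apply: Dop_nopole_c.
- by move=> a b Z ab tZ E R1 R2; apply: (@Dop_nopole_d f a b).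
- exact: MF_Dop.
Qed.
End OperatorStability.

(** * Conditions (1) and (2) are inherited by D f *)

Section EvenConditions.
Variables (K : numFieldType) (n : nat) (q : K).
Hypotheses (q0 : q != 0) (hq : forall N : nat, (0 < N)%N -> q ^+ N != 1).
Variables (k : nat) (LL : bool -> nat * nat) (kap cst : K) (Y : 'I_n -> K).
Hypotheses (HLL : forall b, odd ((LL b).1 + (LL b).2)) (tY : tor Y).
Local Notation pt := ('I_n -> K).
Local Notation sidx := ('I_n * bool)%type.
Local Notation expo := {ffun 'I_n -> int}.
Local Notation tr := (tr q).
Local Notation TT := (TT q Y).
Local Notation sgK := (sgK K).
Local Notation vv := (vv q LL kap).
Local Notation vc := (vc q k LL kap).
Local Notation Dop := (Dop q k LL kap cst Y).
Local Notation adm := (adm LL).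
Local Notation cond1 := (cond1 q LL Y).
Local Notation cond2 := (cond2 q k Y).
Local Notation poles := (poles q).
Local Notation vpr := (vpr q k).
Local Notation vres := (vres q LL kap).
Local Notation pole := (pole q).
Local Notation qshifts := (qshifts q).
Implicit Types (Z : pt) (a b c d : sidx) (mu nu h : expo) (f g : pt -> K) (e : bool).

Lemma flipi_eq a : flipi a.1 a = opp a.
Proof. by rewrite /flipi eqxx. Qed.

Lemma flipi_opp a : flipi a.1 (opp a) = a.
Proof. by rewrite /flipi opp_fst eqxx oppK. Qed.

Lemma flipi_neq a c : c.1 != a.1 -> flipi a.1 c = c.
Proof. by rewrite /flipi => /negPf ->. Qed.

Lemma co_flipi Z a e c : co Z a = sgK e -> co Z (flipi a.1 c) = co Z c.
Proof.
move=> E; case: (c.1 =P a.1) => [/same_fst[]->|/eqP/flipi_neq -> //].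
- by rewrite flipi_eq co_opp E sgKV.
- by rewrite flipi_opp co_opp E sgKV.
Qed.

Lemma eco_flipi a p c : eco (unitv a (- p)) (flipi a.1 c) = eco (unitv a p) c.
Proof.
case: (c.1 =P a.1) => [/same_fst[]->|/eqP ca].
- by rewrite flipi_eq !eco_unitv opp_fst eqxx opp_neq eqxx opprK.
- by rewrite flipi_opp !eco_unitv opp_fst eqxx opp_neq eqxx.
- by rewrite flipi_neq // !eco_unitv (negPf ca).
Qed.

Lemma co_tr_flipi Z a e p c : co Z a = sgK e ->
  co (tr (unitv a (- p)) Z) (flipi a.1 c) = co (tr (unitv a p) Z) c.
Proof. by move=> E; rewrite !co_tr // eco_flipi (co_flipi _ E). Qed.

Lemma vpr_flipi Z Z' a : (forall c, co Z' (flipi a.1 c) = co Z c) ->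
  vpr a Z' = vpr (opp a) Z.
Proof.
move=> E; rewrite /vpr (reindex_inj (inv_inj (flipiK a.1))) /=.
have Ea : co Z' a = co Z (opp a) by rewrite -E flipi_opp.
by apply: eq_big => [c|c _]; rewrite ?Ea ?E // -(flipi1 a.1 c a) flipi_eq.
Qed.

Lemma cond1_shift f Z a e (p : nat) nu : cond1 f -> tor Z -> co Z a = sgK e ->
  adm e p || (p == 0%N) -> eco nu a = 0 ->
  TT (unitv a p%:Z + nu) f Z = TT (unitv a (- p%:Z) + nu) f Z.
Proof.
move=> H tZ E; case: (p =P 0%N) => [->|_]; first by rewrite oppr0.
rewrite orbF => Hp En; rewrite -!TT_tr //; congr (_ * _).
by apply: (H _ _ e) => //; [exact: tor_tr|rewrite co_tr // En mulr1].
Qed.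

Lemma eco_unitv_neq a c p : c.1 != a.1 -> eco (unitv c p) a = 0.
Proof. by rewrite eco_unitv eq_sym => /negPf ->. Qed.

Lemma vc_flip_zero Z a e p : co Z a = sgK e -> adm e p || (p == 0%N) -> ~~ adm e (p + 2) ->
  vc a (tr (unitv a p%:Z) Z) = 0.
Proof.
move=> E Hp Hp2; rewrite /vc /vv (bigD1 e) //= co_tr // eco_unitv !eqxx E.
by rewrite vfac0 // !mul0r mulr0 mul0r.
Qed.

(** The term c = a leads to the condition for p + 2, or has coefficient 0 when p + 2 is not
    admissible; c = [opp a] leads to p - 2, hence the restriction for p = 1; the other terms are
    translates of the condition for p. *)
Lemma cond1_flip f Z a e p c : cond1 f -> tor Z -> co Z a = sgK e -> (0 < p)%N -> adm e p ->
  c != opp a \/ (1 < p)%N ->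
  vc c (tr (unitv a p%:Z) Z) = 0 \/
  TT (unitv a p%:Z + unitv c 2) f Z = TT (unitv a (- p%:Z) + unitv (flipi a.1 c) 2) f Z.
Proof.
move=> H tZ E p0 Hp Hc; case: (c.1 =P a.1) => [/same_fst[]Ec|/eqP ca].
- rewrite Ec flipi_eq unitv_opp !unitvD -opprD.
  case A2 : (adm e (p + 2)); last first.
    by left; apply: (vc_flip_zero E); rewrite ?Hp ?A2.
  right; have := cond1_shift (nu := 0) H tZ E; move/(_ (p + 2)%N); rewrite A2 !addr0 PoszD.
  by apply; rewrite // /eco ffunE /sgi; case: a.2.
- have p2 : (2 <= p)%N by case: Hc => //; rewrite Ec eqxx.
  right; rewrite Ec flipi_opp unitv_opp !unitvD.
  have -> : - p%:Z + 2 = - (p - 2)%N%:Z by lia.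
  have -> : p%:Z - 2 = (p - 2)%N%:Z by lia.
  have := cond1_shift (nu := 0) H tZ E; move/(_ (p - 2)%N); rewrite !addr0; apply.
    by move: Hp; rewrite /adm; lia.
  by rewrite /eco ffunE /sgi; case: a.2.
- right; rewrite flipi_neq //; apply: (cond1_shift H tZ E); rewrite ?Hp //.
  exact: eco_unitv_neq.
Qed.

Lemma TT_Dop_flip f Z a e p : cond1 f -> tor Z -> co Z a = sgK e -> (1 < p)%N -> adm e p ->
  TT (unitv a p%:Z) (Dop f) Z = TT (unitv a (- p%:Z)) (Dop f) Z.
Proof.
move=> H tZ E p1 Hp.
apply: (@Dop_sym _ _ _ q0 _ _ _ _ _ tY f (flipi a.1)) => //.
- exact: flipiK.
- exact: flipi1.
- by move=> c; apply: co_tr_flipi E.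
- exact: (H _ _ e).
by move=> c; apply: (cond1_flip H tZ E) => //; [lia|right].
Qed.

Section Generic.
Variables (Z : pt) (a : sidx) (e : bool) (p : nat).
Hypotheses (tZ : tor Z) (E : co Z a = sgK e).
Hypothesis R1 : forall b, b.1 != a.1 -> co Z b \notin qshifts p.
Hypothesis R2 : sep (qshifts p) Z.

Lemma flip_co_neq r c d : `|r| = p%:Z -> c.1 != d.1 ->
  co (tr (unitv a r) Z) c != co (tr (unitv a r) Z) d.
Proof.
move=> rp cd; apply: (@co_tr_neq _ _ _ q0 p) => // [s sS|]; first exact: R2.
have := eco_unitv_le a r c; have := eco_unitv_le a r d.
case: (c.1 =P a.1) => [ca|/eqP ca].
  rewrite [eco _ d]eco_unitv -ca eq_sym (negPf cd) sub0r normrN rp //.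
by rewrite [eco _ c]eco_unitv (negPf ca) subr0 rp.
Qed.

Lemma flip_poles r c : `|r| = p%:Z -> c.1 != a.1 -> co (tr (unitv a r) Z) c \notin poles.
Proof.
move=> rp ca; apply: (co_tr_poles q0 (R1 ca)).
by rewrite eco_unitv (negPf ca).
Qed.

Lemma reg_tr_flip r : `|r| = p%:Z -> (1 < p)%N -> reg poles (tr (unitv a r) Z).
Proof.
move=> rp p1; split=> [c|c d]; last exact: flip_co_neq.
case: (c.1 =P a.1) => [/same_fst[]->|/eqP ca]; last exact: flip_poles.
- by rewrite co_tr // eco_unitv !eqxx E sgKq_poles //; lia.
- by rewrite co_tr // eco_unitv opp_fst eqxx opp_neq co_opp E sgKV sgKq_poles //; lia.
Qed.
End Generic.

Section Generic1.
Variables (f : pt -> K) (Z : pt) (a : sidx) (e : bool).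
Hypotheses (Lf : LF f) (Hf : cond1 f) (tZ : tor Z) (E : co Z a = sgK e).
Hypothesis R1 : forall b, b.1 != a.1 -> co Z b \notin qshifts 1.
Hypothesis R2 : sep (qshifts 1) Z.
Let mu : expo := unitv a 1.
Let nu : expo := unitv a (- 1).
Let ga := setc Z a.

Lemma flip_curve : rcurve ga (sgK e) Z.
Proof. by have := rcurve_setc a tZ (co_neq0 a tZ); rewrite setc_co E. Qed.

Lemma flip_mul_neq1 r c d : `|r| = 1%:Z -> d.1 != c.1 ->
  co (tr (unitv a r) Z) c * co (tr (unitv a r) Z) d != 1.
Proof.
move=> r1 dc; apply: co_mul_neq1; first exact: tor_tr.
by apply: (@flip_co_neq Z a 1 tZ R2 r c (opp d) r1); rewrite eq_sym.
Qed.

Lemma rlim_vc_flip c : c != opp a ->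
  rlim (fun y => vc c (tr mu (ga y))) (sgK e) (vc c (tr mu Z)) /\
  rlim (fun y => vc (flipi a.1 c) (tr nu (ga y))) (sgK e) (vc c (tr mu Z)).
Proof.
move=> ca.
have Hp : co (tr mu Z) c \notin poles.
  case: (c.1 =P a.1) => [/same_fst[]Ec|/eqP ca1]; last exact: (flip_poles R1).
    by rewrite Ec co_tr // eco_unitv !eqxx E sgKq_poles.
  by rewrite Ec eqxx in ca.
split.
  by apply: rlim_vc (rcurve_tr q0 mu flip_curve) Hp _ => b; apply: flip_mul_neq1.
have Efl := @vc_equiv K n q k LL kap _ _ _ (flipiK a.1) (flipi1 a.1) (fun c => co_tr_flipi 1 c E) c.
rewrite -Efl; apply: rlim_vc (rcurve_tr q0 nu flip_curve) _ _.
  by rewrite (co_tr_flipi 1 c E).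
by move=> b; apply: flip_mul_neq1.
Qed.

(** The two coefficients have simple poles in y and in 1/y with the same limiting numerator, by the
    reflection at a, so [rlim_inv_pair] applies. *)
Lemma exlim_vc_flip :
  exlim (fun y => vc (opp a) (tr mu (ga y)) + vc a (tr nu (ga y))) (sgK e).
Proof.
pose F y := q * vres e true (y * q^-1) * vpr a (tr nu (ga y)).
pose G y := q * vres e true (y^-1 * q^-1) * vpr (opp a) (tr mu (ga y)).
pose x := q * vres e true (pole e true) * vpr (opp a) (tr mu Z).
have Hvpr c r : `|r| = 1%:Z ->
    rlim (fun y => vpr c (tr (unitv a r) (ga y))) (sgK e) (vpr c (tr (unitv a r) Z)).
  move=> r1; apply: rlim_vpr (rcurve_tr q0 _ flip_curve) _ => b; exact: flip_mul_neq1.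
have HF : rlim F (sgK e) x.
  rewrite /x -(@vpr_flipi _ (tr nu Z)); last by move=> c; apply: co_tr_flipi E.
  apply: rlimM (Hvpr _ _ _) => //; apply/rlimMl/rlim_vres => //.
  by have := rlimM (rlim_id (sgK e)) (rlim_cst q^-1 (sgK e)).
have HG : rlim G (sgK e) x.
  apply: rlimM (Hvpr _ _ _) => //; apply/rlimMl/rlim_vres => //.
  have := rlimM (rlimV (sgK_neq0 K e) (rlim_id (sgK e))) (rlim_cst q^-1 (sgK e)).
  by rewrite sgKV.
apply: exlim_near (rlim_inv_pair HF HG); apply: cofinT => y.
have E1 : co (tr nu (ga y)) a = y * q^-1 by rewrite co_tr // eco_unitv !eqxx co_setc.
have E2 : co (tr mu (ga y)) (opp a) = y^-1 * q^-1.
  by rewrite co_tr // eco_unitv opp_fst eqxx opp_neq co_opp co_setc.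
have D u : (u * q^-1 - pole e true)^-1 = q / (u - sgK e).
  by rewrite /pole -mulrBl invfM invrK mulrC.
have VE c Z' : vc c Z' = vres e true (co Z' c) * (co Z' c - pole e true)^-1 * vpr c Z'.
  by rewrite /vc (vv_res q LL kap e true).
by rewrite !VE E1 E2 !D /F /G; ring.
Qed.

(** Shifting by [opp a] at mu gives nu, and shifting by a at nu gives mu. The two singular terms
    thus combine into the sum of their coefficients, which has a limit, times a difference that
    tends to 0. All other terms match under the reflection. *)
Lemma rlim_flip :
  rlim (fun y => TT mu (Dop f) (ga y) - TT nu (Dop f) (ga y)) (sgK e) 0.
Proof.
have HT la : rlim (fun y => TT la f (ga y)) (sgK e) (TT la f Z).
  exact: rlim_TT flip_curve Lf.
have Emn : TT mu f Z = TT nu f Z by exact: (@Hf Z a e 1%N tZ E (adm1 HLL e)).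
pose P c y := vc c (tr mu (ga y)) * (TT (mu + unitv c 2) f (ga y) - TT mu f (ga y)).
pose Q c y := vc (flipi a.1 c) (tr nu (ga y)) *
  (TT (nu + unitv (flipi a.1 c) 2) f (ga y) - TT nu f (ga y)).
have HPQ c : rlim (fun y => P c y - Q c y) (sgK e) 0.
  case: (c =P opp a) => [->|/eqP ca]; last first.
    have [H1 H2] := rlim_vc_flip ca.
    have := rlimB (rlimM H1 (rlimB (HT (mu + unitv c 2)) (HT mu)))
      (rlimM H2 (rlimB (HT (nu + unitv (flipi a.1 c) 2)) (HT nu))).
    rewrite -mulrBr Emn opprB addrA subrK.
    by case: (cond1_flip (p := 1) Hf tZ E isT (adm1 HLL e) (or_introl ca)) => ->;
      rewrite ?subrr ?mulr0 ?mul0r.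
  have [l Hl] := exlim_vc_flip.
  have := rlimM Hl (rlimB (HT nu) (HT mu)); rewrite Emn subrr mulr0; apply: rlim_near.
  apply: cofinT => y; rewrite /P /Q flipi_opp unitv_opp !unitvD.
  by rewrite (_ : 1 - 2 = -1) // (_ : -1 + 2 = 1) // -/mu -/nu; ring.
have HS : rlim (fun y => \sum_c (P c y - Q c y)) (sgK e) (\sum_(c : sidx) 0).
  by apply: rlim_sum => c _; apply: HPQ.
have := rlimD HS (rlimMl cst (rlimB (HT mu) (HT nu))).
rewrite Emn subrr mulr0 addr0 big1 //; apply: rlim_near; apply: cofinT => y.
rewrite !TT_Dop // big_split sumrN /= [X in _ + _ - X](_ : _ = \sum_c Q c y + cst * TT nu f (ga y)).
  by rewrite /P; ring.
by congr (_ + _); rewrite (reindex_inj (inv_inj (flipiK a.1))).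
Qed.
End Generic1.

Lemma cond1_Dop f g : LF f -> cond1 f -> LF g ->
  (forall Z, tor Z -> reg poles Z -> Dop f Z = g Z) -> cond1 g.
Proof.
move=> Lf H Lg EE Z a e p tZ Ea Hp; have p0 : (0 < p)%N by case/andP: Hp.
apply/eqP; rewrite -subr_eq0; apply/eqP.
have LG := LFB (LF_TT q0 Y (unitv a p%:Z) Lg) (LF_TT q0 Y (unitv a (- p%:Z)) Lg).
move: Z tZ Ea; apply: (@densc _ _ _ (qshifts p) a _ LG) => Z tZ Ea R1 R2.
have [p1|p1] := ltnP 1 p.
  have := TT_Dop_flip H tZ Ea p1 Hp.
  rewrite !(TT_congr Y (EE _ (tor_tr q0 _ tZ) _)); last first.
  - by apply: (reg_tr_flip tZ Ea R1 R2) => //; lia.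
  - by apply: (reg_tr_flip tZ Ea R1 R2) => //; lia.
  by move=> ->; rewrite subrr.
have {p0 p1} p1 : p = 1%N by lia.
rewrite {}p1 in Hp LG R1 R2 *.
have e0 : sgK e != 0 := sgK_neq0 K e.
have L1 := rlim_LF_setc a LG tZ (co_neq0 a tZ).
rewrite setc_co Ea in L1; apply: rlim_uniq L1 _.
apply: rlim_near (rlim_flip Lf H tZ Ea R1 R2).
have Hreg r : `|r| = 1%:Z -> cofin (fun y => reg poles (tr (unitv a r) (setc Z a y))).
  move=> r1.
  have Hs y : tr (unitv a r) (setc Z a y) = setc Z a (y * q ^ r).
    apply/funext => i; rewrite /tr /cv /setc ffunE.
    case: (i =P a.1) => // _; last by rewrite mulr1.
    by rewrite /sgi; case: a.2; rewrite // invfM invr_expz.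
  have H1 : cofin (fun y => reg poles (setc Z a y)).
    apply: cofin_reg_setc => // [b /R1|b d bd _ _].
      by apply: contraNN; apply: qshifts_poles.
    by rewrite -[co Z d]mul1r R2 // -[1](expr0z q) qshifts1.
  have s0 : q ^ r != 0 by rewrite expfz_neq0.
  (* Replacing y by y q^r composes the exceptional polynomial with q^r X, which keeps it nonzero. *)
  case: H1 => P P0 HP; exists (P \Po ((q ^ r) *: 'X)).
    rewrite -size_poly_eq0 size_comp_poly2 ?size_poly_eq0 //.
    by rewrite size_scale // size_polyX.
  by move=> y; rewrite horner_comp hornerZ hornerX mulrC Hs; apply: HP.
apply: cofinW (cofinI (cofin_tor_setc a tZ) (cofinI (Hreg 1 _) (Hreg (- 1) _))) _ => // y [ty [h1 h2]].
by rewrite !(TT_congr Y (EE _ (tor_tr q0 _ ty) _)).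
Qed.

Lemma Dop_stable f : LF f -> cond1 f -> cond2 f -> exists g,
  [/\ LF g, cond1 g, cond2 g & forall Z, tor Z -> reg poles Z -> Dop f Z = g Z].
Proof.
move=> Lf H1 H2; have [g Lg Eg] := Dop_LF q0 hq kap cst HLL tY Lf H1 H2.
exists g; split=> //; first exact: cond1_Dop Eg.
by apply: (cond2_Dop q0 hq tY H2 Lg) => Z tZ rZ; rewrite -Eg.
Qed.
End EvenConditions.

(** * Leading terms *)

Section Interpolation.
Variables (K : numFieldType) (n : nat).
Local Notation pt := ('I_n -> K).
Local Notation expo := {ffun 'I_n -> int}.
Implicit Types (Z : pt) (mu nu h : expo) (s : seq expo) (c : expo -> K).

Definition ev s c Z : K := \sum_(mu <- s) c mu * mon Z mu.

Lemma LF_ev s c : LF (ev s c).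
Proof. by apply: LF_sum => mu _; apply: LFM (LF_cst n _) (LF_mon K mu). Qed.

Lemma dotBl mu nu h : dot (mu - nu) h = dot mu h - dot nu h.
Proof.
by rewrite /dot -sumrB; apply: eq_bigr => i _; rewrite !ffunE mulrBl.
Qed.

Lemma cofin_separating (s : seq expo) : cofin (fun y : K =>
  forall mu, mu \in s -> forall nu, nu \in s -> mu != nu ->
  \sum_i (mu i - nu i)%:~R * y ^+ i.+1 != 0).
Proof.
apply: cofin_forall_seq => mu _; apply: cofin_forall_seq => nu _; apply: cofin_imp => mn.
pose P : {poly K} := \sum_(i < n) (mu i - nu i)%:~R *: 'X^(i.+1).
exists P; last first.
  by move=> y; rewrite /P horner_sum; under eq_bigr do rewrite hornerZ hornerXn.
apply: contra_neq mn => P0; apply/ffunP => i.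
have := congr1 (fun p : {poly K} => p`_i.+1) P0.
rewrite coef0 /P coef_sum (bigD1 i) //= coefZ coefXn eqxx mulr1 big1 => [|j ji].
  by rewrite addr0 => /eqP; rewrite intr_eq0 subr_eq0 => /eqP.
by rewrite coefZ coefXn eqSS eq_sym -val_eqE /= in ji *; rewrite (negPf ji) mulr0.
Qed.

Definition powh (T : nat) : expo := [ffun i : 'I_n => (T ^ i.+1)%N%:Z].

(** Kronecker substitution: the weights of exponents in the direction (T, T^2, ...) are values at T
    of polynomials, and T avoids the zeros of their finitely many nonzero differences. *)
Lemma separating_powh s : exists2 T : nat, (1 < T)%N & {in s &, injective (fun mu => dot mu (powh T))}
 .
Proof.
have [T [HT [T0 T1]]] := cofin_nat (cofinI (cofin_separating s) (cofinI (cofin_neq 0) (cofin_neq 1))).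
exists T => [|mu nu smu snu E].
  by case: T T0 T1 {HT} => [|[|T]] //; rewrite eqxx.
apply/eqP; apply: contraT => mn; have /eqP[] := HT _ smu _ snu mn.
have : dot (mu - nu) (powh T) = 0 by rewrite dotBl; apply/eqP; rewrite subr_eq0; apply/eqP.
move=> D0; apply: (etrans (y := (dot (mu - nu) (powh T))%:~R)); last by rewrite D0.
rewrite /dot rmorph_sum; apply: eq_bigr => i _.
by rewrite !ffunE rmorphM /= -[(Posz _)%:~R]pmulrn natrX.
Qed.

Lemma eco_powh T (a : 'I_n * bool) : eco (powh T) a = sgi a (T ^ a.1.+1)%N%:Z.
Proof. by rewrite /eco ffunE. Qed.

Lemma powh_neq T (a b : 'I_n * bool) : (1 < T)%N -> a.1 != b.1 ->
  eco (powh T) a != eco (powh T) b.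
Proof.
move=> T1 ab; rewrite !eco_powh.
have : (T ^ a.1.+1)%N != (T ^ b.1.+1)%N.
  by rewrite eqn_exp2l // eqSS.
have : (0 < T ^ a.1.+1)%N by rewrite expn_gt0; lia.
have : (0 < T ^ b.1.+1)%N by rewrite expn_gt0; lia.
by rewrite /sgi; case: a.2; case: b.2; lia.
Qed.

Lemma powh_neq0 T (a : 'I_n * bool) : (1 < T)%N -> eco (powh T) a != 0.
Proof.
move=> T1; rewrite eco_powh sgi_eq0.
have : (0 < T ^ a.1.+1)%N by rewrite expn_gt0; lia.
lia.
Qed.

Lemma lagrange_coef (ys : seq K) : uniq ys -> exists w : nat -> nat -> K,
  forall P : {poly K}, (size P <= size ys)%N ->
  forall e, P`_e = \sum_(j < size ys) w e j * P.[ys`_j].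
Proof.
move=> uy; pose L (j : nat) : {poly K} :=
  \prod_(i < size ys | i != j :> nat) ((ys`_j - ys`_i)^-1 *: ('X - (ys`_i)%:P)).
have LE (j j' : 'I_(size ys)) : (L j).[ys`_j'] = (j == j')%:R.
  rewrite /L horner_prod; case: eqP => [->|/eqP jj'].
    rewrite big1 // => i ij; rewrite hornerZ hornerXsubC mulVf // subr_eq0.
    by rewrite nth_uniq // eq_sym.
  rewrite (bigD1 j') 1?eq_sym //= hornerZ hornerXsubC subrr mulr0 mul0r //.
have LS (j : 'I_(size ys)) : (size (L j) <= size ys)%N.
  rewrite /L; apply: leq_trans (size_prod_leq _ _) _.
  under eq_bigr => i ij.
    rewrite size_scale ?size_XsubC; last first.
      by rewrite invr_eq0 subr_eq0 nth_uniq // eq_sym.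
    over.
  rewrite sum_nat_const muln2 -addnn -addSn addnK.
  have -> : #|(fun i : 'I_(size ys) => i != j :> nat)| = #|predC1 j| by apply: eq_card.
  by rewrite cardC1 card_ord prednK // (leq_ltn_trans _ (ltn_ord j)).
exists (fun e j => (L j)`_e) => P sP e.
suff -> : P = \sum_(j < size ys) P.[ys`_j] *: L j.
  rewrite coef_sum; apply: eq_bigr => j _; rewrite coefZ mulrC; congr (_ * _).
  rewrite horner_sum (bigD1 j) //= hornerZ LE eqxx mulr1 big1 ?addr0 // => i ij.
  by rewrite hornerZ LE (negPf ij) mulr0.
apply/eqP; rewrite -subr_eq0; apply: contraT => D0.
have := max_poly_roots D0 _ uy.
move=> H; have {H} : (size ys < size (P - \sum_(j < size ys) P.[ys`_j] *: L j)%R)%N.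
  apply: H; apply/allP => y /(nthP 0)[j js <-]; rewrite rootE hornerD hornerN horner_sum.
  rewrite (bigD1 (Ordinal js)) //= hornerZ (LE (Ordinal js) (Ordinal js)) eqxx mulr1.
  rewrite big1 ?addr0 ?subrr // => i ij.
  by rewrite hornerZ (LE i (Ordinal js)) (negPf ij) mulr0.
rewrite ltnNge; apply: contraNT => _.
apply: leq_trans (size_polyD _ _) _; rewrite size_polyN geq_max sP /=.
apply: leq_trans (size_sum _ _ _) _; apply/bigmax_leqP => j _.
exact: leq_trans (size_scale_leq _ _) (LS j).
Qed.

(* Along the curve y^h, with h injective on s, the monomials of s become
   distinct powers of y, so Lagrange interpolation recovers coefficients. *)
Lemma interpolation (S : seq K) s : uniq s -> exists (M : nat) (P : nat -> pt) (w : expo -> nat -> K),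
  [/\ forall j, (j < M)%N -> tor (P j),
      forall j, (j < M)%N -> (forall b, co (P j) b \notin S) /\ sep S (P j) &
      forall c mu, mu \in s -> c mu = \sum_(j < M) w mu j * ev s c (P j)].
Proof.
move=> us; have [T T1 inj] := separating_powh s.
pose h := powh T; pose Z1 : pt := fun=> 1.
have tZ1 : tor Z1 by move=> i; rewrite /Z1 oner_eq0.
(* N makes all powers of y nonnegative; the factor y^N in the weights undoes this shift. *)
pose N := \sum_(mu <- s) `|dot mu h|%N.
pose e mu := absz (dot mu h + N%:Z).
have eE mu : mu \in s -> (e mu)%:Z = dot mu h + N%:Z.
  move=> smu; rewrite /e; have : (`|dot mu h|%N <= N)%N.
    by rewrite /N (big_rem mu) //= leq_addr.
  lia.
pose M := (\max_(mu <- s) e mu).+1.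
have CF : cofin (fun y : K => y != 0 /\ ((forall b, co (cv Z1 h y) b \notin S) /\ sep S (cv Z1 h y))).
  apply: cofinI; first exact: cofin_neq.
  apply: cofinI.
    apply: cofin_forall => b.
    have := @cofin_forall_seq _ K S _ (fun x _ => cofin_co_cv x tZ1 (powh_neq0 b T1)).
    by move/cofinW; apply=> y Hy; apply/negP => /Hy; rewrite eqxx.
  apply: cofin_forall => a; apply: cofin_forall => b; apply: cofin_imp => ab.
  by apply: cofin_forall_seq => x _; apply: cofin_co2_cv => //; apply: powh_neq.
have [ys [uys sys] Hys] := cofin_seq M CF.
have [w Hw] := lagrange_coef uys.
have ys0 j : (j < M)%N -> ys`_j \in ys by move=> jM; apply: mem_nth; rewrite sys.
exists M, (fun j => cv Z1 h ys`_j), (fun mu j => w (e mu) j * ys`_j ^+ N); split.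
- by move=> j /ys0/Hys[y0 _]; apply: tor_cv.
- by move=> j /ys0/Hys[].
move=> c mu smu.
pose P : {poly K} := \sum_(nu <- s) c nu *: 'X^(e nu).
have -> : c mu = P`_(e mu).
  rewrite /P coef_sum (bigD1_seq mu) //= coefZ coefXn eqxx mulr1 big_seq_cond big1 ?addr0 //.
  move=> nu /andP[snu nm]; rewrite coefZ coefXn; case: eqP; rewrite ?mulr0 // => E.
  case/eqP: nm; apply: inj => //.
  by have := eE nu snu; have := eE mu smu; rewrite E -/h; lia.
rewrite (Hw P); last first.
  rewrite sys /P; apply: leq_trans (size_sum _ _ _) _; apply/bigmax_leqP_seq => nu snu _.
  apply: leq_trans (size_scale_leq _ _) _; rewrite size_polyXn ltnS.
  exact: (leq_bigmax_seq _ snu).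
rewrite sys; apply: eq_bigr => j _; rewrite -mulrA; congr (_ * _).
have y0 : ys`_j != 0 by case: (Hys _ (ys0 j (ltn_ord j))).
rewrite /P horner_sum /ev mulr_sumr big_seq [RHS]big_seq; apply: eq_bigr => nu snu.
rewrite hornerZ hornerXn mon_cv // exprnP eE // expfzDr // -exprnP.
rewrite (_ : mon Z1 nu = 1) ?mul1r; first ring.
by rewrite /mon big1 // => i _; rewrite exp1rz.
Qed.

Lemma ev_inj s c : uniq s -> (forall Z, tor Z -> ev s c Z = 0) ->
  forall mu, mu \in s -> c mu = 0.
Proof.
move=> us H mu smu; have [M [P [w [tP _ HP]]]] := interpolation [::] us.
by rewrite (HP c mu smu) big1 // => j _; rewrite H ?mulr0 //; apply: tP.
Qed.
End Interpolation.

(** * Degeneration of the operator in a regular direction *)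

Section LeadingTerms.
Variables (K : numFieldType) (n : nat) (q : K).
Hypotheses (q0 : q != 0) (hq : forall N : nat, (0 < N)%N -> q ^+ N != 1).
Variables (k : nat) (LL : bool -> nat * nat) (kap cst : K) (Y : 'I_n -> K).
Hypotheses (HLL : forall b, odd ((LL b).1 + (LL b).2)) (tY : tor Y).
Local Notation pt := ('I_n -> K).
Local Notation sidx := ('I_n * bool)%type.
Local Notation expo := {ffun 'I_n -> int}.
Local Notation tr := (tr q).
Local Notation TT := (TT q Y).
Local Notation sgK := (sgK K).
Local Notation pnum := (pnum q k).
Local Notation pf := (pf q k).
Local Notation vfac := (vfac q LL).
Local Notation vv := (vv q LL kap).
Local Notation vc := (vc q k LL kap).
Local Notation Dop := (Dop q k LL kap cst Y).
Local Notation poles := (poles q).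
Implicit Types (Z : pt) (a b : sidx) (mu nu h : expo) (f g : pt -> K) (e : bool)
  (s : seq expo) (c : expo -> K).
(** The multiplicity 1 + l + l' + m + m' of the roots e_i, written with the doubled parameters. *)
Variable m1 : int.
Hypothesis Hm1 : 2 * m1 = 2 + \sum_(e : bool) ((LL e).1 + (LL e).2)%N%:Z.
Hypothesis Hkap : kap = q ^ (- m1).

Definition regh h := (forall a, eco h a != 0) /\
  (forall a b, a.1 != b.1 -> eco h a != eco h b).

(* The component at a of twice the image of rho in the closed chamber of h. *)
Definition r2 h a : int :=
  m1 * sgz (eco h a) + k%:Z * \sum_(b | b.1 != a.1) sgz (eco h a + eco h b).
Definition rho2 h : expo := [ffun i => r2 h (i, false)].
(** The eigenvalue m(x + nu) as a function of eta = 2 nu - 2 rho, since Y_i^2 q^(eta_i) = q^(2 (x +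
    nu)_i). *)
Definition Em (eta : expo) : K := \sum_(a : sidx) mon Y (unitv a 2) * q ^ eco eta a.
Definition dbl mu : expo := [ffun i => 2 * mu i].

Lemma eco_opp h a : eco h (opp a) = - eco h a.
Proof. by rewrite /eco /sgi /=; case: a.2; rewrite ?opprK. Qed.

Lemma ecoD h h' a : eco (h + h') a = eco h a + eco h' a.
Proof. by rewrite /eco ffunE /sgi; case: a.2; rewrite ?opprD. Qed.

Lemma eco_dbl h a : eco (dbl h) a = 2 * eco h a.
Proof. by rewrite /eco ffunE /sgi; case: a.2; rewrite ?mulrN. Qed.

Lemma r2_opp h a : r2 h (opp a) = - r2 h a.
Proof.
rewrite /r2 eco_opp sgzN mulrN opprD; congr (_ + _).
rewrite -mulrN -sumrN; congr (_ * _).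
rewrite (reindex_inj (inv_inj (@oppK n))) /=; apply: eq_bigr => b _.
by rewrite eco_opp -opprD sgzN.
Qed.

Lemma eco_rho2 h a : eco (rho2 h) a = r2 h a.
Proof.
by case: a => i []; rewrite /eco ffunE /sgi /= -?r2_opp.
Qed.

Lemma dot_unitv mu a p : dot mu (unitv a p) = eco mu a * p.
Proof.
rewrite /dot (bigD1 a.1) //= ffunE eqxx big1 ?addr0 => [|i ia]; last first.
  by rewrite ffunE (negPf ia) mulr0.
by rewrite /eco /sgi; case: a.2; rewrite ?mulrN ?mulNr.
Qed.

Lemma rlim_Xpos (x : K) (p : int) : 0 < p -> rlim (fun y : K => x * y ^ p) 0 0.
Proof.
case: p => [[|p]|] // _.
have := rlimMl x (rlimX p.+1 (rlim_id (0 : K))).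
by rewrite expr0n mulr0.
Qed.

Lemma rlim_vv_pos u : rlim u 0 0 -> rlim (fun y => vv (u y)) 0 (q ^ m1).
Proof.
move=> Hu; have -> : q ^ m1 = vv 0.
  have F e : vfac e 0 / ((0 - sgK e) * (0 - sgK e * q^-1)) = q ^ (1 + ((LL e).1 + (LL e).2)%N%:Z).
    rewrite /vfac !sub0r !mulrNN.
    have s2 x y : sgK e * x * (sgK e * y) = x * y by rewrite mulrACA sgKK mul1r.
    by rewrite s2 mulrA sgKK mul1r invrK [RHS]expfzDr // PoszD expfzDr // mulrC expr1z.
  rewrite /vv Hkap (eq_bigr _ (fun e _ => F e)) big_bool /= -(expfzDr _ _ q0) -expfzDr //; congr (_ ^ _).
  by have := Hm1; rewrite big_bool /=; lia.
apply: rlim_vv => //.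
by rewrite !inE ![0 == _]eq_sym !mulf_eq0 !invr_eq0 !(negPf q0) !(negPf (sgK_neq0 _ _)).
Qed.

Lemma rlim_vv_neg u : cofin (fun y => u y != 0) -> rlim (fun y => (u y)^-1) 0 0 ->
  rlim (fun y => vv (u y)) 0 (q ^ (- m1)).
Proof.
move=> u0 Hu.
have H1 (x : K) : rlim (fun y => 1 - x * (u y)^-1) 0 1.
  by have := rlimB (rlim_cst 1 0) (rlimMl x Hu); rewrite mulr0 subr0.
have H : rlim (fun y => kap * \prod_(e : bool)
    (((1 - sgK e * q ^ (LL e).1%:Z * (u y)^-1) * (1 - sgK e * q ^ (LL e).2%:Z * (u y)^-1)) /
     ((1 - sgK e * (u y)^-1) * (1 - sgK e * q^-1 * (u y)^-1)))) 0 (kap * \prod_(e : bool) 1).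
  apply/rlimMl/rlim_prod => e _.
  by have := rlim_div _ (rlimM (H1 _) (H1 _)) (rlimM (H1 _) (H1 _)); rewrite !mulr1 divr1; apply; rewrite oner_eq0.
rewrite -Hkap; move: H; rewrite big1_eq mulr1; apply: rlim_near.
apply: cofinW u0 _ => y y0; rewrite /vv; congr (_ * _); apply: eq_bigr => e _.
have D x : 1 - x * (u y)^-1 = (u y - x) * (u y)^-1 by rewrite mulrBl mulfV.
by rewrite /vfac !D ![_ * (u y)^-1 * (_ * _)]mulrACA -mulf_div mulfV ?mulr1 // mulf_neq0 ?invr_eq0.
Qed.

Lemma rlim_pf_pos w : rlim w 0 0 -> rlim (fun y => pf (w y)) 0 (q ^ k%:Z).
Proof.
have -> : q ^ k%:Z = pf 0 by rewrite /pf /pnum mulr0 !sub0r invrN1 mulrN1 opprK.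
by apply: rlim_pf; rewrite eq_sym oner_eq0.
Qed.

Lemma rlim_pf_neg w : cofin (fun y => w y != 0) -> rlim (fun y => (w y)^-1) 0 0 ->
  rlim (fun y => pf (w y)) 0 (q ^ (- k%:Z)).
Proof.
move=> w0 Hw.
have H1 (x x' : K) : rlim (fun y => x - x' * (w y)^-1) 0 x.
  by have := rlimB (rlim_cst x 0) (rlimMl x' Hw); rewrite mulr0 subr0.
have := rlim_div (oner_neq0 K) (H1 (q ^ (- k%:Z)) (q ^ k%:Z)) (H1 1 1).
rewrite divr1; apply: rlim_near; apply: cofinW w0 _ => y y0.
rewrite /pf /pnum; have -> : q ^ (- k%:Z) - q ^ k%:Z * (w y)^-1 = (q ^ (- k%:Z) * w y - q ^ k%:Z) * (w y)^-1.
  by rewrite mulrBl mulfK.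
have -> : 1 - 1 * (w y)^-1 = (w y - 1) * (w y)^-1 by rewrite mulrBl mulfV.
by rewrite -mulf_div mulfV ?mulr1 // invr_eq0.
Qed.

Lemma sgz_case (x : int) : x != 0 -> (0 < x /\ sgz x = 1) \/ (0 < - x /\ sgz x = -1).
Proof. by move=> x0; case: (ltrgtP x 0) x0 => // h _; [right|left]; rewrite ?oppr_gt0 ?(ltr0_sgz h) ?(gtr0_sgz h). Qed.

(** Every factor tends to its value at 0 or at infinity: q^m1 or q^-m1 for [vv], q^k or q^-k for
    [pf], according to the sign of the exponent of y in its argument. These exponents add up to
    [r2 h a]. *)
Lemma rlim_vc_inf Z h a : tor Z -> regh h ->
  rlim (fun y => vc a (cv Z h y)) 0 (q ^ r2 h a).
Proof.
move=> tZ [h0 h1].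
have cz (x : K) (p : int) : x != 0 -> cofin (fun y => x * y ^ p != 0).
  by move=> x0; apply: cofinW (cofin_neq 0) _ => y y0; rewrite mulf_neq0 ?expfz_neq0.
have a0 b := co_neq0 b tZ.
have HM (x y : K) (p p' : int) z : z != 0 -> x * z ^ p * (y * z ^ p') = x * y * z ^ (p + p').
  by move=> z0; rewrite mulrACA expfzDr.
rewrite /r2 expfzDr //; apply: rlimM.
  have E : cofin (fun y => co Z a * y ^ eco h a = co (cv Z h y) a).
    by apply: cofinT => y; rewrite co_cv.
  case: (sgz_case (h0 a)) => -[ha ->].
    by rewrite mulr1; apply/rlim_vv_pos/(rlim_near E)/rlim_Xpos.
  rewrite mulrN1; apply: rlim_vv_neg.
    by apply: cofinW (cz _ (eco h a) (a0 a)) _ => y; rewrite co_cv.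
  apply: rlim_near (rlim_Xpos (co Z a)^-1 ha); apply: cofinT => y.
  by rewrite co_cv invfM invr_expz.
rewrite mulr_sumr expfz_sum //.
apply: rlim_prod => b ba.
have hab : eco h a + eco h b != 0.
  by rewrite -[eco h b]opprK -eco_opp subr_eq0 h1 // eq_sym.
have E : cofin (fun y => co Z a * co Z b * y ^ (eco h a + eco h b) = co (cv Z h y) a * co (cv Z h y) b).
  by apply: cofinW (cofin_neq 0) _ => y y0; rewrite !co_cv HM.
case: (sgz_case hab) => -[hh ->].
  by rewrite mulr1; apply/rlim_pf_pos/(rlim_near E)/rlim_Xpos.
have ab0 : co Z a * co Z b != 0 by rewrite mulf_neq0.
rewrite mulrN1; apply: rlim_pf_neg.
  by apply: cofinW (cofinI E (cz _ (eco h a + eco h b) ab0)) _ => y [<-].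
apply: rlim_near (rlim_Xpos (co Z a * co Z b)^-1 hh).
by apply: cofinW E _ => y <-; rewrite [RHS]invfM invr_expz.
Qed.

Definition level (h : expo) (d : int) c mu : K := if dot mu h == d then c mu else 0.

Lemma rlim_ev_level Z h d s c : tor Z -> (forall mu, mu \in s -> dot mu h < d -> c mu = 0) ->
  rlim (fun y => y ^ (- d) * ev s c (cv Z h y)) 0 (ev s (level h d c) Z).
Proof.
move=> tZ H; rewrite /ev big_seq.
have : rlim (fun y => \sum_(mu <- s | mu \in s) c mu * mon Z mu * y ^ (dot mu h - d)) 0
   (\sum_(mu <- s | mu \in s) level h d c mu * mon Z mu).
  apply: rlim_sum => mu smu; rewrite /level; case: (ltrgtP (dot mu h) d) => hd.
  - by rewrite H // !mul0r; apply: rlim_near (rlim_cst 0 0); apply: cofinT => y; rewrite !mul0r.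
  - by rewrite mul0r; apply: rlim_Xpos; rewrite subr_gt0.
  - by rewrite hd subrr; apply: rlim_near (rlim_cst _ 0); apply: cofinT => y; rewrite mulr1.
apply: rlim_near; apply: cofinW (cofin_neq 0) _ => y y0.
rewrite mulr_sumr [RHS]big_seq; apply: eq_bigr => mu smu.
by rewrite mon_cv // expfzDr //; ring.
Qed.

Definition tcoef nu c mu : K := mon Y nu * q ^ dot mu nu * c mu.

Lemma TT_ev nu s c Z : TT nu (ev s c) Z = ev s (tcoef nu c) Z.
Proof.
rewrite /TT /ev mulr_sumr; apply: eq_bigr => mu _.
by rewrite /tr mon_cv // /tcoef; ring.
Qed.

Section Lead.
Hypothesis Hcst : forall h, regh h -> cst = \sum_a q ^ r2 h a.
Variables (s : seq expo) (c c' : expo -> K) (h : expo).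
Hypotheses (us : uniq s) (rh : regh h).
Hypothesis HD : forall Z, tor Z -> reg poles Z -> Dop (ev s c) Z = ev s c' Z.

Lemma EmE mu : Em (dbl mu + rho2 h) =
  \sum_(a : sidx) q ^ r2 h a * (mon Y (unitv a 2) * q ^ dot mu (unitv a 2)).
Proof.
apply: eq_bigr => a _; rewrite ecoD eco_dbl eco_rho2 dot_unitv expfzDr // [2 * _]mulrC.
ring.
Qed.

(** Both sides are divided by y^d and compared as y tends to 0. The constant [cst] cancels the
    unshifted terms, and what remains of D is a shift operator with constant coefficients, diagonal
    on monomials. *)
Lemma level_eq d : (forall mu, mu \in s -> dot mu h < d -> c mu = 0) ->
  (forall mu, mu \in s -> dot mu h < d -> c' mu = 0) ->
  forall mu, mu \in s -> dot mu h = d -> c' mu = Em (dbl mu + rho2 h) * c mu.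
Proof.
move=> H H' mu smu Emu.
have Ht nu x : x \in s -> dot x h < d -> tcoef nu c x = 0.
  by move=> sx dx; rewrite /tcoef H ?mulr0.
suff HZ : forall Z, tor Z ->
    ev s (fun mu => level h d c' mu - Em (dbl mu + rho2 h) * level h d c mu) Z = 0.
  have := ev_inj us HZ smu; rewrite /level Emu eqxx => /eqP.
  by rewrite subr_eq0 => /eqP.
move=> Z tZ.
have L1 := rlim_ev_level tZ H'.
have L2 : rlim (fun y => y ^ (- d) * Dop (ev s c) (cv Z h y)) 0
   (\sum_a q ^ r2 h a * (ev s (level h d (tcoef (unitv a 2) c)) Z - ev s (level h d c) Z)
     + cst * ev s (level h d c) Z).
  have : rlim (fun y => \sum_(a : sidx) vc a (cv Z h y) *
      (y ^ (- d) * ev s (tcoef (unitv a 2) c) (cv Z h y) - y ^ (- d) * ev s c (cv Z h y))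
      + cst * (y ^ (- d) * ev s c (cv Z h y))) 0
     (\sum_a q ^ r2 h a * (ev s (level h d (tcoef (unitv a 2) c)) Z - ev s (level h d c) Z)
     + cst * ev s (level h d c) Z).
    apply: rlimD; last by apply: rlimMl; apply: rlim_ev_level.
    apply: rlim_sum => a _; apply: rlimM; first exact: rlim_vc_inf.
    by apply: rlimB; apply: rlim_ev_level => //; apply: Ht.
  apply: rlim_near; apply: cofinT => y; rewrite /Dop [RHS]mulrDr; congr (_ + _); last exact: mulrCA.
  rewrite [RHS]mulr_sumr.
  by apply: eq_bigr => a _; rewrite TT_ev -mulrBr mulrCA.
have rC : cofin (fun y => reg poles (cv Z h y)).
  case: rh => h0 h1; apply: cofinI.
    apply: cofin_forall => b.
    have := @cofin_forall_seq _ K poles _ (fun x _ => cofin_co_cv x tZ (h0 b)).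
    by move/cofinW; apply=> y Hy; apply/negP => /Hy; rewrite eqxx.
  apply: cofin_forall => a; apply: cofin_forall => b; apply: cofin_imp => ab.
  by apply: cofinW (cofin_co2_cv 1 tZ (h1 _ _ ab)) _ => y; rewrite mul1r.
have {}L2 := rlim_near (G := fun y => y ^ (- d) * ev s c' (cv Z h y)) _ L2.
have E := rlim_uniq L1 (L2 _); move: {L1 L2}E.
have -> : \sum_a q ^ r2 h a * (ev s (level h d (tcoef (unitv a 2) c)) Z - ev s (level h d c) Z)
     + cst * ev s (level h d c) Z = ev s (fun mu => Em (dbl mu + rho2 h) * level h d c mu) Z.
  rewrite (Hcst rh) mulr_suml -big_split /=.
  under eq_bigr => a _ do rewrite mulrBr subrK /ev mulr_sumr.
  rewrite exchange_big /=; apply: eq_bigr => nu _.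
  rewrite EmE !mulr_suml; apply: eq_bigr => a _.
  by rewrite /level /tcoef; case: eqP => _; rewrite ?mul0r ?mulr0 //; ring.
move=> E; rewrite /ev; under eq_bigr => nu _ do rewrite mulrBl.
rewrite sumrB; apply/eqP; rewrite subr_eq0; apply/eqP; apply: E.
apply: cofinW (cofinI rC (cofin_tor_cv h tZ)) _ => y [ry ty].
by rewrite HD.
Qed.

(** As [level_eq] presupposes that c' vanishes below the level, the levels are climbed one by one
    from the bottom -B of the finite list s. *)
Lemma lead_zero d : (forall mu, mu \in s -> dot mu h < d -> c mu = 0) ->
  forall mu, mu \in s -> dot mu h < d -> c' mu = 0.
Proof.
move=> H; pose B := \sum_(mu <- s) `|dot mu h|%N.
have HB mu : mu \in s -> - B%:Z <= dot mu h.
  move=> smu; have : (`|dot mu h|%N <= B)%N by rewrite /B (big_rem mu) //= leq_addr.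
  lia.
suff main (j : nat) : - B%:Z + j%:Z <= d ->
    forall mu, mu \in s -> dot mu h < - B%:Z + j%:Z -> c' mu = 0.
  move=> mu smu dmu; apply: (main (absz (dot mu h + 1 + B%:Z))) => //.
    by have := HB mu smu; lia.
  by have := HB mu smu; lia.
elim: j => [|j IH] jd mu smu dmu; first by have := HB mu smu; lia.
have jd' : - B%:Z + j%:Z <= d by lia.
case: (ltrP (dot mu h) (- B%:Z + j%:Z)) => hd; first exact: IH.
have Ed : dot mu h = - B%:Z + j%:Z by lia.
rewrite (level_eq (d := - B%:Z + j%:Z) _ (IH jd') smu Ed).
  by rewrite H ?mulr0 //; lia.
by move=> nu snu dnu; apply: H => //; lia.
Qed.

Lemma lead_eq d : (forall mu, mu \in s -> dot mu h < d -> c mu = 0) ->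
  forall mu, mu \in s -> dot mu h = d -> c' mu = Em (dbl mu + rho2 h) * c mu.
Proof. by move=> H; apply: level_eq H (lead_zero H). Qed.
End Lead.
End LeadingTerms.

(** * Lattice points of the zonotope *)

Section Zonotope.
Variables (n k : nat) (m1 : int).
Hypothesis m1_gt0 : 0 < m1.
Local Notation sidx := ('I_n * bool)%type.
Local Notation expo := {ffun 'I_n -> int}.
Implicit Types (a b x y : sidx) (s eta h g : expo) (l : sidx -> int) (C : sidx -> sidx -> int).

Definition goodl l := [/\ forall a, l (opp a) = - l a, forall a, l a <= m1 &
  forall a, (2 %| l a - m1)%Z].
Definition goodC C := [/\ forall a b, C a b = C b a,
  forall a b, C (opp a) (opp b) = - C a b,
  forall a b, a.1 != b.1 -> C a b <= k%:Z &
  forall a b, a.1 != b.1 -> (2 %| C a b - k%:Z)%Z].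
Definition zval l C a : int := l a + \sum_(b : sidx | b.1 != a.1) C a b.

(* Twice the set of the sums of l_al al with l_al in m_al/2 + Z and
   |l_al| <= m_al/2; l a and C a b are the coefficients at e_a and e_a + e_b. *)
Definition inS s := exists l C, [/\ goodl l, goodC C & forall a, eco s a = zval l C a].

(** Elementary changes of the coefficients, extended antisymmetrically under [opp]: subtracting 2
    [dl a] or 2 [dC a b] moves the point by -2 e_a or -2 (e_a + e_b). *)
Definition dl a x : int := (x == a)%:Z - (x == opp a)%:Z.
Definition dC a b x y : int :=
  ((x == a) && (y == b))%:Z + ((x == b) && (y == a))%:Z
  - ((x == opp a) && (y == opp b))%:Z - ((x == opp b) && (y == opp a))%:Z.

Lemma opp_eq a b : (opp a == b) = (a == opp b).
Proof. by rewrite -(inj_eq (inv_inj (@oppK n))) oppK. Qed.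

Lemma neq_opp a : (a == opp a) = false.
Proof. by rewrite eq_sym opp_neq. Qed.

Lemma dl_opp a x : dl a (opp x) = - dl a x.
Proof. by rewrite /dl !opp_eq oppK; lia. Qed.

Lemma dl_oppl a x : dl (opp a) x = - dl a x.
Proof. by rewrite /dl oppK; lia. Qed.

Lemma fst_neq a b : a.1 != b.1 -> [/\ (a == b) = false, (a == opp b) = false,
  (b == a) = false & (b == opp a) = false].
Proof.
move=> ab; split; apply: contraNF ab => /eqP -> //=.
Qed.

(** By parity l a > -m1 means l a >= 2 - m1, so the opposite coefficient stays at most m1. *)
Lemma goodl_move l a : goodl l -> - m1 < l a -> goodl (fun x => l x - 2 * dl a x).
Proof.
move=> [h1 h2 h3] la; split=> [x|x|x].
- by rewrite h1 dl_opp; lia.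
- have := h2 x; rewrite /dl; case: eqP => [->|_] /=; first by rewrite neq_opp; lia.
  case: eqP => [->|_] /=; last lia.
  by rewrite h1; have := h3 a; lia.
- by have := h3 x; move: (dl a x) => d; lia.
Qed.

Lemma goodC_move C a b : goodC C -> a.1 != b.1 -> - k%:Z < C a b ->
  goodC (fun x y => C x y - 2 * dC a b x y).
Proof.
move=> [h1 h2 h3 h4] ab la; have [n1 n2 n3 n4] := fst_neq ab.
have hd x y : dC a b x y = dC a b y x.
  by rewrite /dC ![(x == _) && _]andbC; ring.
split=> [x y|x y|x y xy|x y xy].
- by rewrite h1 hd.
- by rewrite h2 /dC !opp_eq !oppK; ring.
- have := h3 _ _ xy; rewrite /dC.
  case E1 : ((x == opp a) && (y == opp b)).
    case/andP: E1 => /eqP -> /eqP ->; rewrite !opp_eq ?oppK ?neq_opp ?n1 ?n2 ?n3 ?n4 ?andbF /=.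
    by rewrite h2; have := h4 _ _ ab; lia.
  case E2 : ((x == opp b) && (y == opp a)).
    case/andP: E2 => /eqP -> /eqP ->; rewrite !opp_eq ?oppK ?neq_opp ?n1 ?n2 ?n3 ?n4 ?andbF /=.
    by rewrite h1 h2; have := h4 _ _ ab; lia.
  by move: (C x y) (_ && _) (_ && _) => z [] []; clear; lia.
- by have := h4 _ _ xy; move: (dC a b x y) => d; lia.
Qed.

Lemma sum_dC a b x : a.1 != b.1 -> \sum_(y | y.1 != x.1) dC a b x y = dl a x + dl b x.
Proof.
move=> ab; have ba : b.1 != a.1 by rewrite eq_sym.
have P (u v : sidx) : u.1 != v.1 ->
    \sum_(y : sidx | y.1 != x.1) ((x == u) && (y == v))%:Z = (x == u)%:Z.
  move=> uv; case: (x =P u) => [->|_] /=; last by rewrite big1.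
  by rewrite (bigD1 v) 1?eq_sym //= eqxx big1 ?addr0 // => y /andP[_ /negPf ->].
rewrite /dC /dl !sumrB big_split /= !P //; lia.
Qed.

Lemma val_move l C a b x : a.1 != b.1 ->
  zval l (fun x y => C x y - 2 * dC a b x y) x = zval l C x - 2 * (dl a x + dl b x).
Proof.
by move=> ab; rewrite /zval sumrB -mulr_sumr sum_dC // addrA.
Qed.

Lemma val_movel l C a x : zval (fun x => l x - 2 * dl a x) C x = zval l C x - 2 * dl a x.
Proof. by rewrite /zval addrAC. Qed.

Lemma eco_unitv_dl a p x : eco (unitv a p) x = p * dl a x.
Proof.
rewrite eco_unitv fst_eqE /dl; case: (x =P a) => [->|_] /=; first by rewrite neq_opp subr0 mulr1.
by case: (x =P opp a) => _ /=; rewrite ?sub0r ?mulrN1 ?mulr0.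
Qed.

Lemma ecoN s a : eco (- s) a = - eco s a.
Proof. by rewrite /eco ffunE /sgi; case: a.2. Qed.

(** If l a can be lowered, that is the move. Otherwise l a = -m1, and positivity of the coordinate
    yields b with C a b + C a (opp b) > 0: lowering both of these moves the point by -4 e_a, and
    raising l a gives back 2 e_a. *)
Lemma inS_sub1 s a : inS s -> 0 < eco s a -> inS (s - unitv a 2).
Proof.
move=> [l [C [Gl GC E]]]; rewrite E => s0; have [l1 l2 l3] := Gl; have [c1 c2 c3 c4] := GC.
have E' x : eco (s - unitv a 2) x = zval l C x - 2 * dl a x.
  by rewrite ecoD ecoN eco_unitv_dl E.
case: (ltrP (- m1) (l a)) => la.
  exists (fun x => l x - 2 * dl a x), C; split=> // [|x]; first exact: goodl_move.
  by rewrite val_movel E'.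
have [b ba Hb] : exists2 b, b.1 != a.1 & 0 < C a b + C a (opp b).
  apply: contrapT => Hn.
  have : \sum_(b : sidx | b.1 != a.1) (C a b + C a (opp b)) <= 0.
    apply: sumr_le0 => b ba; rewrite leNgt; apply/negP => Hb; apply: Hn; by exists b.
  rewrite big_split /= [X in _ + X](_ : _ = \sum_(b : sidx | b.1 != a.1) C a b); last first.
    by rewrite [RHS](reindex_inj (inv_inj (@oppK n))).
  by move: s0 la; rewrite /zval; move: (\sum_(b : sidx | b.1 != a.1) C a b) (l a) => S la; clear -m1_gt0; lia.
have ab : a.1 != b.1 by rewrite eq_sym.
have B1 : - k%:Z < C a b by have := c3 a (opp b) ab; lia.
have B2 : - k%:Z < C a (opp b) by have := c3 a b ab; lia.
have [n1 n2 n3 n4] := fst_neq ab.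
have G1 := goodC_move GC ab B1.
have G2 : goodC (fun x y => (C x y - 2 * dC a b x y) - 2 * dC a (opp b) x y).
  apply: (goodC_move (a := a) (b := opp b) G1 ab).
  by rewrite /dC eqxx opp_neq !n1 n2 neq_opp /= ?andbF; lia.
exists (fun x => l x - 2 * dl (opp a) x), (fun x y => (C x y - 2 * dC a b x y) - 2 * dC a (opp b) x y).
split=> // [|x].
  by apply: goodl_move => //; rewrite l1; lia.
rewrite val_movel (val_move _ (fun x y => C x y - 2 * dC a b x y) x (b := opp b) ab) val_move // E' !dl_oppl; ring.
Qed.

(** The move lowers the coefficient of e_a - e_b if possible; failing that, it trades l a against l
    b when l b < l a. In the remaining case a third index y has C b y < C a y, and the move trades C
    a y against C b y. *)
Lemma inS_sub2 s a b : inS s -> a.1 != b.1 -> eco s b < eco s a ->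
  inS (s - unitv a 2 + unitv b 2).
Proof.
move=> [l [C [Gl GC E]]] ab; rewrite !E => s0; have [l1 l2 l3] := Gl; have [c1 c2 c3 c4] := GC.
have ba : b.1 != a.1 by rewrite eq_sym.
have [n1 n2 n3 n4] := fst_neq ab.
have E' x : eco (s - unitv a 2 + unitv b 2) x = zval l C x - 2 * dl a x + 2 * dl b x.
  by rewrite !ecoD ecoN !eco_unitv_dl E.
case: (ltrP (- k%:Z) (C a (opp b))) => cab.
  exists l, (fun x y => C x y - 2 * dC a (opp b) x y); split=> // [|x].
    exact: (goodC_move (b := opp b) GC ab).
  by rewrite (val_move _ _ _ (b := opp b)) // E' dl_oppl; ring.
case: (ltrP (l b) (l a)) => lab.
  have lb := l1 b; have B1 : - m1 < l a by have := l2 (opp b); lia.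
  have G1 := goodl_move Gl B1.
  have G2 : goodl (fun x => (l x - 2 * dl a x) - 2 * dl (opp b) x).
    apply: (goodl_move (a := opp b) G1).
    by rewrite lb /dl opp_eq n4 (inj_eq (inv_inj (@oppK n))) n3; have := l2 a; lia.
  exists (fun x => (l x - 2 * dl a x) - 2 * dl (opp b) x), C; split=> // x.
  by rewrite (val_movel (fun x => l x - 2 * dl a x)) val_movel E' dl_oppl; ring.
have SP u v : u.1 != v.1 -> \sum_(y : sidx | y.1 != u.1) C u y =
    C u v + C u (opp v) + \sum_(y : sidx | (y.1 != u.1) && (y.1 != v.1)) C u y.
  move=> uv; have vu : v.1 != u.1 by rewrite eq_sym.
  rewrite (bigD1 v) //= (bigD1 (opp v)) /= ?vu ?opp_neq // addrA; congr (_ + _).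
  by apply: eq_bigl => y; rewrite (fst_eqE v) negb_or andbA.
have [y [ya yb Hy]] : exists y, [/\ y.1 != a.1, y.1 != b.1 & C b y < C a y].
  apply: contrapT => Hn.
  have : \sum_(y : sidx | (y.1 != a.1) && (y.1 != b.1)) (C a y - C b y) <= 0.
    apply: sumr_le0 => y /andP[ya yb]; rewrite leNgt; apply/negP => Hb; apply: Hn.
    by exists y; split=> //; lia.
  move: s0; rewrite /zval (SP a b) // (SP b a) // sumrB.
  rewrite [X in _ + (_ + X)](eq_bigl (fun y => (y.1 != a.1) && (y.1 != b.1))); last first.
    by move=> y; rewrite andbC.
  have : C b (opp a) = - C a (opp b) by rewrite c1 -c2 oppK.
  have := c1 a b; move: cab lab.
  move: (\sum_(y | _) C a y) (\sum_(y | _) C b y) (C a b) (C b a) (C a (opp b)) (C b (opp a)) (l a) (l b).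
  by clear => *; lia.
have ay : a.1 != y.1 by rewrite eq_sym.
have yb' : b.1 != y.1 by rewrite eq_sym.
have B1 : - k%:Z < C a y.
  by have := c3 (opp b) (opp y) yb'; rewrite c2; move: Hy; clear; lia.
have G1 := goodC_move GC ay B1.
have [m1' m2 m3 m4] := fst_neq yb'.
have G2 : goodC (fun x z => (C x z - 2 * dC a y x z) - 2 * dC (opp b) (opp y) x z).
  apply: (goodC_move (a := opp b) (b := opp y) G1 yb').
  rewrite c2 /dC !(inj_eq (inv_inj (@oppK n))) !opp_eq n3 n4 m1' m2 /=.
  by have := c3 _ _ ay; move: Hy; clear; lia.
exists l, (fun x z => (C x z - 2 * dC a y x z) - 2 * dC (opp b) (opp y) x z); split=> // x.
rewrite (val_move _ (fun x z => C x z - 2 * dC a y x z) x (a := opp b) (b := opp y)) //.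
by rewrite val_move // E' !dl_oppl; ring.
Qed.

End Zonotope.

(** * From the chamber inequalities to lattice points of the zonotope *)

Section ZonotopePoints.
Variables (n k : nat) (m1 : int).
Hypothesis m1_gt0 : 0 < m1.
Local Notation sidx := ('I_n * bool)%type.
Local Notation expo := {ffun 'I_n -> int}.
Local Notation r2 := (r2 k m1).
Local Notation rho2 := (rho2 k m1).
Local Notation inS := (inS k m1).
Implicit Types (a b x y : sidx) (s eta h g : expo).

Lemma even_addz (x y : int) : (2 %| x)%Z -> (2 %| y)%Z -> (2 %| x + y)%Z.
Proof. by clear; lia. Qed.

Lemma sum_even (I : finType) (Q : pred I) (F : I -> int) :
  (forall i, (2 %| F i)%Z) -> (2 %| (\sum_(i | Q i) F i)%R)%Z.
Proof. by move=> H; elim/big_rec: _ => // i x _; apply: even_addz. Qed.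

Lemma sgz_odd (x : int) : x != 0 -> sgz x = 1 \/ sgz x = -1.
Proof. by case/sgz_case => -[_ ->]; [left|right]. Qed.

Lemma regh_opp h : regh h -> regh (- h).
Proof. by case=> h0 h1; split=> [a|a b ab]; rewrite !ecoN ?oppr_eq0 ?(inj_eq oppr_inj) ?h1. Qed.

Lemma r2N h a : r2 (- h) a = - r2 h a.
Proof.
rewrite /r2 ecoN sgzN mulrN opprD; congr (_ + _).
rewrite -mulrN -sumrN; congr (_ * _); apply: eq_bigr => b _.
by rewrite ecoN -opprD sgzN.
Qed.

Section Sorted.
Variable eta : expo.

(** Sorting the indices by absolute value, with signs making eta nonnegative, puts eta into the
    dominant chamber. *)
Lemma sorted_frame : exists W : 'I_n -> sidx,
  [/\ injective (fst \o W), forall p, 0 <= eco eta (W p) &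
      forall p p' : 'I_n, (p <= p')%N -> eco eta (W p') <= eco eta (W p)].
Proof.
pose r a b := eco eta b <= eco eta a.
pose w0 : seq sidx := [seq (i, eta i < 0) | i <- enum 'I_n].
have sw : size (sort r w0) == n by rewrite size_sort size_map size_enum_ord.
have tot : total r by move=> a b; rewrite /r; apply: le_total.
have tr : transitive r by move=> a b c ab bc; apply: le_trans bc ab.
exists (tnth (Tuple sw)); split=> [p p' /= E|p|p p' pp'].
- have U : uniq (map fst (sort r w0)).
    rewrite (perm_uniq (perm_map fst (permEl (perm_sort r w0)))) -map_comp map_id_in ?enum_uniq //.
  apply/val_inj/eqP => /=; pose x0 := tnth (Tuple sw) p.
  rewrite -(nth_uniq x0.1 _ _ U) ?size_map ?(eqP sw) ?ltn_ord //.
  rewrite !(nth_map x0) ?(eqP sw) ?ltn_ord // -!(tnth_nth x0 (Tuple sw)).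
  exact/eqP.
- have : tnth (Tuple sw) p \in sort r w0 by apply: mem_tnth.
  rewrite mem_sort => /mapP[i _ ->]; rewrite /eco /sgi /=.
  by case: ltrP => //; lia.
- have S := sort_sorted tot w0.
  have := sorted_leq_nth tr (fun a => lexx _ : r a a) (tnth (Tuple sw) p) S.
  move=> /(_ p p'); rewrite !inE (eqP sw) !ltn_ord => /(_ isT isT pp').
  by rewrite -!(tnth_nth _ (Tuple sw)).
Qed.

Variable W : 'I_n -> sidx.
Hypotheses (injW : injective (fst \o W)) (W0 : forall p, 0 <= eco eta (W p))
  (Wle : forall p p' : 'I_n, (p <= p')%N -> eco eta (W p') <= eco eta (W p)).

Definition vec (t : 'I_n -> int) : expo :=
  [ffun i => sgi (W (invF injW i)) (t (invF injW i))].

Lemma invFW p : invF injW (W p).1 = p.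
Proof. exact: (invF_f injW). Qed.

Lemma Wall a : exists p, a = W p \/ a = opp (W p).
Proof.
exists (invF injW a.1); apply: same_fst.
by have := f_invF injW a.1.
Qed.

Lemma W_neq p p' : p != p' -> (W p).1 != (W p').1.
Proof. by apply: contra_neq => /injW. Qed.

Lemma eco_vec t p : eco (vec t) (W p) = t p.
Proof. by rewrite /eco ffunE invFW sgiK. Qed.

Lemma dot_vec s t : dot s (vec t) = \sum_p eco s (W p) * t p.
Proof.
rewrite /dot (reindex (fst \o W)) /=; last first.
  by apply: onW_bij; exists (invF injW); [exact: invF_f|exact: f_invF].
apply: eq_bigr => p _; rewrite ffunE invFW /eco /sgi.
by case: (W p).2; rewrite ?mulrN ?mulNr.
Qed.

Definition decr (t : 'I_n -> int) :=
  (forall p, 0 < t p) /\ (forall p p' : 'I_n, (p < p')%N -> t p' < t p).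

Lemma vec_pair t a b : decr t -> a.1 != b.1 -> exists p p' (u v : bool),
  [/\ p != p', eco (vec t) a = (-1) ^+ u * t p, eco (vec t) b = (-1) ^+ v * t p' &
      forall t', eco (vec t') a = (-1) ^+ u * t' p /\ eco (vec t') b = (-1) ^+ v * t' p'].
Proof.
move=> [t0 t1] ab; have [p Hp] := Wall a; have [p' Hp'] := Wall b.
have pp' : p != p'.
  by apply: contraNneq ab => E; rewrite E in Hp; case: Hp => ->; case: Hp' => ->.
have E (t' : 'I_n -> int) x r : x = W r \/ x = opp (W r) ->
    eco (vec t') x = (-1) ^+ (x != W r) * t' r.
  case=> ->; first by rewrite eqxx mul1r eco_vec.
  by rewrite opp_neq eco_opp eco_vec mulN1r.
by exists p, p', (a != W p), (b != W p'); split=> [//|||t']; rewrite !(E _ a p, E _ b p').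
Qed.

Lemma regh_vec t : decr t -> regh (vec t).
Proof.
move=> dt; have [t0 t1] := dt; split=> [a|a b ab].
  have [p [->|->]] := Wall a; rewrite ?eco_opp eco_vec ?oppr_eq0; have := t0 p; lia.
have [p [p' [u [v [pp' -> -> _]]]]] := vec_pair dt ab.
have := t0 p; have := t0 p'; case: (ltngtP p p') => [/t1|/t1|/val_inj E].
- by case: u; case: v; rewrite ?expr0 ?expr1 ?mulN1r ?mul1r; clear; lia.
- by case: u; case: v; rewrite ?expr0 ?expr1 ?mulN1r ?mul1r; clear; lia.
- by rewrite E eqxx in pp'.
Qed.

Lemma sgz_pos (x : int) : 0 < x -> sgz x = 1. Proof. exact: gtr0_sgz. Qed.
Lemma sgz_neg (x : int) : x < 0 -> sgz x = -1. Proof. exact: ltr0_sgz. Qed.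

(** Only the signs of t_p and of t_p + t_p', t_p - t_p' enter, and these are the same for all
    positive decreasing t: [r2] is constant on a chamber. *)
Lemma r2_vec t t' a : decr t -> decr t' -> r2 (vec t) a = r2 (vec t') a.
Proof.
move=> dt dt'; have [t0 t1] := dt; have [t0' t1'] := dt'; rewrite /r2; congr (_ * _ + _ * _).
  have [p [->|->]] := Wall a; rewrite ?eco_opp !eco_vec ?sgzN !sgz_pos //.
apply: eq_bigr => b ba; have [|p [p' [u [v [pp' -> -> /(_ t')[-> ->]]]]]] := vec_pair (a := a) (b := b) dt.
  by rewrite eq_sym.
have := t0 p; have := t0 p'; have := t0' p; have := t0' p'.
case: (ltngtP p p') => [pq|pq|/val_inj E]; last by rewrite E eqxx in pp'.
- have := t1 _ _ pq; have := t1' _ _ pq; case: u; case: v; rewrite ?expr0 ?expr1 ?mulN1r ?mul1r => *.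
  + by rewrite !sgz_neg //; lia.
  + by rewrite !sgz_neg //; lia.
  + by rewrite !sgz_pos //; lia.
  + by rewrite !sgz_pos //; lia.
- have := t1 _ _ pq; have := t1' _ _ pq; case: u; case: v; rewrite ?expr0 ?expr1 ?mulN1r ?mul1r => *.
  + by rewrite !sgz_neg //; lia.
  + by rewrite !sgz_pos //; lia.
  + by rewrite !sgz_neg //; lia.
  + by rewrite !sgz_pos //; lia.
Qed.

Definition tstd (p : 'I_n) : int := n%:Z - p%:Z.

Lemma decr_std N (j : nat) : decr (fun p => N%:Z * (p < j)%N%:Z + tstd p).
Proof.
split=> [p|p p' pp']; rewrite /tstd; first by have := ltn_ord p; lia.
have H : (p' < j)%N -> (p < j)%N by lia.
move: H pp'; case: (p' < j)%N; case: (p < j)%N => H pp';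
  first [by have := H isT | by rewrite ?mulr0 ?mulr1; move: pp'; clear; lia].
Qed.

(** The partial sum A is the pairing with a fundamental weight, which is not regular. The directions
    N 1_(p < j) + [tstd] are regular in the same chamber and give N A + B >= 0 for every N, hence A
    >= 0. *)
Lemma partial_ge0 s (j : nat) : (forall h, regh h -> 0 <= dot (rho2 h - eta) h) ->
  s = rho2 (vec tstd) ->
  0 <= \sum_(p : 'I_n | (p < j)%N) (eco s (W p) - eco eta (W p)).
Proof.
move=> H ->; set g := vec tstd; set A := \sum_(p | _) _.
pose B := \sum_p (eco (rho2 g) (W p) - eco eta (W p)) * tstd p.
have key (N : nat) : 0 <= N%:Z * A + B.
  pose t (p : 'I_n) := N%:Z * (p < j)%N%:Z + tstd p.
  have dt : decr t by apply: decr_std.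
  have dg : decr tstd.
    have [h0 h1] := decr_std 0 0; split=> [p|p p' pp'].
      by have := h0 p; rewrite mul0r add0r.
    by have := h1 _ _ pp'; rewrite !mul0r !add0r.
  have := H _ (regh_vec dt); rewrite dot_vec.
  suff -> : \sum_p eco (rho2 (vec t) - eta) (W p) * t p = N%:Z * A + B by [].
  pose E p := eco (rho2 g) (W p) - eco eta (W p).
  transitivity (\sum_(p : 'I_n) (N%:Z * (if (p < j)%N then E p else 0) + E p * tstd p)); last first.
    by rewrite big_split -mulr_sumr -big_mkcond.
  apply: eq_bigr => p _; rewrite ecoD ecoN /E !eco_rho2 (r2_vec _ dt dg) /t.
  by case: ltnP => _ /=; ring.
rewrite leNgt; apply/negP => A0.
have := key `|B|.+1; nia.
Qed.

Lemma dl_W p p' : dl (W p) (W p') = (p == p')%:Z.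
Proof.
rewrite /dl; case: (p =P p') => [->|/eqP pp']; first by rewrite eqxx neq_opp.
by have [n1 n2 n3 n4] := fst_neq (W_neq pp'); rewrite n3 n4.
Qed.

Definition psum s (j : nat) := \sum_(p : 'I_n | (p < j)%N) (eco s (W p) - eco eta (W p)).

Lemma psumS s (p : 'I_n) : psum s p.+1 = psum s p + (eco s (W p) - eco eta (W p)).
Proof.
rewrite /psum (bigD1 p) //= addrC; congr (_ + _); apply: eq_bigl => i.
by rewrite ltnS -val_eqE /= ltn_neqAle andbC.
Qed.

Lemma psum0 s : psum s 0 = 0. Proof. by rewrite /psum big1. Qed.

Lemma psum_sub s (p : 'I_n) (r : int) j :
  psum (s + unitv (W p) r) j = psum s j + r * (p < j)%N%:Z.
Proof.
rewrite /psum; under eq_bigr do rewrite ecoD eco_unitv_dl dl_W addrAC.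
rewrite big_split /= -mulr_sumr; congr (_ + _ * _).
case: ltnP => pj; last first.
  by rewrite big1 // => i ij; case: (p =P i) => // E; rewrite -E ltnNge pj in ij.
by rewrite (bigD1 p) //= eqxx big1 ?addr0 // => i /andP[_]; rewrite eq_sym => /negPf ->.
Qed.

Lemma psum_even s j : (forall a, (2 %| eco s a - eco eta a)%Z) -> (2 %| psum s j)%Z.
Proof. by move=> H; apply: sum_even. Qed.

(** Descent in the dominance order, measured by the total of the partial sums of s - eta. At the
    first positive partial sum s exceeds eta at i. If the partial sums return to 0, the excess is
    passed by [inS_sub2] to the place i' where this happens, at which s is below eta; otherwise it
    is removed by [inS_sub1]. *)
Lemma inS_chain (N : nat) s : inS s -> (forall a, (2 %| eco s a - eco eta a)%Z) ->
  (forall j, (j <= n)%N -> 0 <= psum s j) ->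
  \sum_(j < n.+1) psum s j <= N%:Z -> inS eta.
Proof.
elim/ltn_ind: N s => N IH s Ss Es Ps Ns.
have ev := psum_even _ Es.
case: (pselect (exists j, (j <= n)%N && (0 < psum s j))) => [Hex|Hn]; last first.
  have P0 j : (j <= n)%N -> psum s j = 0.
    move=> jn; apply/eqP; rewrite eq_le Ps // andbT leNgt; apply/negP => pj; apply: Hn.
    by exists j; rewrite jn.
  case: Ss => l [C [Gl GC E]]; exists l, C; split=> // a.
  have HW p : eco eta (W p) = eco s (W p).
    have := psumS s p; rewrite !P0 //; last exact: ltnW.
    by clear; lia.
  by rewrite -E; have [p [->|->]] := Wall a; rewrite ?eco_opp HW.
case: (ex_minnP Hex) => j0 /andP[j0n pj0] min0.
have [i Ei] : exists i : 'I_n, j0 = i.+1.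
  case: j0 j0n pj0 {min0} => [|i] in_ p0; first by rewrite psum0 in p0.
  by exists (Ordinal in_).
have pi0 : psum s i = 0.
  apply/eqP; rewrite eq_le Ps 1?ltnW // andbT leNgt; apply/negP => pi.
  by have := min0 i; rewrite pi Ei ltnn (ltnW (ltn_ord i)) => /(_ isT).
have Di : eco eta (W i) < eco s (W i).
  by move: pj0; rewrite Ei psumS pi0; clear; lia.
have low j : (j <= i)%N -> psum s j = 0.
  move=> ji; have jn : (j <= n)%N by apply: leq_trans ji (ltnW (ltn_ord i)).
  apply/eqP; rewrite eq_le Ps // andbT leNgt; apply/negP => pj.
  by have := min0 j; rewrite pj jn Ei => /(_ isT); rewrite leqNgt ltnS ji.
(* Subtracting 2 e_(W i), and possibly adding 2 e_(W i') back, decreases the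
   partial sums on a range where they are positive, hence at least 2. *)
have step s' (hi : nat) : (i < hi <= n)%N -> inS s' ->
    (forall j, (i < j <= hi)%N -> 0 < psum s j) ->
    (forall a, (2 %| eco s' a - eco s a)%Z) ->
    (forall j, (j <= n)%N -> psum s' j = psum s j - 2 * ((i < j <= hi)%N)%:Z) ->
    inS eta.
  move=> /andP[ihi hin] Ss' pos Es' Ps'.
  have P2 j : (i < j <= hi)%N -> 2 <= psum s j.
    by move=> jj; have := pos _ jj; have := ev j; clear; lia.
  have Ps'0 j : (j <= n)%N -> 0 <= psum s' j.
    move=> jn; rewrite Ps' //; case E : (i < j <= hi)%N; first by have := P2 j E; clear; lia.
    by rewrite mulr0 subr0 Ps.
  have lt : \sum_(j < n.+1) psum s' j < N%:Z.
    apply: lt_le_trans Ns; pose jj : 'I_n.+1 := Ordinal (ltn_ord i : (i.+1 < n.+1)%N).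
    rewrite (bigD1 jj) // [X in _ < X](bigD1 jj) //=.
    apply: ltr_leD.
      by rewrite Ps' //= ltnSn ihi /=; clear; lia.
    apply: ler_sum => j _; rewrite Ps' -1?ltnS //.
    by case: (i < j <= hi)%N; clear; lia.
  have ge0 : 0 <= \sum_(j < n.+1) psum s' j.
    by apply: sumr_ge0 => j _; apply: Ps'0; rewrite -ltnS.
  apply: (IH (absz (\sum_(j < n.+1) psum s' j)) _ s') => //.
  - by move: lt ge0; clear; lia.
  - move=> a; have -> : eco s' a - eco eta a = (eco s' a - eco s a) + (eco s a - eco eta a).
      by rewrite addrA subrK.
    exact: even_addz.
  - by move: ge0; clear; lia.
have N2 a p : unitv a (- p) = - unitv a p.
  by apply/ffunP => x; rewrite !ffunE /sgi; case: ifP => _; case: a.2; rewrite ?oppr0.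
case: (pselect (exists J, [&& (i < J)%N, (J <= n)%N & psum s J == 0])) => [HJ|HnJ]; last first.
  apply: (step (s - unitv (W i) 2) n); rewrite ?leqnn ?ltn_ord //.
  - by apply: inS_sub1 => //; have := W0 i; move: Di; clear; lia.
  - move=> j /andP[ij jn]; rewrite lt_neqAle Ps // andbT eq_sym; apply/negP => /eqP E.
    by apply: HnJ; exists j; rewrite ij jn E eqxx.
  - move=> a; rewrite ecoD ecoN eco_unitv_dl; move: (dl _ _) (eco s a) => d x; clear; lia.
  - by move=> j jn; rewrite -N2 psum_sub jn andbT mulNr.
case: (ex_minnP HJ) => J /and3P[iJ Jn /eqP pJ] minJ.
have posJ j : (i < j < J)%N -> 0 < psum s j.
  move=> /andP[ij jJ]; rewrite lt_neqAle Ps 1?(leq_trans (ltnW jJ)) // andbT eq_sym.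
  apply/negP => pj; have := minJ j; rewrite ij pj (leq_trans (ltnW jJ) Jn) => /(_ isT).
  by rewrite leqNgt jJ.
have [i' Ei'] : exists i' : 'I_n, J = i'.+1.
  by case: J iJ Jn {pJ minJ posJ} => [|J] // _ Jn; exists (Ordinal Jn).
have ii' : (i < i')%N.
  rewrite ltn_neqAle -ltnS -Ei' iJ andbT; apply/eqP => /val_inj E.
  by move: pJ pj0; rewrite Ei' Ei E => ->.
have Di' : eco s (W i') < eco eta (W i').
  have := posJ i'; rewrite ii' Ei' leqnn => /(_ isT); move: pJ; rewrite Ei' psumS.
  by clear; lia.
apply: (step (s - unitv (W i) 2 + unitv (W i') 2) i'); rewrite ?ii' ?(ltnW (ltn_ord i')) //.
- apply: inS_sub2 => //; first by apply: W_neq; apply: contraTneq ii' => ->; rewrite ltnn.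
  by have := Wle (ltnW ii'); move: Di Di'; clear; lia.
- by move=> j /andP[ij ji']; apply: posJ; rewrite ij Ei' ltnS ji'.
- move=> a; rewrite !ecoD ecoN !eco_unitv_dl.
  by move: (dl _ _) (dl _ _) (eco s a) => d d' x; clear; lia.
- move=> j jn; rewrite psum_sub -N2 psum_sub.
  move: (psum s j) ii' => x; case: (ltnP i j) => h1; case: (ltnP i' j) => h2; case: (leqP j i') => h3 /=;
    by [clear; lia | move: h1 h2 h3; clear; lia].
Qed.
End Sorted.

(** Read at -h, the inequalities say that eta is dominated by the vertex [rho2 g] of its own
    chamber. All coefficients of this vertex are extremal, so it lies in [inS], and [inS_chain]
    descends from it to eta. *)
Lemma zonotope_points eta : (forall h, regh h -> 0 <= dot (eta + rho2 h) h) ->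
  (forall h a, regh h -> (2 %| eco eta a - r2 h a)%Z) -> inS eta.
Proof.
move=> H P.
have H' h : regh h -> 0 <= dot (rho2 h - eta) h.
  move=> rh; have := H _ (regh_opp rh).
  have -> : rho2 (- h) = - rho2 h.
    by apply/ffunP => i; rewrite !ffunE r2N.
  suff -> : dot (eta + - rho2 h) (- h) = dot (rho2 h - eta) h by [].
  by apply: eq_bigr => i _; rewrite !ffunE mulrN -mulNr opprD opprK addrC.
have [W [injW W0 Wle]] := sorted_frame eta.
have dg : decr tstd.
  have [h0 h1] := decr_std 0 0; split=> [p|p p' pp'].
    by have := h0 p; rewrite mul0r add0r.
  by have := h1 _ _ pp'; rewrite !mul0r !add0r.
pose g := vec injW tstd.
have rg : regh g by apply: regh_vec dg.
have gab a b : a.1 != b.1 -> eco g a + eco g b != 0.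
  by case: rg => _ g1 ab; rewrite -[eco g b]opprK -eco_opp subr_eq0 g1.
have Sg : inS (rho2 g).
  exists (fun a => m1 * sgz (eco g a)), (fun a b => k%:Z * sgz (eco g a + eco g b)); split.
  - split=> a; first by rewrite eco_opp sgzN mulrN.
      by case: (sgz_odd (rg.1 a)) => ->; move: m1_gt0; clear; lia.
    by case: (sgz_odd (rg.1 a)) => ->; clear; lia.
  - split=> [a b|a b|a b ab|a b ab].
    + by rewrite addrC.
    + by rewrite !eco_opp -opprD sgzN mulrN.
    + by case: (sgz_odd (gab _ _ ab)) => ->; clear; lia.
    + by case: (sgz_odd (gab _ _ ab)) => ->; clear; lia.
  - by move=> a; rewrite eco_rho2 /zval -mulr_sumr.
apply: (inS_chain injW W0 Wle (N := absz (\sum_(j < n.+1) psum eta W (rho2 g) j)) Sg) => //.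
- move=> a; rewrite eco_rho2 -opprB.
  by have := P g a rg; move: (_ - _) => x; clear; lia.
- by move=> j jn; apply: partial_ge0.
- by clear; lia.
Qed.
End ZonotopePoints.

(** * The eigenvalue argument *)

Section Boxes.
Variables (n : nat).
Local Notation expo := {ffun 'I_n -> int}.
Implicit Types (mu : expo).

Definition boxs (B : nat) : seq expo :=
  [seq [ffun i : 'I_n => (f i : nat)%:Z - B%:Z] | f : {ffun 'I_n -> 'I_(B + B).+1}].

Lemma uniq_boxs B : uniq (boxs B).
Proof.
rewrite map_inj_uniq ?enum_uniq // => f f' /ffunP E; apply/ffunP => i.
by have := E i; rewrite !ffunE => /addIr[] /val_inj.
Qed.

Lemma mem_boxs B mu : (mu \in boxs B) = [forall i, `|mu i| <= B%:Z].
Proof.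
apply/mapP/forallP => [[f _ ->] i|H].
  by rewrite ffunE; case: (f i) => v /= vB; rewrite ler_norml; move: vB; clear; lia.
exists [ffun i => inord (absz (mu i + B%:Z))]; first by rewrite mem_enum.
apply/ffunP => i; rewrite !ffunE inordK; have := H i; rewrite ler_norml; move: (mu i) => x; clear; lia.
Qed.

Lemma boxs_sub B B' : (B <= B')%N -> {subset boxs B <= boxs B'}.
Proof.
move=> BB mu; rewrite !mem_boxs => /forallP H; apply/forallP => i.
by apply: le_trans (H i) _; rewrite lez_nat.
Qed.
End Boxes.

(** * The finite-dimensional space preserved by D *)

Section CoefficientOperator.
Variables (K : numFieldType) (n : nat) (q : K).
Hypotheses (q0 : q != 0) (hq : forall N : nat, (0 < N)%N -> q ^+ N != 1).
Variables (k : nat) (LL : bool -> nat * nat) (kap cst : K) (Y : 'I_n -> K).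
Hypotheses (HLL : forall b, odd ((LL b).1 + (LL b).2)) (tY : tor Y).
Local Notation pt := ('I_n -> K).
Local Notation sidx := ('I_n * bool)%type.
Local Notation expo := {ffun 'I_n -> int}.
Local Notation TT := (TT q Y).
Local Notation Dop := (Dop q k LL kap cst Y).
Local Notation cond1 := (cond1 q LL Y).
Local Notation cond2 := (cond2 q k Y).
Local Notation poles := (poles q).
Variable m1 : int.
Hypothesis m1_gt0 : 0 < m1.
Hypothesis Hm1 : 2 * m1 = 2 + \sum_(e : bool) ((LL e).1 + (LL e).2)%N%:Z.
Hypothesis Hkap : kap = q ^ (- m1).
Local Notation r2 := (r2 k m1).
Local Notation rho2 := (rho2 k m1).
Implicit Types (Z : pt) (a b : sidx) (mu nu h eta : expo) (f g : pt -> K) (e : bool)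
  (s : seq expo) (c : expo -> K).
Hypothesis Hcst : forall h, regh h -> cst = \sum_a q ^ r2 h a.

(** One half-space for each regular direction h, bounded at -[rho2 h], which is the extreme exponent
    of Q in that direction. *)
Definition hull c := forall mu, c mu != 0 -> forall h, regh h -> 0 <= dot (mu + rho2 h) h.

(** The entry n + 1 at i exceeds all other absolute values, so the direction is regular. The two
    choices of e' have opposite entries elsewhere, and adding their inequalities bounds mu i
    alone. *)
Definition probe (i : 'I_n) (e e' : bool) : expo :=
  [ffun j : 'I_n => if j == i then (-1) ^+ e * n.+1%:Z else (-1) ^+ e' * j.+1%:Z].

Lemma regh_probe i e e' : regh (probe i e e').
Proof.
split=> [a|a b ab].
  rewrite /eco sgi_eq0 ffunE; case: ifP => _; rewrite mulf_neq0 ?signr_eq0 //.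
rewrite /eco !ffunE; have := ltn_ord a.1; have := ltn_ord b.1.
have H : (a.1 : nat) != b.1 by rewrite val_eqE.
case: (a.1 =P i) => [Ea|_]; case: (b.1 =P i) => [Eb|_].
- by rewrite Ea Eb eqxx in ab.
- by rewrite /sgi; case: a.2; case: b.2; case: (e); case: (e'); rewrite ?expr0 ?expr1 ?mul1r ?mulN1r; clear; lia.
- by rewrite /sgi; case: a.2; case: b.2; case: (e); case: (e'); rewrite ?expr0 ?expr1 ?mul1r ?mulN1r; clear; lia.
- by move: H; rewrite /sgi; case: a.2; case: b.2; case: (e'); rewrite ?expr0 ?expr1 ?mul1r ?mulN1r; clear; lia.
Qed.

Lemma dotDl mu nu h : dot (mu + nu) h = dot mu h + dot nu h.
Proof. by rewrite /dot -big_split; apply: eq_bigr => i _; rewrite ffunE mulrDl. Qed.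

Lemma dotNl mu h : dot (- mu) h = - dot mu h.
Proof. by rewrite /dot -sumrN; apply: eq_bigr => i _; rewrite ffunE mulNr. Qed.

Definition hbound : nat :=
  \sum_(i : 'I_n) \sum_(e : bool) \sum_(e' : bool) absz (dot (rho2 (probe i e e')) (probe i e e')).

Lemma hbound_ge i e : (absz (dot (rho2 (probe i e false)) (probe i e false)) +
  absz (dot (rho2 (probe i e true)) (probe i e true)) <= hbound)%N.
Proof.
rewrite /hbound (bigD1 i) //= (bigD1 e) //= big_bool /= [X in (X <= _)%N]addnC -addnA.
exact: leq_addr.
Qed.

Lemma hull_box c mu : hull c -> c mu != 0 -> mu \in boxs n hbound.
Proof.
move=> H cm; rewrite mem_boxs; apply/forallP => i.
have key e : - hbound%:Z <= 2 * n.+1%:Z * ((-1) ^+ e * mu i).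
  have := H mu cm _ (regh_probe i e false); have := H mu cm _ (regh_probe i e true).
  rewrite !dotDl => h1 h2.
  have : dot mu (probe i e false) + dot mu (probe i e true) = 2 * n.+1%:Z * ((-1) ^+ e * mu i).
    rewrite /dot -big_split /= (bigD1 i) //= big1 ?addr0.
      by rewrite !ffunE eqxx; ring.
    by move=> j ji; rewrite !ffunE (negPf ji) -mulrDr expr0 expr1 mul1r mulN1r subrr mulr0.
  move=> <-; have := hbound_ge i e; move: h1 h2.
  by clear; lia.
have : 1 <= n.+1%:Z by [].
have := key false; have := key true; rewrite expr0 expr1 mul1r mulN1r ler_norml.
by move: (mu i) (hbound%:Z) (n.+1%:Z) => x B N; clear; nia.
Qed.

Let s := boxs n hbound.

Lemma regh_std : regh (stdh n).
Proof.
by split=> [a|a b ab]; rewrite !eco_std ?sgi_eq0 // sgi_std_neq.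
Qed.

Definition Usp c := [/\ hull c, cond1 (ev s c) & cond2 (ev s c)].

Lemma ev_sub s1 s2 c Z : uniq s1 -> uniq s2 -> {subset s1 <= s2} ->
  (forall mu, mu \in s2 -> c mu != 0 -> mu \in s1) -> ev s2 c Z = ev s1 c Z.
Proof.
move=> u1 u2 sub H; rewrite /ev [LHS](bigID (mem s1)) /= addrC big1_seq ?add0r => [|mu /andP[n1 n2]].
  rewrite -big_filter; apply/perm_big/uniq_perm; rewrite ?filter_uniq // => mu.
  by rewrite mem_filter; case E : (mu \in s1); rewrite //= sub.
by case: (c mu =P 0) => [->|/eqP cm]; rewrite ?mul0r //; rewrite (H mu n2 cm) in n1.
Qed.

Lemma LF_box f : LF f -> exists B c, (hbound <= B)%N /\
  (forall mu, mu \notin boxs n B -> c mu = 0) /\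
  forall Z, tor Z -> f Z = ev (boxs n B) c Z.
Proof.
move=> /LF_normal[t Ht].
pose B := maxn hbound (\max_(p <- t) \max_(i < n) absz (p.2 i)).
have tB p : p \in t -> p.2 \in boxs n B.
  move=> pt_; rewrite mem_boxs; apply/forallP => i.
  have : (absz (p.2 i) <= B)%N.
    rewrite /B leq_max; apply/orP; right.
    apply: (@leq_trans (\max_(j < n) absz (p.2 j))).
      exact: (leq_bigmax_cond (F := fun j : 'I_n => absz (p.2 j)) i isT).
    exact: (leq_bigmax_seq (F := fun p : K * expo => \max_(j < n) absz (p.2 j)) p pt_ isT).
  by rewrite ler_norml; move: (p.2 i) B => x b; clear; lia.
pose c mu := \sum_(p <- t | p.2 == mu) p.1.
exists B, c; split; [exact: leq_maxl|split=> [mu mB|Z tZ]].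
  by rewrite /c big_seq_cond big1 // => p /andP[/tB pB /eqP Ep]; rewrite -Ep pB in mB.
rewrite Ht // /ev; under [RHS]eq_bigr => mu _ do rewrite /c mulr_suml.
under [RHS]eq_bigr => mu _ do rewrite big_mkcond.
rewrite exchange_big /= big_seq [RHS]big_seq; apply: eq_bigr => p /tB pB.
rewrite (bigD1_seq p.2) ?uniq_boxs //= eqxx big1 ?addr0 // => mu; rewrite eq_sym.
by move=> /negPf ->.
Qed.

(** D f is a Laurent polynomial of unknown support, so it is first expanded in a larger box;
    [lead_zero] in every regular direction then brings its exponents back within the bounds. *)
Lemma Usp_stable c : Usp c -> exists2 c', Usp c' &
  forall Z, tor Z -> reg poles Z -> Dop (ev s c) Z = ev s c' Z.
Proof.
move=> [Hc c1 c2]; have [g [Lg g1 g2 Eg]] := Dop_stable q0 hq kap cst HLL tY (LF_ev s c) c1 c2.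
have [B [c' [hB [sup Ec']]]] := LF_box Lg.
have sB : {subset s <= boxs n B} by apply: boxs_sub.
have Es : ev (boxs n B) c = ev s c.
  apply/funext => Z; apply: ev_sub; rewrite ?uniq_boxs // => mu _; exact: hull_box.
have HD Z : tor Z -> reg poles Z -> Dop (ev (boxs n B) c) Z = ev (boxs n B) c' Z.
  by move=> tZ rZ; rewrite Es Eg // Ec'.
have hc' : hull c'.
  move=> mu cm h rh; have mB : mu \in boxs n B by apply: contraR cm => /sup ->.
  rewrite dotDl -[X in X + _]opprK addrC subr_ge0 leNgt; apply/negP => hlt.
  case/eqP: cm; apply: (lead_zero q0 Hm1 Hkap Hcst (uniq_boxs n B) rh HD (d := - dot (rho2 h) h)) => //.
    move=> nu _ dn; apply/eqP; apply: contraT => cn.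
    by have := Hc nu cn h rh; rewrite dotDl; move: dn; clear; lia.
  by move: hlt; clear; lia.
have Ec : forall Z, tor Z -> g Z = ev s c' Z.
  move=> Z tZ; rewrite Ec' //; apply: ev_sub; rewrite ?uniq_boxs // => mu _; exact: hull_box.
have TE mu Z : tor Z -> TT mu (ev s c') Z = TT mu g Z.
  by move=> tZ; apply: TT_congr; rewrite Ec //; apply: tor_tr.
exists c'; last by move=> Z tZ rZ; rewrite Eg // Ec.
split=> //.
- by move=> Z a e p tZ Ea Hp; rewrite !TE //; apply: g1 Hp.
- by move=> Z a b r tZ ab E Hr; rewrite !TE //; apply: g2.
Qed.
End CoefficientOperator.

(** * Eigenvectors and absence of Jordan blocks for generic x *)

Section EigenArgument.
Variables (K : numFieldType) (n : nat) (q : K).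
Hypotheses (q0 : q != 0) (hq : forall N : nat, (0 < N)%N -> q ^+ N != 1).
Variables (k : nat) (LL : bool -> nat * nat) (kap cst : K) (Y : 'I_n -> K).
Hypotheses (HLL : forall b, odd ((LL b).1 + (LL b).2)) (tY : tor Y).
Local Notation pt := ('I_n -> K).
Local Notation sidx := ('I_n * bool)%type.
Local Notation expo := {ffun 'I_n -> int}.
Local Notation TT := (TT q Y).
Local Notation vc := (vc q k LL kap).
Local Notation Dop := (Dop q k LL kap cst Y).
Local Notation cond1 := (cond1 q LL Y).
Local Notation cond2 := (cond2 q k Y).
Local Notation poles := (poles q).
Variable m1 : int.
Hypothesis m1_gt0 : 0 < m1.
Hypothesis Hm1 : 2 * m1 = 2 + \sum_(e : bool) ((LL e).1 + (LL e).2)%N%:Z.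
Hypothesis Hkap : kap = q ^ (- m1).
Local Notation Em := (Em q Y).
Local Notation r2 := (r2 k m1).
Local Notation rho2 := (rho2 k m1).
Local Notation inS := (inS k m1).
Implicit Types (Z : pt) (a b : sidx) (mu nu h eta : expo) (f g : pt -> K) (e : bool)
  (c : expo -> K) (E : seq K).
Hypothesis Hcst : forall h, regh h -> cst = \sum_a q ^ r2 h a.
Local Notation Usp := (Usp q k LL Y m1).
Local Notation s := (boxs n (hbound n k m1)).
Variables (M : nat) (P : nat -> pt) (w : expo -> nat -> K).
Hypothesis tP : forall j, (j < M)%N -> tor (P j).
Hypothesis rP : forall j, (j < M)%N -> reg poles (P j).
Hypothesis HP : forall c mu, mu \in s -> c mu = \sum_(j < M) w mu j * ev s c (P j).

(* The operator D on coefficients, through interpolation at the points P j;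
   the formula makes sense for every c and Y. *)
Definition Dhat c mu : K :=
  if mu \in s then \sum_(j < M) w mu j * Dop (ev s c) (P j) else 0.
Definition step (x : K) c mu : K := Dhat c mu - x * c mu.
Definition app E c : expo -> K := foldr step c E.

Lemma Dhat_spec c : Usp c -> Usp (Dhat c) /\
  forall Z, tor Z -> reg poles Z -> Dop (ev s c) Z = ev s (Dhat c) Z.
Proof.
move=> Uc; have [c' Uc' Ec'] := Usp_stable q0 hq HLL tY Hm1 Hkap Hcst Uc.
suff -> : Dhat c = c' by [].
apply/funext => mu; rewrite /Dhat; case: ifP => smu.
  rewrite (HP c' smu); apply: eq_bigr => j _; congr (_ * _).
  by apply: Ec'; [apply: tP|apply: rP].
apply/esym/eqP; apply: contraFT smu => cm.
by case: Uc' => hc _ _; apply: hull_box hc cm.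
Qed.

Lemma ev_lin x c c' Z : ev s (fun mu => x * c mu + c' mu) Z = x * ev s c Z + ev s c' Z.
Proof.
rewrite /ev mulr_sumr -big_split; apply: eq_bigr => mu _.
by rewrite mulrDl mulrA.
Qed.

Lemma TT_lin mu x c c' Z : TT mu (ev s (fun nu => x * c nu + c' nu)) Z =
  x * TT mu (ev s c) Z + TT mu (ev s c') Z.
Proof. by rewrite /TT ev_lin mulrDr mulrCA. Qed.

Lemma Dop_lin x c c' Z : Dop (ev s (fun mu => x * c mu + c' mu)) Z =
  x * Dop (ev s c) Z + Dop (ev s c') Z.
Proof.
rewrite /Dop ev_lin.
have -> : \sum_(a : sidx) vc a Z * (TT (unitv a 2) (ev s (fun mu => x * c mu + c' mu)) Z
    - (x * ev s c Z + ev s c' Z)) =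
  x * (\sum_(a : sidx) vc a Z * (TT (unitv a 2) (ev s c) Z - ev s c Z)) +
  \sum_(a : sidx) vc a Z * (TT (unitv a 2) (ev s c') Z - ev s c' Z).
  by rewrite [x * (\sum_(_ : sidx) _)]mulr_sumr -big_split; apply: eq_bigr => a _; rewrite TT_lin /=; ring.
ring.
Qed.

Lemma Dhat_lin x c c' : Dhat (fun mu => x * c mu + c' mu) = (fun mu => x * Dhat c mu + Dhat c' mu).
Proof.
apply/funext => mu; rewrite /Dhat; case: ifP => _; last by rewrite mulr0 addr0.
by rewrite mulr_sumr -big_split; apply: eq_bigr => j _; rewrite Dop_lin /=; ring.
Qed.

Lemma stepE x c : step x c = (fun mu => (- x) * c mu + Dhat c mu).
Proof. by apply/funext => mu; rewrite /step mulNr addrC. Qed.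

Lemma stepC x y c : step x (step y c) = step y (step x c).
Proof.
rewrite [step x c]stepE [step y c]stepE /step !Dhat_lin.
by apply/funext => mu; ring.
Qed.

Lemma app_step E x c : app E (step x c) = step x (app E c).
Proof. by elim: E => //= y E ->; rewrite stepC. Qed.

Lemma app_cat E E' c : app (E ++ E') c = app E (app E' c).
Proof. exact: foldr_cat. Qed.

Lemma app_rem E x c : x \in E -> exists E', app E c = step x (app E' c).
Proof.
case/splitPr => E1 E2; exists (E1 ++ E2).
by rewrite !app_cat /= app_step.
Qed.

Lemma cond1_lin x c c' : cond1 (ev s c) -> cond1 (ev s c') -> cond1 (ev s (fun mu => x * c mu + c' mu)).
Proof. by move=> H H' Z a e p tZ E Hp; rewrite !TT_lin (H Z a e p) // (H' Z a e p). Qed.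

Lemma cond2_lin x c c' : cond2 (ev s c) -> cond2 (ev s c') -> cond2 (ev s (fun mu => x * c mu + c' mu)).
Proof. by move=> H H' Z a b r tZ ab E Hr; rewrite !TT_lin (H Z a b r) // (H' Z a b r). Qed.

Lemma Usp_lin x c c' : Usp c -> Usp c' -> Usp (fun mu => x * c mu + c' mu).
Proof.
move=> [h1 h2 h3] [h1' h2' h3']; split; [|exact: cond1_lin|exact: cond2_lin].
move=> mu; case: (c mu =P 0) => [->|/eqP cm _]; last exact: h1.
by rewrite mulr0 add0r; apply: h1'.
Qed.

Lemma Usp_step x c : Usp c -> Usp (step x c).
Proof. by move=> Uc; rewrite stepE; apply: Usp_lin => //; case: (Dhat_spec Uc). Qed.

Lemma Usp_app E c : Usp c -> Usp (app E c).
Proof. by move=> Uc; elim: E => //= x E; apply: Usp_step. Qed.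

Lemma Usp_mem c mu : Usp c -> c mu != 0 -> mu \in s.
Proof. by case=> hc _ _; apply: hull_box. Qed.

Section Direction.
Variables (h : expo).
Hypothesis rh : regh h.

Lemma step_zero c d x : Usp c -> (forall mu, dot mu h < d -> c mu = 0) ->
  forall mu, dot mu h < d -> step x c mu = 0.
Proof.
move=> Uc H mu dmu; rewrite /step H // mulr0 subr0; have [UD ED] := Dhat_spec Uc.
apply/eqP; apply: contraT => cm; have sm := Usp_mem UD cm.
case/eqP: cm; apply: (lead_zero q0 Hm1 Hkap Hcst (uniq_boxs n _) rh ED (d := d)) => //.
by move=> nu _; apply: H.
Qed.

Lemma step_eq c d x : Usp c -> (forall mu, dot mu h < d -> c mu = 0) ->
  forall mu, dot mu h = d -> step x c mu = (Em (dbl mu + rho2 h) - x) * c mu.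
Proof.
move=> Uc H mu dmu; rewrite /step mulrBl; congr (_ - _); have [UD ED] := Dhat_spec Uc.
case sm : (mu \in s).
  apply: (lead_eq q0 Hm1 Hkap Hcst (uniq_boxs n _) rh ED (d := d)) => //.
  by move=> nu _; apply: H.
have c0 c1 : Usp c1 -> c1 mu = 0.
  by move=> U1; apply/eqP; apply: contraFT sm; apply: Usp_mem.
by rewrite !c0 // mulr0.
Qed.

Lemma app_level c d E : Usp c -> (forall mu, dot mu h < d -> c mu = 0) ->
  (forall mu, dot mu h < d -> app E c mu = 0) /\
  (forall mu, dot mu h = d -> app E c mu = (\prod_(x <- E) (Em (dbl mu + rho2 h) - x)) * c mu).
Proof.
move=> Uc H; elim: E => [|x E [IH1 IH2]] /=.
  by split=> // mu _; rewrite big_nil mul1r.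
split=> mu dmu; first exact: step_zero (Usp_app E Uc) IH1 _ dmu.
by rewrite (step_eq _ (Usp_app E Uc) IH1 dmu) IH2 // big_cons mulrA.
Qed.

Lemma dot_bound : exists B : nat, forall mu, mu \in s -> (absz (dot mu h) <= B)%N.
Proof.
by exists (\sum_(mu <- s) absz (dot mu h)) => mu smu; rewrite (big_rem mu) //= leq_addr.
Qed.

Lemma bottom c : Usp c -> c <> (fun=> 0) -> exists mu, c mu != 0 /\
  forall nu, dot nu h < dot mu h -> c nu = 0.
Proof.
move=> Uc c0; have [B HB0] := dot_bound.
have HB mu : c mu != 0 -> - B%:Z <= dot mu h.
  move=> /(Usp_mem Uc) smu; have := HB0 _ smu.
  by clear; lia.
have : exists N : nat, has (fun mu => (c mu != 0) && (dot mu h + B%:Z == N%:Z)) s.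
  have [mu cm] : exists mu, c mu != 0.
    apply: contrapT => Hn; apply: c0; apply/funext => mu; apply/eqP; apply: contraT => cm.
    by case: Hn; exists mu.
  exists (absz (dot mu h + B%:Z)); apply/hasP; exists mu; first exact: Usp_mem cm.
  by rewrite cm; have := HB mu cm; clear; lia.
case/ex_minnP => N /hasP[mu smu /andP[cm /eqP Emu]] minN; exists mu; split=> // nu dnu.
apply/eqP; apply: contraT => cn; have := minN (absz (dot nu h + B%:Z)).
have Hn := HB nu cn; have -> : has (fun mu => (c mu != 0) && (dot mu h + B%:Z == (absz (dot nu h + B%:Z))%:Z)) s.
  apply/hasP; exists nu; first exact: Usp_mem cn.
  by rewrite cn; move: Hn; clear; lia.
move=> /(_ isT); move: Hn dnu Emu; clear; lia.
Qed.

(** L lists the scalars attached to all exponents of the box. One pass through L kills the lowest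
    level still present in direction h, and there are at most 2B + 1 levels between -B and B. *)
Lemma annihilator : exists E, forall c, Usp c -> app E c = (fun=> 0).
Proof.
pose L := [seq Em (dbl mu + rho2 h) | mu <- s].
have [B HB0] := dot_bound.
have HB mu : mu \in s -> - B%:Z <= dot mu h <= B%:Z.
  move=> smu; have := HB0 _ smu.
  by clear; lia.
have main N c : Usp c -> forall mu, dot mu h < - B%:Z + N%:Z -> app (flatten (nseq N L)) c mu = 0.
  move=> Uc; elim: N => [|N IH] mu dmu /=.
    apply/eqP; apply: contraT => cm; have /HB := Usp_mem Uc cm.
    by move: dmu; clear; lia.
  rewrite app_cat; have [A1 A2] := app_level L (Usp_app _ Uc) IH.
  have [|] := ltrP (dot mu h) (- B%:Z + N%:Z); first exact: A1.
  move=> dm; have dE : dot mu h = - B%:Z + N%:Z.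
    by move: dm dmu; clear; lia.
  rewrite A2 //; case sm : (mu \in s).
    rewrite (_ : \prod_(x <- L) _ = 0) ?mul0r //; apply/eqP; rewrite prodf_seq_eq0.
    apply/hasP; exists (Em (dbl mu + rho2 h)); last by rewrite subrr eqxx.
    by apply/mapP; exists mu.
  rewrite [X in _ * X](_ : _ = 0) ?mulr0 //.
  by apply/eqP; apply: contraFT sm; apply/Usp_mem/Usp_app.
exists (flatten (nseq (B + B).+1 L)) => c Uc; apply/funext => mu.
apply/eqP; apply: contraT => cm; have /HB Hmu := Usp_mem (Usp_app _ Uc) cm.
case/eqP: cm; apply: main => //.
by move: Hmu; clear; lia.
Qed.
End Direction.

(** A bound satisfied by every eta = [dbl mu + rho2 h] with mu in the box, which makes [generic_Em]
    a finite set of inequations. The three terms bound 2 mu, the contribution of the e_i and that of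
    the e_i ± e_j. *)
Definition etab (eta : expo) := forall i, `|eta i| <= (2 * hbound n k m1)%N%:Z + m1 + (2 * k * n)%N%:Z.
Definition generic_Em := forall eta eta', etab eta -> etab eta' -> Em eta = Em eta' -> eta = eta'.

Lemma etab_face c mu h : Usp c -> c mu != 0 -> regh h -> etab (dbl mu + rho2 h).
Proof.
move=> Uc cm rh i; have := Usp_mem Uc cm; rewrite mem_boxs => /forallP /(_ i).
rewrite !ffunE /r2 => Hmu.
have S1 x : `|sgz x| <= 1 by rewrite /sgz; case: eqP => // _; case: ifP.
have S2 : `|\sum_(b : sidx | b.1 != i) sgz (eco h (i, false) + eco h b)| <= (2 * n)%N%:Z.
  apply: le_trans (ler_norm_sum _ _ _) _; rewrite big_mkcond /=.
  apply: (@le_trans _ _ (\sum_(b : sidx) 1)); first by apply: ler_sum => b _; case: ifP.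
  by rewrite sumr_const card_prod card_bool card_ord mulnC natz.
apply: le_trans (ler_normD _ _) _; apply: (@le_trans _ _ ((2 * hbound n k m1)%N%:Z + (m1 + (2 * k * n)%N%:Z))); last by rewrite addrA.
apply: lerD; first by rewrite normrM PoszM ler_pM2l.
apply: le_trans (ler_normD _ _) _; apply: lerD.
  rewrite normrM (gtr0_norm m1_gt0) -[X in _ <= X]mulr1; by apply: ler_wpM2l; [exact: ltW|exact: S1].
rewrite normrM (_ : (2 * k * n)%N = (k * (2 * n))%N) ?PoszM; last by rewrite mulnCA mulnA.
by apply: ler_wpM2l => //; rewrite -PoszM.
Qed.

(** The lowest coefficient in direction h is multiplied by [Em (dbl mu + rho2 h)], which must equal
    e; by genericity [dbl mu + rho2 h] is the same eta for all h. The extreme exponents being known,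
    [zonotope_points] applies both to eta and to [dbl mu - eta]. *)
Lemma eigen_faces c (e : K) : Usp c -> c <> (fun=> 0) -> step e c = (fun=> 0) ->
  generic_Em -> exists eta, [/\ Em eta = e, etab eta, inS eta,
    forall h, regh h -> exists mu, [/\ c mu != 0, dbl mu + rho2 h = eta &
       forall nu, dot nu h < dot mu h -> c nu = 0] &
    forall mu, c mu != 0 -> inS (dbl mu - eta)].
Proof.
move=> Uc c0 ec gen.
have face h : regh h -> exists mu, [/\ c mu != 0, Em (dbl mu + rho2 h) = e &
       forall nu, dot nu h < dot mu h -> c nu = 0].
  move=> rh; have [mu [cm bm]] := bottom h Uc c0; exists mu; split=> //.
  have := step_eq rh e Uc bm erefl; rewrite ec => /esym/eqP.
  by rewrite mulf_eq0 (negPf cm) orbF subr_eq0 => /eqP.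
have [mu0 [cm0 em0 _]] := face _ (regh_std n).
pose eta := dbl mu0 + rho2 (stdh n).
have Beta : etab eta := etab_face Uc cm0 (regh_std n).
have face2 h : regh h -> exists mu, [/\ c mu != 0, dbl mu + rho2 h = eta &
       forall nu, dot nu h < dot mu h -> c nu = 0].
  move=> rh; have [mu [cm em bm]] := face h rh; exists mu; split=> //.
  by apply: gen => //; [exact: etab_face cm rh|rewrite em].
have dblD mu h : dot (dbl mu) h = 2 * dot mu h.
  by rewrite /dot mulr_sumr; apply: eq_bigr => i _; rewrite ffunE mulrA.
have [hc _ _] := Uc.
exists eta; split=> // [|mu cm].
  apply: zonotope_points => // [h rh|h a rh].
    have [mu [cm <- _]] := face2 h rh; have := hc mu cm h rh.
    by rewrite !dotDl dblD; move: (dot mu h) (dot (rho2 h) h) => x y; clear; lia.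
  have [mu [cm <- _]] := face2 h rh.
  by rewrite ecoD eco_dbl eco_rho2 addrK; move: (eco mu a) => x; clear; lia.
apply: zonotope_points => // [h rh|h a rh].
  have [nu [cn <- bn]] := face2 h rh.
  have : dot nu h <= dot mu h.
    by rewrite leNgt; apply/negP => /bn E; rewrite E eqxx in cm.
  rewrite !(dotDl, dotNl, dblD).
  by move: (dot mu h) (dot nu h) (dot (rho2 h) h) => x y z; clear; lia.
have [nu [cn <- bn]] := face2 h rh.
rewrite !(ecoD, ecoN, eco_dbl, eco_rho2).
by move: (eco mu a) (eco nu a) (r2 h a) => x y z; clear; lia.
Qed.

(** Were the result nonzero, the eigenvalue of a nonzero eigenvector F built from it would occur in
    [es], so that F is also in the image of D - x on the space; this is the Jordan block to be
    excluded. *)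
Lemma generic_kernel c (es : seq K) : Usp c -> generic_Em ->
  (forall eta, inS eta -> Em eta \in es) -> app es c = (fun=> 0).
Proof.
move=> Uc gen Hes; apply: contrapT => G0; have UG := Usp_app es Uc.
have [E HE] := annihilator (regh_std n).
(* F is the last nonzero vector while the factors of the annihilator are applied to [app es c]. *)
have [F [x [E2 [EF F0 xF]]]] : exists F x E2, [/\ F = app E2 (app es c), F <> (fun=> 0) & step x F = (fun=> 0)].
  have := HE _ UG; elim: E {HE} => [//|y E IH] /= Hy.
  case: (pselect (app E (app es c) = (fun=> 0))) => [/IH //|F0].
  by exists (app E (app es c)), y, E.
have UF : Usp F by rewrite EF; apply: Usp_app.
have [eta [Eeta Beta Seta faces _]] := eigen_faces UF F0 xF gen.
have xes : x \in es by rewrite -Eeta; apply: Hes.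
have [E' HE'] := app_rem c xes.
pose H := app E2 (app E' c).
have EFH : F = step x H by rewrite EF HE' app_step.
have UH : Usp H by do 2!apply: Usp_app.
have H0 : H <> (fun=> 0).
  move=> H0; apply: F0; rewrite EFH H0 /step; apply/funext => mu.
  have := Dhat_lin (-1) (fun=> 0) (fun=> 0).
  have -> : (fun mu : expo => -1 * 0 + 0) = (fun=> 0) :> (expo -> K).
    by apply/funext => ?; rewrite mulr0 addr0.
  move=> /(congr1 (fun f : expo -> K => f mu)) /= ->.
  by rewrite mulN1r addNr mulr0 subrr.
pose h := stdh n; have rh : regh h := regh_std n.
have [mu [Hmu bmu]] := bottom h UH H0.
have Fz nu : dot nu h < dot mu h -> F nu = 0.
  by rewrite EFH; apply: step_zero UH bmu nu.
(* On the lowest level of H the relation (D - x)^2 H = 0 reads (Em - x)^2 H nu = 0, so only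
   exponents with scalar x survive there, and F vanishes on this level. *)
have Feq nu : dot nu h = dot mu h -> F nu = 0 /\ (H nu != 0 -> dbl nu + rho2 h = eta).
  move=> dnu; have E1 := step_eq rh x UH bmu dnu; rewrite -EFH in E1.
  have := step_eq rh x UF Fz dnu; rewrite xF E1 mulrA => /esym/eqP.
  rewrite mulf_eq0 => /orP[|/eqP ->]; last by rewrite mulr0; split=> //; rewrite eqxx.
  rewrite mulf_eq0 orbb subr_eq0 => /eqP Ex; split; first by rewrite Ex subrr mul0r.
  by move=> Hnu; apply: gen => //; [exact: etab_face Hnu rh|rewrite Ex Eeta].
have [Fmu /(_ Hmu) Emu] := Feq mu erefl.
(* F attains its minimum in direction h at the exponent determined by eta, which is mu itself, where
   F has just been seen to vanish. *)
have [nu [Fnu Enu _]] := faces h rh.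
have : nu = mu.
  have : dbl nu = dbl mu by apply: (addIr (rho2 h)); rewrite Enu Emu.
  move=> /ffunP D; apply/ffunP => i; have := D i; rewrite !ffunE; move: (nu i) (mu i) => y z; clear; lia.
by move=> E3; rewrite E3 Fmu eqxx in Fnu.
Qed.
End EigenArgument.

(** * From generic x to every x *)

Section AllSpectralParameters.
Variables (K : numFieldType) (n : nat) (q : K).
Hypotheses (q0 : q != 0) (hq : forall N : nat, (0 < N)%N -> q ^+ N != 1).
Variables (k : nat) (LL : bool -> nat * nat) (kap cst : K).
Hypotheses (HLL : forall b, odd ((LL b).1 + (LL b).2)).
Local Notation pt := ('I_n -> K).
Local Notation sidx := ('I_n * bool)%type.
Local Notation expo := {ffun 'I_n -> int}.
Variable m1 : int.
Hypothesis m1_gt0 : 0 < m1.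
Hypothesis Hm1 : 2 * m1 = 2 + \sum_(e : bool) ((LL e).1 + (LL e).2)%N%:Z.
Hypothesis Hkap : kap = q ^ (- m1).
Local Notation poles := (poles q).
Local Notation r2 := (r2 k m1).
Local Notation rho2 := (rho2 k m1).
Local Notation inS := (inS k m1).
Hypothesis Hcst : forall h : expo, regh h -> cst = \sum_a q ^ r2 h a.
Local Notation s := (boxs n (hbound n k m1)).
Variables (M : nat) (P : nat -> pt) (w : expo -> nat -> K).
Hypothesis tP : forall j, (j < M)%N -> tor (P j).
Hypothesis rP : forall j, (j < M)%N -> reg poles (P j).
Hypothesis HP : forall (c : expo -> K) mu, mu \in s -> c mu = \sum_(j < M) w mu j * ev s c (P j).
Variables (etas : seq expo) (eta0 : expo) (c0 : expo -> K).
Hypothesis Heta : forall eta, inS eta -> eta \in eta0 :: etas.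
Hypothesis Beta0 : etab k m1 eta0.
Hypothesis Uc0 : forall Y, tor Y -> Usp q k LL Y m1 c0.
Implicit Types (Y Z : pt) (mu nu eta : expo) (c : expo -> K).

Local Notation DhatY Y := (Dhat q k LL kap cst Y m1 M P w).
Local Notation stepY Y := (step q k LL kap cst Y m1 M P w).
Local Notation appY Y := (app q k LL kap cst Y m1 M P w).

Definition psi Y : expo -> K := appY Y [seq Em q Y eta | eta <- etas] c0.

Lemma generic_eigen Y : tor Y -> generic_Em q k Y m1 ->
  stepY Y (Em q Y eta0) (psi Y) = (fun=> 0) /\
  forall mu, psi Y mu != 0 -> inS (dbl mu - eta0).
Proof.
move=> tY gen.
have E0 : stepY Y (Em q Y eta0) (psi Y) = (fun=> 0).
  apply: (generic_kernel q0 hq HLL tY m1_gt0 Hm1 Hkap Hcst tP rP HP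
    (es := [seq Em q Y eta | eta <- eta0 :: etas]) (Uc0 tY) gen) => eta /Heta.
  exact: map_f.
split=> // mu pm.
have p0 : psi Y <> (fun=> 0) by move=> E; rewrite E eqxx in pm.
have Up : Usp q k LL Y m1 (psi Y).
  exact: (Usp_app q0 hq HLL tY Hm1 Hkap Hcst tP rP HP _ (Uc0 tY)).
have [eta [Ee Be _ _ H]] := eigen_faces q0 hq HLL tY m1_gt0 Hm1 Hkap Hcst tP rP HP Up p0 E0 gen.
by rewrite -(gen _ _ Be Beta0 Ee); apply: H.
Qed.

Lemma cofin_expsum (I : finType) (C : I -> K) (e : I -> int) (i0 : I) :
  injective e -> C i0 != 0 -> cofin (fun y => \sum_i C i * y ^ e i != 0).
Proof.
move=> inj C0.
have [N eN] : exists N : nat, forall i, e i + N%:Z = (absz (e i + N%:Z))%:Z.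
  exists (\sum_i absz (e i)) => i.
  have : (absz (e i) <= \sum_i absz (e i))%N by rewrite (bigD1 i) //= leq_addr.
  by move: (e i) (\sum_i absz (e i))%N => x b; clear; lia.
pose E : {poly K} := \sum_i C i *: 'X^(absz (e i + N%:Z)).
have E0 : E != 0.
  apply: contraNneq C0 => /(congr1 (fun p : {poly K} => p`_(absz (e i0 + N%:Z)))).
  rewrite coef0 /E coef_sum (bigD1 i0) //= coefZ coefXn eqxx mulr1 big1 ?addr0 => [->//|i ii].
  rewrite coefZ coefXn; case: eqP; rewrite ?mulr0 // => H.
  by case/eqP: ii; apply: inj; have := eN i; rewrite -H -eN => /addIr.
apply: cofinW (cofinI (cofin_neq 0) (cofin_poly E0)) _ => y [y0].
apply: contraNneq => H; apply/eqP; rewrite /E horner_sum.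
transitivity (y ^ N%:Z * \sum_i C i * y ^ e i); last by rewrite H mulr0.
rewrite mulr_sumr; apply: eq_bigr => i _.
by rewrite hornerZ hornerXn mulrCA -expfzDr // [N%:Z + _]addrC eN.
Qed.

(** Along Y y^h with h = (1, ..., n) the terms of [Em] carry pairwise distinct powers of y, and a
    coefficient differs wherever eta and eta' do, q not being a root of unity. *)
Lemma cofin_Em_neq Y eta eta' : tor Y -> eta != eta' ->
  cofin (fun y => Em q (cv Y (stdh n) y) eta != Em q (cv Y (stdh n) y) eta').
Proof.
move=> tY ee.
pose C (a : sidx) := mon Y (unitv a 2) * (q ^ eco eta a - q ^ eco eta' a).
pose e (a : sidx) := dot (unitv a 2) (stdh n).
have eE a : e a = 2 * eco (stdh n) a.
  rewrite /e /dot (bigD1 a.1) //= big1 => [|i ia]; last by rewrite ffunE (negPf ia) mul0r.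
  by rewrite addr0 ffunE eqxx /eco /sgi; case: a.2; rewrite ?mulNr ?mulrN.
have inj : injective e.
  move=> a b; rewrite !eE => /(mulfI (_ : 2 != 0 :> int)) => /(_ isT).
  rewrite !eco_std; case: a b => [a a'] [b b'] /= E.
  suff [-> ->] : a = b /\ a' = b' by [].
  move: E; rewrite /sgi /=; case: a'; case: b' => E; split=> //; try (apply/val_inj => /=; move: E; clear; lia);
  by exfalso; move: E; clear; lia.
have [i Hi] : exists i, eta i != eta' i.
  apply: contrapT => Hn; case/eqP: ee; apply/ffunP => i; apply/eqP.
  by apply: contraT => Hi; case: Hn; exists i.
have C0 : C (i, false) != 0.
  rewrite mulf_neq0 ?mon_neq0 // subr_eq0; apply: contraNneq Hi => /(qz_inj q0 hq) E.
  by apply/eqP.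
apply: cofinW (cofinI (cofin_neq 0) (cofin_expsum inj C0)) _ => y [y0].
apply: contraNneq => E.
apply/eqP; transitivity (Em q (cv Y (stdh n) y) eta - Em q (cv Y (stdh n) y) eta'); last by rewrite E subrr.
rewrite /Em -sumrB; apply: eq_bigr => a _.
by rewrite mon_cv // /C /e; ring.
Qed.

Lemma cofin_generic Y : tor Y -> cofin (fun y => generic_Em q k (cv Y (stdh n) y) m1).
Proof.
move=> tY; pose B := absz ((2 * hbound n k m1)%N%:Z + m1 + (2 * k * n)%N%:Z).
have inB eta : etab k m1 eta -> eta \in boxs n B.
  move=> He; rewrite mem_boxs; apply/forallP => i; apply: le_trans (He i) _.
  by rewrite /B; move: (_ + _) => x; clear; lia.
have H : cofin (fun y => forall eta, eta \in boxs n B -> forall eta', eta' \in boxs n B ->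
    eta != eta' -> Em q (cv Y (stdh n) y) eta != Em q (cv Y (stdh n) y) eta').
  apply: cofin_forall_seq => eta _; apply: cofin_forall_seq => eta' _; apply: cofin_imp.
  exact: cofin_Em_neq.
apply: cofinW H _ => y Hy eta eta' /inB He /inB He' E; apply/eqP; apply: contraT => ee.
by have := Hy _ He _ He' ee; rewrite E eqxx.
Qed.

Section Continuity.
Variable Y0 : pt.
Hypothesis tY0 : tor Y0.
Local Notation Yc := (cv Y0 (stdh n)).

Lemma rlim_mon_cv mu : rlim (fun y => mon (Yc y) mu) 1 (mon (Yc 1) mu).
Proof. exact: (rlim_LF_cv (stdh n) (LF_mon K mu) tY0 (oner_neq0 K)). Qed.

Lemma rlim_Em eta : rlim (fun y => Em q (Yc y) eta) 1 (Em q (Yc 1) eta).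
Proof. by apply: rlim_sum => a _; apply: rlimM (rlim_mon_cv _) (rlim_cst _ _). Qed.

Definition ctn (F : K -> expo -> K) := forall mu, rlim (fun y => F y mu) 1 (F 1 mu).

Lemma ctn_ev F Z : ctn F -> rlim (fun y => ev s (F y) Z) 1 (ev s (F 1) Z).
Proof. by move=> HF; apply: rlim_sum => mu _; apply: rlimM (HF mu) (rlim_cst _ _). Qed.

(** The points P and weights w do not depend on Y, so [Dhat] involves Y only through monomials. It
    is therefore rational along the curve whether or not its argument satisfies the conditions. *)
Lemma ctn_Dhat F : ctn F -> ctn (fun y => DhatY (Yc y) (F y)).
Proof.
move=> HF mu; rewrite /Dhat; case: ifP => _; last exact: rlim_cst.
apply: rlim_sum => j _; apply: rlimMl; apply: rlimD; last exact/rlimMl/ctn_ev.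
apply: rlim_sum => a _; apply: rlimMl; apply: rlimB; last exact: ctn_ev.
exact: rlimM (rlim_mon_cv _) (ctn_ev _ HF).
Qed.

Lemma ctn_step F eta : ctn F -> ctn (fun y => stepY (Yc y) (Em q (Yc y) eta) (F y)).
Proof.
move=> HF mu; apply: rlimB; first exact: ctn_Dhat.
exact: rlimM (rlim_Em eta) (HF mu).
Qed.

Lemma ctn_psi : ctn (fun y => psi (Yc y)).
Proof.
rewrite /psi; elim: etas => [|eta es IH] /=; first by move=> mu; apply: rlim_cst.
exact: ctn_step IH.
Qed.

Lemma Yc1 : Yc 1 = Y0.
Proof. by apply/funext => i; rewrite /cv exp1rz mulr1. Qed.

Lemma psi_eigen : stepY Y0 (Em q Y0 eta0) (psi Y0) = (fun=> 0).
Proof.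
apply/funext => mu; rewrite -Yc1; apply: rlim_eq0 (ctn_step eta0 ctn_psi mu).
apply: cofinW (cofinI (cofin_generic tY0) (cofin_tor_cv (stdh n) tY0)) _ => y [gy ty].
by have [-> _] := generic_eigen ty gy.
Qed.

Lemma psi_support mu : psi Y0 mu != 0 -> inS (dbl mu - eta0).
Proof.
move=> pm; apply: contrapT => nS; case/eqP: pm.
rewrite -Yc1; apply: rlim_eq0 (ctn_psi mu).
apply: cofinW (cofinI (cofin_generic tY0) (cofin_tor_cv (stdh n) tY0)) _ => y [gy ty].
have [_ H] := generic_eigen ty gy.
by apply/eqP; apply: contraT => /H.
Qed.
End Continuity.

Lemma psi_bottom Y g : tor Y -> regh g -> psi Y (- rho2 g) =
  (\prod_(eta <- etas) (Em q Y (- rho2 g) - Em q Y eta)) * c0 (- rho2 g).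
Proof.
move=> tY rg; have Uc := Uc0 tY; have [hc _ _] := Uc.
have := app_level q0 hq HLL tY Hm1 Hkap Hcst tP rP HP rg (d := dot (- rho2 g) g)
  [seq Em q Y eta | eta <- etas] Uc.
case=> [mu dm|_ /(_ _ erefl)].
  apply/eqP; apply: contraT => cm; have := hc mu cm g rg.
  by rewrite dotDl; move: dm; rewrite dotNl; clear; lia.
rewrite /psi big_map => ->; congr (_ * _); apply: eq_bigr => eta _; congr (Em q Y _ - _).
by apply/ffunP => i; rewrite !ffunE; move: (r2 g _) => x; clear; lia.
Qed.
End AllSpectralParameters.

(** * The initial function *)

Section InitialFunction.
Variables (K : numFieldType) (n : nat) (q : K).
Hypotheses (q0 : q != 0) (hq : forall N : nat, (0 < N)%N -> q ^+ N != 1).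
Variables (k : nat) (LL : bool -> nat * nat).
Hypotheses (HLL : forall b, odd ((LL b).1 + (LL b).2)).
Local Notation pt := ('I_n -> K).
Local Notation sidx := ('I_n * bool)%type.
Local Notation expo := {ffun 'I_n -> int}.
Variable m1 : int.
Hypothesis m1_gt0 : 0 < m1.
Hypothesis Hm1 : 2 * m1 = 2 + \sum_(e : bool) ((LL e).1 + (LL e).2)%N%:Z.
Local Notation adm := (adm LL).
Local Notation sgK := (sgK K).
Local Notation r2 := (r2 k m1).
Local Notation rho2 := (rho2 k m1).
Local Notation s := (boxs n (hbound n k m1)).
Implicit Types (Y Z : pt) (mu nu al h : expo) (c : expo -> K) (a b : sidx) (e d : bool).

Definition admseq e : seq nat := [seq p <- iota 1 (maxn (LL e).1 (LL e).2) | adm e p].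

(** Up to sign, the product of the two factors of c(z, M) and c(-z, M) belonging to one root and one
    j. *)
Definition rfac (al : expo) (x : K) Z : K := mon Z al + mon Z (- al) - x.
Definition root1 (i j : 'I_n) d : expo := unitv (i, false) 1 + unitv (j, d) 1.
Definition Qtor Z : K :=
  (\prod_(i < n) \prod_(e : bool) \prod_(p <- admseq e)
     rfac (unitv (i, false) 1) (sgK e * (q ^ p%:Z + q ^ (- p%:Z))) Z) *
  \prod_(i < n) \prod_(j < n | (i < j)%N) \prod_(d : bool) \prod_(1 <= t < k.+1)
     rfac (root1 i j d) (q ^ (2 * t%:Z) + q ^ (- (2 * t%:Z))) Z.

Lemma LF_rfac al x : LF (rfac al x).
Proof. by apply: LFB (LF_cst n x); apply: LFD; apply: LF_mon. Qed.

Lemma LF_Qtor : LF Qtor.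
Proof.
by apply: LFM; do 4!(apply: LF_prod => ? _ || apply: LF_rfac) => //; apply: LF_rfac.
Qed.

Lemma count_parity x N : (x <= N)%N ->
  count (fun p => (p <= x)%N && ~~ odd (x - p)) (iota 1 N) = uphalf x.
Proof.
have main M : count (fun p => (p <= x)%N && ~~ odd (x - p)) (iota 1 M) =
    if (M <= x)%N then uphalf (M - odd (x - M)) else uphalf x.
  elim: M => [|M IH]; first by [].
  have -> : iota 1 M.+1 = iota 1 M ++ [:: M.+1] by have := iotaD 1 M 1; rewrite addn1 add1n.
  rewrite count_cat IH /= addn0 !uphalfE.
  case: (leqP M.+1 x) => h; last first.
    rewrite /= addn0; case: (leqP M x) => h' //.
    have -> : M = x by move: h h'; clear; lia.
    by rewrite subnn subn0.
  have -> : (M <= x)%N by exact: ltnW.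
  have -> : odd (x - M) = ~~ odd (x - M.+1) by move: h; clear; lia.
  by case: (odd (x - M.+1)) => /=; move: h; clear; lia.
move=> h; rewrite main; case: (leqP N x) => h' //.
have -> : N = x by move: h h'; clear; lia.
by rewrite subnn subn0.
Qed.

(** The parameters have opposite parity, so the two conditions in [adm] are exclusive and their
    counts add up. In the original parameters there are l + l' + 1/2 admissible j for (l, l'). *)
Lemma size_admseq e : (2 * size (admseq e) = (LL e).1 + (LL e).2 + 1)%N.
Proof.
rewrite size_filter; have o := HLL e; rewrite oddD in o.
set x := (LL e).1 in o *; set y := (LL e).2 in o *.
have -> : count (adm e) (iota 1 (maxn x y)) =
  (count (fun p => (p <= x)%N && ~~ odd (x - p)) (iota 1 (maxn x y)) +
   count (fun p => (p <= y)%N && ~~ odd (y - p)) (iota 1 (maxn x y)))%N.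
  rewrite -count_predUI [X in (_ + X)%N](_ : _ = 0%N) ?addn0.
    apply: eq_in_count => p; rewrite mem_iota /adm -/x -/y /= => /andP[-> _] //.
  apply/eqP; rewrite -leqn0 leqNgt -has_count; apply/hasPn => p _ /=.
  by move: o; clear; lia.
rewrite !count_parity ?leq_maxl ?leq_maxr //.
by move: o; clear; lia.
Qed.

Lemma adm_admseq e p : adm e p -> p \in admseq e.
Proof.
move=> H; rewrite mem_filter H mem_iota /=; case/andP: H => p0 /orP[] /andP[pl _].
  by rewrite p0 add1n ltnS leq_max pl.
by rewrite p0 add1n ltnS leq_max pl orbT.
Qed.

Lemma monN Z mu : tor Z -> mon Z (- mu) = (mon Z mu)^-1.
Proof.
move=> tZ; apply: (mulIf (mon_neq0 mu tZ)).
by rewrite -monD // addNr mon0 mulVf // mon_neq0.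
Qed.

Lemma Qtor_zero0 Z a e p : tor Z -> adm e p -> co Z a = sgK e * q ^ p%:Z \/
  co Z a = sgK e * q ^ (- p%:Z) -> Qtor Z = 0.
Proof.
move=> tZ Hp Ha.
have Em : mon Z (unitv (a.1, false) 1) + mon Z (- unitv (a.1, false) 1) = co Z a + (co Z a)^-1.
  rewrite monN // mon_unitv expr1z; case: a {Ha} => i []; rewrite /co //= invrK.
  by rewrite addrC.
have sV (x : K) : (sgK e * x)^-1 = sgK e * x^-1 by rewrite invfM sgKV.
have F0 : rfac (unitv (a.1, false) 1) (sgK e * (q ^ p%:Z + q ^ (- p%:Z))) Z = 0.
  rewrite /rfac Em; case: Ha => ->; rewrite sV invr_expz -mulrDr ?opprK ?subrr //.
  by rewrite [q ^ (- _) + _]addrC subrr.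
by rewrite /Qtor (bigD1 a.1) //= (bigD1 e) //= (big_rem p) ?adm_admseq //= F0 !mul0r.
Qed.

Lemma mon_root1 Z i j d : tor Z -> mon Z (root1 i j d) = co Z (i, false) * co Z (j, d).
Proof. by move=> tZ; rewrite monD // !mon_unitv !expr1z. Qed.

Lemma Qtor_zero1 Z a b (t : nat) : tor Z -> a.1 != b.1 -> (1 <= t <= k)%N ->
  co Z a * co Z b = q ^ (2 * t%:Z) \/ co Z a * co Z b = q ^ (- (2 * t%:Z)) -> Qtor Z = 0.
Proof.
move=> tZ; wlog: a b / (a.1 < b.1)%N => [H ab tk E|ab _ tk E].
  case: (ltngtP a.1 b.1) => [lt|lt|/val_inj eq]; first exact: (H a b).
    by apply: (H b a) => //; rewrite 1?eq_sym // mulrC.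
  by rewrite eq eqxx in ab.
have F0 : rfac (root1 a.1 b.1 (a.2 (+) b.2)) (q ^ (2 * t%:Z) + q ^ (- (2 * t%:Z))) Z = 0.
  rewrite /rfac monN // mon_root1 //.
  have -> : co Z (a.1, false) * co Z (b.1, a.2 (+) b.2) + (co Z (a.1, false) * co Z (b.1, a.2 (+) b.2))^-1
    = co Z a * co Z b + (co Z a * co Z b)^-1.
    case: a b {ab E} => [i u] [j v]; rewrite /co /=; case: u; case: v => /=;
      rewrite ?invfM ?invrK //; exact: addrC.
  by case: E => ->; rewrite invr_expz ?opprK ?subrr // [q ^ (- _) + _]addrC subrr.
rewrite /Qtor [X in _ * X](bigD1 a.1) //= [X in _ * (X * _)](bigD1 b.1) //=.
rewrite [X in _ * (X * _ * _)](bigD1 (a.2 (+) b.2)) //=.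
by rewrite [X in _ * (X * _ * _ * _)](big_rem t) ?mem_index_iota //= F0 !mul0r mulr0.
Qed.

(** Q vanishes at both shifted points, so the condition reads 0 = 0 for every Y. *)
Lemma cond1_Qtor Y f : (forall Z, tor Z -> f Z = Qtor Z) -> cond1 q LL Y f.
Proof.
move=> Ef Z a e p tZ Ea Hp.
have t1 := tor_tr q0 (unitv a p%:Z) tZ; have t2 := tor_tr q0 (unitv a (- p%:Z)) tZ.
rewrite /TT !Ef // (Qtor_zero0 (a := a) t1 Hp) ?(Qtor_zero0 (a := a) t2 Hp) ?mulr0 //;
  rewrite co_tr // eco_unitv !eqxx Ea; [by right|by left].
Qed.

Lemma cond2_Qtor Y f : (forall Z, tor Z -> f Z = Qtor Z) -> cond2 q k Y f.
Proof.
move=> Ef Z a b t tZ ab Eab Ht; have ba : b.1 != a.1 by rewrite eq_sym.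
have t1 := tor_tr q0 (unitv a (2 * t%:Z)) tZ; have t2 := tor_tr q0 (unitv b (2 * t%:Z)) tZ.
have b0 := co_neq0 b tZ.
rewrite /TT !Ef // (Qtor_zero1 (a := a) (b := opp b) t1 ab Ht).
  rewrite (Qtor_zero1 (a := a) (b := opp b) t2 ab Ht) ?mulr0 //.
  right; rewrite !co_tr // !eco_unitv !opp_fst (negPf ab) eqxx opp_neq co_opp Eab.
  by rewrite mulr1 mulrA mulfV // mul1r.
left; rewrite !co_tr // !eco_unitv !opp_fst !eqxx (negPf ba) co_opp Eab.
by rewrite mulr1 mulrAC mulfV // mul1r.
Qed.

Definition zscale (z : int) al : expo := [ffun i => z * al i].

Lemma zscale1 al : zscale 1 al = al.
Proof. by apply/ffunP => i; rewrite ffunE mul1r. Qed.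

Lemma zscaleN1 al : zscale (-1) al = - al.
Proof. by apply/ffunP => i; rewrite !ffunE mulN1r. Qed.

Lemma rlim_rfac Z h al x : tor Z -> dot al h != 0 ->
  rlim (fun y => y ^ `|dot al h| * rfac al x (cv Z h y)) 0 (mon Z (- (zscale (sgz (dot al h)) al))).
Proof.
move=> tZ a0.
have E : cofin (fun y => y ^ `|dot al h| * rfac al x (cv Z h y) =
    mon Z al * y ^ (`|dot al h| + dot al h) + mon Z (- al) * y ^ (`|dot al h| - dot al h) - x * y ^ `|dot al h|).
  apply: cofinW (cofin_neq 0) _ => y y0.
  by rewrite /rfac !mon_cv // dotNl !expfzDr //; ring.
apply: rlim_near (cofinW E (fun y => @esym _ _ _)) _.
have Lx : rlim (fun y => x * y ^ `|dot al h|) 0 0 by apply: rlim_Xpos; rewrite normr_gt0.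
case: (sgz_case a0) => -[ap ->].
  rewrite zscale1 gtr0_norm // subrr.
  have := rlimB (rlimD (rlim_Xpos (mon Z al) (addr_gt0 ap ap)) (rlim_cst (mon Z (- al)) 0)) Lx.
  rewrite add0r subr0; apply: rlim_near; apply: cofinT => y.
  by rewrite gtr0_norm // expr0z mulr1.
rewrite zscaleN1 opprK; have an : dot al h < 0 by rewrite -oppr_gt0.
have := rlimB (rlimD (rlim_cst (mon Z al) 0) (rlim_Xpos (mon Z (- al)) (addr_gt0 ap ap))) Lx.
rewrite addr0 subr0; apply: rlim_near; apply: cofinT => y.
by rewrite ltr0_norm // addNr expr0z mulr1.
Qed.

(** The lowest term of F in direction h is the monomial Z^(-de), with coefficient 1. *)
Definition leads h (F : pt -> K) (de : expo) :=
  forall Z, tor Z -> rlim (fun y => y ^ dot de h * F (cv Z h y)) 0 (mon Z (- de)).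

Lemma leadsM h F G de de' : leads h F de -> leads h G de' ->
  leads h (fun Z => F Z * G Z) (de + de').
Proof.
move=> HF HG Z tZ; rewrite opprD monD //.
apply: rlim_near (rlimM (HF Z tZ) (HG Z tZ)).
apply: cofinW (cofin_neq 0) _ => y y0; rewrite dotDl expfzDr //; ring.
Qed.

Lemma leads1 h : leads h (fun=> 1) 0.
Proof.
move=> Z tZ; rewrite oppr0 mon0; apply: rlim_near (rlim_cst 1 0); apply: cofinT => y.
by rewrite mulr1 /dot big1 ?expr0z // => i _; rewrite ffunE mul0r.
Qed.

Lemma leads_prod h (I : Type) (r : seq I) (Q : pred I) (F : I -> pt -> K) (de : I -> expo) :
  (forall i, Q i -> leads h (F i) (de i)) ->
  leads h (fun Z => \prod_(i <- r | Q i) F i Z) (\sum_(i <- r | Q i) de i).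
Proof.
move=> H; elim: r => [|i r IH].
  move=> Z tZ; rewrite big_nil; apply: rlim_near (leads1 h tZ).
  by apply: cofinT => y; rewrite big_nil.
move=> Z tZ; rewrite big_cons; case: ifP => Qi; last first.
  by apply: rlim_near (IH Z tZ); apply: cofinT => y; rewrite big_cons Qi.
by apply: rlim_near (leadsM (H i Qi) IH tZ); apply: cofinT => y; rewrite big_cons Qi.
Qed.

Lemma leads_rfac h al x : dot al h != 0 -> leads h (rfac al x) (zscale (sgz (dot al h)) al).
Proof.
move=> a0 Z tZ; have -> : dot (zscale (sgz (dot al h)) al) h = `|dot al h|.
  case: (sgz_case a0) => -[ap ->]; first by rewrite zscale1 gtr0_norm.
  by rewrite zscaleN1 dotNl ltr0_norm // -oppr_gt0.
exact: rlim_rfac.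
Qed.

Lemma dot_unitvl a p h : dot (unitv a p) h = p * eco h a.
Proof.
rewrite /dot (bigD1 a.1) //= ffunE eqxx big1 ?addr0 => [|i ia]; last by rewrite ffunE (negPf ia) mul0r.
by rewrite /eco /sgi; case: a.2; rewrite ?mulrN ?mulNr.
Qed.

Lemma sum_seq_const (I : Type) (r : seq I) (x : int) : \sum_(p <- r) x = x * (size r)%:Z.
Proof.
elim: r => [|p r IH]; first by rewrite big_nil mulr0.
by rewrite big_cons IH /= -addn1 PoszD mulrDr mulr1 addrC.
Qed.

Lemma sum_size_admseq : \sum_(e : bool) (size (admseq e))%:Z = m1.
Proof.
have := size_admseq true; have := size_admseq false; have := Hm1; rewrite !big_bool /=.
by move: (size _) (size _) => x y; clear; lia.
Qed.

Lemma sum_pairs (F : sidx -> int) i :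
  \sum_(b : sidx | b.1 != i) F b = \sum_(j < n | j != i) \sum_(d : bool) F (j, d).
Proof. by rewrite pair_big_dep /=; apply: eq_big => [[j d]|[j d] _] //=; rewrite andbT. Qed.

(** [r2] groups the roots by coordinate, the product [Qtor] by positive root: each e_i occurs m1
    times and each e_i ± e_j occurs k times, with the sign of the root on h. *)
Lemma rho2_sum h : rho2 h =
  (\sum_(i < n) \sum_(e : bool) \sum_(p <- admseq e)
     zscale (sgz (dot (unitv (i, false) 1) h)) (unitv (i, false) 1)) +
  \sum_(i < n) \sum_(j < n | (i < j)%N) \sum_(d : bool) \sum_(1 <= t < k.+1)
     zscale (sgz (dot (root1 i j d) h)) (root1 i j d).
Proof.
apply/ffunP => i; rewrite [RHS]ffunE !sum_ffunE ffunE /r2; congr (_ + _).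
  rewrite [RHS](bigD1 i) //= [X in _ = _ + X]big1 ?addr0 => [|j ji]; last first.
    rewrite sum_ffunE big1 // => e _; rewrite sum_ffunE big1 // => p _.
    by rewrite !ffunE /= eq_sym (negPf ji) mulr0.
  rewrite sum_ffunE -sum_size_admseq mulr_suml; apply: eq_bigr => e _.
  rewrite sum_ffunE; under eq_bigr => p _ do rewrite !ffunE /= eqxx mulr1 dot_unitvl mul1r.
  by rewrite sum_seq_const mulrC.
pose G i' j d := sgz (dot (root1 i' j d) h).
transitivity (\sum_(i' < n) \sum_(j < n | (i' < j)%N) \sum_(d : bool)
    k%:Z * (G i' j d * ((i == i')%:Z + (if d then -1 else 1) * (i == j)%:Z))); last first.
  apply: eq_bigr => i' _; rewrite sum_ffunE; apply: eq_bigr => j _.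
  rewrite sum_ffunE; apply: eq_bigr => d _; rewrite sum_ffunE.
  under eq_bigr => t _ do rewrite !ffunE /=.
  rewrite sum_seq_const size_iota subn1 /= [RHS]mulrC; congr (_ * (_ * (_ + _))).
    by rewrite /sgi /=; case: eqP.
  by rewrite /sgi /=; case: d; case: eqP.
rewrite sum_pairs mulr_sumr.
transitivity (\sum_(j < n | j != i) \sum_(d : bool) k%:Z * sgz (eco h (i, false) + eco h (j, d))).
  by apply: eq_bigr => j _; rewrite mulr_sumr.
rewrite (bigID (fun j : 'I_n => (i < j)%N)) /=.
transitivity (\sum_(i' < n) \sum_(j < n | (i' < j)%N) \sum_(d : bool) k%:Z * (G i' j d * (i == i')%:Z)
  + \sum_(i' < n) \sum_(j < n | (i' < j)%N) \sum_(d : bool) k%:Z * (G i' j d * ((if d then -1 else 1) * (i == j)%:Z))); last first.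
  rewrite -big_split; apply: eq_bigr => i' _; rewrite -big_split; apply: eq_bigr => j _.
  by rewrite -big_split; apply: eq_bigr => d _; rewrite /= -mulrDr -mulrDr.
congr (_ + _).
  rewrite [RHS](bigD1 i) //= [X in _ = _ + X]big1 ?addr0 => [|i' ii]; last first.
    by rewrite big1 // => j _; rewrite big1 // => d _; rewrite eq_sym (negPf ii) !mulr0.
  apply: eq_big => [j|j _]; first by rewrite -val_eqE; case: ltngtP.
  by apply: eq_bigr => d _; rewrite eqxx mulr1 /G dotDl !dot_unitvl !mul1r.
rewrite [RHS](bigID (fun i' : 'I_n => (i' < i)%N)) /= [X in _ = _ + X]big1 ?addr0; last first.
  move=> i' ii; rewrite big1 // => j ij; rewrite big1 // => d _.
  by case: eqP => [E|_]; rewrite ?mulr0 //; rewrite -E (negPf ii) in ij.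
apply: eq_big => [j|j]; first by rewrite -val_eqE; case: ltngtP.
move=> /andP[ji]; rewrite -leqNgt => jile; have lt : (j < i)%N by rewrite ltn_neqAle jile val_eqE ji.
rewrite [RHS](bigD1 i) //= [X in _ = _ + X]big1 ?addr0 => [|j' /andP[_ jj]]; last first.
  by rewrite big1 // => d _; rewrite eq_sym (negPf jj) !mulr0.
rewrite !big_bool /= eqxx !mulr1 /G !dotDl !dot_unitvl !mul1r /eco /sgi /=.
rewrite mulrN1 -sgzN opprB [h j + h i]addrC; congr (_ * sgz _ + _); ring.
Qed.

Lemma leads_Qtor h : regh h -> leads h Qtor (rho2 h).
Proof.
move=> rh; have [h0 h1] := rh.
have d0 i : dot (unitv (i, false) 1) h != 0 by rewrite dot_unitvl mul1r.
have d1 (i j : 'I_n) d : (i < j)%N -> dot (root1 i j d) h != 0.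
  move=> ij; rewrite dotDl !dot_unitvl !mul1r -[eco h (j, d)]opprK -eco_opp subr_eq0 h1 //=.
  by apply: contraTneq ij => ->; rewrite ltnn.
rewrite rho2_sum; apply: leadsM.
  apply: leads_prod => i _; apply: leads_prod => e _; apply: leads_prod => p _.
  exact: leads_rfac.
apply: leads_prod => i _; apply: leads_prod => j ij; apply: leads_prod => d _.
apply: leads_prod => t _; apply: leads_rfac; exact: d1.
Qed.

Lemma Qtor_coef : exists c0 : expo -> K,
  [/\ forall Y, tor Y -> Usp q k LL Y m1 c0, forall Z, tor Z -> ev s c0 Z = Qtor Z &
      forall h, regh h -> c0 (- rho2 h) = 1].
Proof.
have [B [c0 [hB [sup E]]]] := LF_box k m1 LF_Qtor.
(* Induction on the distance N to the bottom of the box: at a level below that of -[rho2 h], the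
   rescaled limit of Q is 0 by [leads_Qtor], so all coefficients on that level vanish. *)
have lowbox h : regh h -> forall (N : nat) (dl : int), (forall mu, mu \in boxs n B -> dl - N%:Z <= dot mu h) ->
    dl <= - dot (rho2 h) h -> forall mu, mu \in boxs n B -> dot mu h < dl -> c0 mu = 0.
  move=> rh N; elim: N => [|N IH] dl HN dh mu smu dm.
    by have := HN mu smu; rewrite subr0 leNgt dm.
  have IH' : forall nu, nu \in boxs n B -> dot nu h < dl - 1 -> c0 nu = 0.
    apply: IH; last by move: dh; clear; lia.
    by move=> nu snu; have := HN nu snu; clear; lia.
  case: (ltrP (dot mu h) (dl - 1)) => dm1; first exact: IH'.
  have Ed : dot mu h = dl - 1 by move: dm dm1; clear; lia.
  suff HZ : forall Z, tor Z -> ev (boxs n B) (level h (dl - 1) c0) Z = 0.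
    by have := ev_inj (uniq_boxs n B) HZ smu; rewrite /level Ed eqxx.
  move=> Z tZ; apply: rlim_uniq (rlim_ev_level (s := boxs n B) tZ IH') _.
  have L := rlimM (rlim_Xpos 1 (_ : 0 < - (dl - 1) - dot (rho2 h) h)) (leads_Qtor rh tZ).
  have {L} L := L ltac:(by move: dh; clear; lia).
  rewrite mul0r in L; apply: rlim_near L.
  apply: cofinW (cofin_neq 0) _ => y y0.
  by rewrite -E ?mul1r ?mulrA -?expfzDr ?subrK //; apply: tor_cv.
have low h : regh h -> forall mu, dot mu h < - dot (rho2 h) h -> c0 mu = 0.
  move=> rh mu dm; case smu : (mu \in boxs n B); last by apply: sup; rewrite smu.
  apply: (lowbox h rh (absz (- dot (rho2 h) h) + \sum_(nu <- boxs n B) absz (dot nu h))%N _ _ _ mu smu dm) => //.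
  move=> nu snu; have : (absz (dot nu h) <= \sum_(nu <- boxs n B) absz (dot nu h))%N.
    by rewrite (big_rem nu) //= leq_addr.
  by move: (\sum_(nu <- _) _)%N (dot nu h) (dot (rho2 h) h) => x y z; clear; lia.
have hc : hull k m1 c0.
  move=> mu cm h rh; rewrite dotDl -[dot mu h]opprK addrC subr_ge0 leNgt; apply/negP => dm.
  by case/eqP: cm; apply: (low h rh); move: dm; clear; lia.
have Es Z : tor Z -> ev s c0 Z = Qtor Z.
  move=> tZ; rewrite E //; apply/esym; apply: ev_sub; rewrite ?uniq_boxs //; first exact: boxs_sub.
  by move=> mu _; apply: hull_box hc.
exists c0; split=> // [Y tY|h rh].
  by split=> //; [exact: cond1_Qtor|exact: cond2_Qtor].
pose r := - rho2 h; pose B' := (B + \sum_(i < n) absz (r i))%N.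
have rB : r \in boxs n B'.
  rewrite mem_boxs; apply/forallP => i.
  have : (absz (r i) <= \sum_(i < n) absz (r i))%N by rewrite (bigD1 i) //= leq_addr.
  by rewrite /B' ler_norml; move: (\sum_(i0 < n) _)%N (r i) => x y; clear; lia.
have HZ : forall Z, tor Z ->
    ev (boxs n B') (fun mu => level h (- dot (rho2 h) h) c0 mu - (mu == r)%:R) Z = 0.
  move=> Z tZ; rewrite /ev; under eq_bigr do rewrite mulrBl.
  have Er : \sum_(mu <- boxs n B') (mu == r)%:R * mon Z mu = mon Z r.
    rewrite (bigD1_seq r) ?uniq_boxs //= eqxx mul1r big1 ?addr0 // => mu mr.
    by rewrite (negPf mr) mul0r.
  rewrite sumrB Er.
  apply/eqP; rewrite subr_eq0; apply/eqP.
  have low' mu : mu \in boxs n B' -> dot mu h < - dot (rho2 h) h -> c0 mu = 0 by move=> _; apply: low.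
  apply: rlim_uniq (rlim_ev_level tZ low') _.
  apply: rlim_near (leads_Qtor rh tZ); apply: cofinW (cofin_neq 0) _ => y y0.
  rewrite opprK E; last exact: tor_cv.
  congr (_ * _); apply/esym; apply: ev_sub; rewrite ?uniq_boxs //.
    by apply: boxs_sub; rewrite /B' leq_addr.
  by move=> mu _ cm; apply: contraR cm => /sup ->.
have := ev_inj (uniq_boxs n B') HZ rB; rewrite eqxx /level dotNl eqxx => /eqP.
by rewrite subr_eq0 => /eqP.
Qed.
End InitialFunction.

(** * The theorem in torus coordinates *)

Section TorusTheorem.
Variables (K : numFieldType) (n : nat) (q : K).
Hypotheses (q0 : q != 0) (hq : forall N : nat, (0 < N)%N -> q ^+ N != 1).
Variables (k : nat) (LL : bool -> nat * nat).
Hypotheses (HLL : forall b, odd ((LL b).1 + (LL b).2)).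
Local Notation pt := ('I_n -> K).
Local Notation sidx := ('I_n * bool)%type.
Local Notation expo := {ffun 'I_n -> int}.
Variable m1 : int.
Hypothesis Hm1 : 2 * m1 = 2 + \sum_(e : bool) ((LL e).1 + (LL e).2)%N%:Z.
Local Notation r2 := (r2 k m1).
Local Notation rho2 := (rho2 k m1).
Local Notation inS := (inS k m1).
Implicit Types (Y Z : pt) (mu eta h : expo) (a b : sidx) (c : expo -> K).

Definition cst_torus : K := \sum_(i < n) (q ^ (m1 + (2 * k * i)%N%:Z) + q ^ (- (m1 + (2 * k * i)%N%:Z))).

(** For each j the two signs of e_j together contribute 2 sgn(h_i) if |h_j| < |h_i| and 0 otherwise.
    So [r2 h (i, false)] is sgn(h_i) (m1 + 2k rk i), and the rank [rk] permutes 0, ..., n - 1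
    whatever h is. *)
Lemma cst_sum h : regh h -> cst_torus = \sum_a q ^ r2 h a.
Proof.
move=> rh; have [h0 h1] := rh.
have hz i : h i != 0 by have := h0 (i, false).
have hab i j : i != j -> h i != h j /\ h i != - h j.
  by move=> ij; split; [have := h1 (i, false) (j, false) ij|have := h1 (i, false) (j, true) ij].
pose rk i := #|[pred j | absz (h j) < absz (h i)]%N|.
have rkn i : (rk i < n)%N.
  rewrite /rk -[X in (_ < X)%N](card_ord n); apply/proper_card/properP; split; first exact/fintype.subsetP.
  by exists i; rewrite !inE ?ltnn.
have rkE i : r2 h (i, false) = sgz (h i) * (m1 + (2 * k * rk i)%N%:Z).
  rewrite /r2 /= sum_pairs /= mulrDr [sgz _ * m1]mulrC; congr (_ + _).
  transitivity (k%:Z * \sum_(j < n | j != i) (if (absz (h j) < absz (h i))%N then 2 * sgz (h i) else 0)).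
    congr (_ * _); apply: eq_bigr => j ji; rewrite big_bool /eco /sgi /=.
    have [n1 n2] := hab _ _ ji; move: (hz i) n1 n2; move: (h i) (h j) => x y; clear => x0 n1 n2.
    have S (u v : int) : (0 < u /\ sgz u = 1) \/ (0 < - u /\ sgz u = -1) ->
       (0 < v /\ sgz v = 1) \/ (0 < - v /\ sgz v = -1) -> True by [].
    have A := @sgz_case (x - y); have B := @sgz_case (x + y); have D := sgz_case x0.
    have {A} A : (0 < x - y /\ sgz (x - y) = 1) \/ (0 < - (x - y) /\ sgz (x - y) = -1) by apply: A; move: n1; clear; lia.
    have {B} B : (0 < x + y /\ sgz (x + y) = 1) \/ (0 < - (x + y) /\ sgz (x + y) = -1) by apply: B; move: n2; clear; lia.
    case: A => -[A ->]; case: B => -[B ->]; case: D => -[D ->]; case: ltnP => L; move: A B D L; clear; lia.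
  rewrite -big_mkcondr /= sumr_const.
  have -> : #|[pred j | (j != i) && (absz (h j) < absz (h i))%N]| = rk i.
    apply: eq_card => j; rewrite !inE; case: (j =P i) => [->|_] //=; by rewrite ltnn.
  by rewrite -mulr_natr natz !PoszM; ring.
have rk_inj : injective (fun i => Ordinal (rkn i)).
  move=> i j [E]; apply/eqP; apply: contraT => ij; have [n1 n2] := hab _ _ ij.
  have lt i' j' : (absz (h i') < absz (h j'))%N -> (rk i' < rk j')%N.
    move=> L; apply/proper_card/properP; split.
      by apply/fintype.subsetP => x; rewrite !inE => /ltn_trans; apply.
    by exists i'; rewrite !inE ?ltnn.
  case: (ltngtP (absz (h i)) (absz (h j))) => [/lt|/lt|EE]; rewrite ?E ?ltnn //.
  by move: n1 n2 EE; move: (h i) (h j) => x y; clear; lia.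
rewrite /cst_torus (reindex_inj rk_inj) /=.
transitivity (\sum_(i < n) \sum_(d : bool) q ^ r2 h (i, d)); last first.
  by rewrite pair_big /=; apply: eq_bigr => -[].
apply: eq_bigr => i _; rewrite big_bool /= -[r2 h (i, true)]/(r2 h (opp (i, false))) r2_opp rkE.
case: (sgz_case (hz i)) => -[_ ->]; rewrite ?mul1r ?mulN1r ?opprK //; exact: addrC.
Qed.

Lemma m1_pos : 0 < m1.
Proof.
have := HLL true; have := HLL false; have := Hm1; rewrite big_bool /=.
by move: (_ + _)%N (_ + _)%N => x y; clear; lia.
Qed.

Variables (etas : seq expo) (g : expo).
Hypothesis rg : regh g.
Hypothesis Heta : forall eta, inS eta -> eta \in - rho2 g :: etas.
Local Notation Dop Y := (Dop q k LL (q ^ (- m1)) cst_torus Y).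

(** F Y L holds the coefficients obtained from Q after the factors indexed by L. Keeping partial
    lists lets the iterated formula be matched one factor at a time. *)
Theorem torus_baker_akhiezer : exists (s : seq expo) (F : pt -> seq expo -> expo -> K),
  [/\ uniq s,
    forall Y, tor Y -> (forall Z, tor Z -> ev s (F Y [::]) Z = Qtor q k LL Z) /\
      forall eta L Z, tor Z -> reg (poles q) Z ->
        ev s (F Y (eta :: L)) Z = Dop Y (ev s (F Y L)) Z - Em q Y eta * ev s (F Y L) Z,
    forall Y, tor Y -> cond1 q LL Y (ev s (F Y etas)) /\ cond2 q k Y (ev s (F Y etas)),
    forall Y, tor Y -> (forall Z, tor Z -> reg (poles q) Z ->
        Dop Y (ev s (F Y etas)) Z = Em q Y (- rho2 g) * ev s (F Y etas) Z) /\
      (forall mu, F Y etas mu != 0 -> mu \in s /\ inS (dbl mu + rho2 g)) &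
    forall Y, tor Y -> F Y etas (- rho2 g) = \prod_(eta <- etas) (Em q Y (- rho2 g) - Em q Y eta)].
Proof.
have m1_gt0 := m1_pos.
pose s := boxs n (hbound n k m1).
have [M [P [w [tP rP' HP]]]] := interpolation (poles q) (uniq_boxs n (hbound n k m1)).
have rP j : (j < M)%N -> reg (poles q) (P j).
  move=> /rP'[h1 h2]; split=> // a b ab; rewrite -[co _ b]mul1r; apply: h2 => //.
  exact: poles1.
have [c0 [Uc0 Ec0 c01]] := Qtor_coef n q0 k HLL Hm1.
have tY1 : tor (fun _ : 'I_n => 1 : K) by move=> i; apply: oner_neq0.
have Beta0 : etab k m1 (- rho2 g).
  have -> : - rho2 g = dbl (- rho2 g) + rho2 g.
    by apply/ffunP => i; rewrite !ffunE; move: (r2 g _) => x; clear; lia.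
  by apply: (etab_face m1_gt0 (Uc0 _ tY1)) => //; rewrite c01 // oner_neq0.
pose kap := q ^ (- m1).
pose F Y L := app q k LL kap cst_torus Y m1 M P w [seq Em q Y eta | eta <- L] c0.
have Hcst h : regh h -> cst_torus = \sum_a q ^ r2 h a by apply: cst_sum.
have UF Y L : tor Y -> Usp q k LL Y m1 (F Y L).
  by move=> tY; apply: (Usp_app q0 hq HLL tY Hm1 (erefl kap) Hcst tP rP HP _ (Uc0 _ tY)).
have DF Y c : tor Y -> Usp q k LL Y m1 c -> forall Z, tor Z -> reg (poles q) Z ->
    Dop Y (ev s c) Z = ev s (Dhat q k LL kap cst_torus Y m1 M P w c) Z.
  by move=> tY Uc; have [] := Dhat_spec q0 hq HLL tY Hm1 (erefl kap) Hcst tP rP HP Uc.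
have ev_sub2 x c c' Z : ev s (fun mu => c mu - x * c' mu) Z = ev s c Z - x * ev s c' Z.
  rewrite /ev mulr_sumr -sumrB; apply: eq_bigr => mu _.
  by rewrite mulrBl mulrA.
exists s, F; split.
- exact: uniq_boxs.
- move=> Y tY; split=> [Z|eta L Z tZ rZ]; first exact: Ec0.
  by rewrite (DF Y _ tY (UF Y L tY)) //; apply: ev_sub2.
- by move=> Y tY; have [_ h1 h2] := UF Y etas tY.
- move=> Y tY; split=> [Z tZ rZ|mu pm].
    rewrite (DF Y _ tY (UF Y etas tY)) //; apply/eqP; rewrite -subr_eq0 -ev_sub2.
    have := psi_eigen q0 hq HLL m1_gt0 Hm1 (erefl kap) Hcst tP rP HP Heta Beta0 Uc0 tY.
    rewrite /psi /step => H; apply/eqP; rewrite /ev big1 // => mu _.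
    by move/(congr1 (fun f : expo -> K => f mu)): H => /= ->; rewrite mul0r.
  split; last first.
    have := psi_support q0 hq HLL m1_gt0 Hm1 (erefl kap) Hcst tP rP HP Heta Beta0 Uc0 tY.
    by move=> /(_ mu pm); rewrite opprK.
  by have [hc _ _] := UF Y etas tY; apply: hull_box hc pm.
- move=> Y tY.
  have := psi_bottom q0 hq HLL Hm1 (erefl kap) Hcst tP rP HP etas Uc0 tY rg.
  by rewrite c01 // mulr1.
Qed.

Lemma cofin_qpow (P : K -> Prop) : cofin P -> exists N : nat, P (q ^+ N).
Proof.
case=> E E0 HE; apply: contrapT => H.
have qinj : injective (fun N : nat => q ^+ N).
  by move=> N N' /= EN; have := qz_inj q0 hq (EN : q ^ N%:Z = q ^ N'%:Z) => -[].
have: (size [seq q ^+ i | i <- iota 0 (size E)] < size E)%N.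
  apply: max_poly_roots => //; last by rewrite map_inj_uniq ?iota_uniq.
  apply/allP => _ /mapP[i _ ->]; rewrite rootE; case: (eqVneq E.[q ^+ i] 0) => // /HE Hi.
  by case: H; exists i.
by rewrite size_map size_iota ltnn.
Qed.

(** The point must have the form q^(2z). Powers of q suffice: in a separating direction the sum
    becomes a nonzero Laurent polynomial in one variable, which cannot vanish at all the distinct
    powers of q. *)
Lemma ev_neq0_qpow (s : seq expo) c mu : uniq s -> mu \in s -> c mu != 0 ->
  exists v : 'I_n -> int, ev s c (fun i => q ^ v i) != 0.
Proof.
move=> us smu cm; have [T T1 inj] := separating_powh K s.
pose h := powh n T.
have inj2 : injective (fun i : 'I_(size s) => dot (nth 0 s i) h).
  move=> i j E; apply/val_inj/eqP => /=; rewrite -(nth_uniq 0 _ _ us) //.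
  by apply/eqP/inj => //; apply: mem_nth.
have im : (index mu s < size s)%N by rewrite index_mem.
have C0 : c (nth 0 s (Ordinal im)) != 0 by rewrite /= nth_index.
have [N] := cofin_qpow (cofin_expsum (C := fun i : 'I_(size s) => c (nth 0 s i)) inj2 C0).
move=> HN; exists (fun i => N%:Z * h i); apply: contraNneq HN => E; apply/eqP; rewrite -[RHS]E.
rewrite /ev (big_nth 0) big_mkord; apply: eq_bigr => i _; congr (_ * _).
rewrite /mon /dot expfz_sum ?expf_neq0 //; apply: eq_bigr => j _.
by rewrite exprnP !exprz_exp; congr (q ^ _); ring.
Qed.
End TorusTheorem.

(** * Exponential coordinates *)

Section Exponential.
Variables (R : realType) (logq : R[i]).
Local Notation C := R[i].
Local Notation q := (cexp logq).
Local Notation qp := (qpow logq).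
Implicit Types (u v w z : C).

Lemma cexpD u v : cexp (u + v) = cexp u * cexp v.
Proof.
case: u v => a b [c d]; rewrite /cexp /= expRD cosD sinD.
by apply/eqP; rewrite eq_complex /=; apply/andP; split; apply/eqP; ring.
Qed.

Lemma cexp0 : cexp (0 : C) = 1.
Proof. by rewrite /cexp /= expR0 cos0 sin0 mulr1 mulr0. Qed.

Lemma qpowD u v : qp (u + v) = qp u * qp v.
Proof. by rewrite /qpow mulrDl cexpD. Qed.

Lemma qpow0 : qp 0 = 1.
Proof. by rewrite /qpow mul0r cexp0. Qed.

Lemma qpow1 : qp 1 = q.
Proof. by rewrite /qpow mul1r. Qed.

Lemma qpow_neq0 u : qp u != 0.
Proof.
apply/eqP => E; have := qpowD u (- u).
by rewrite subrr qpow0 E mul0r => /eqP; rewrite oner_eq0.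
Qed.

Lemma qpowN u : qp (- u) = (qp u)^-1.
Proof. by apply: (mulfI (qpow_neq0 u)); rewrite -qpowD subrr qpow0 divff ?qpow_neq0. Qed.

Lemma qpowB u v : qp (u - v) = qp u / qp v.
Proof. by rewrite qpowD qpowN. Qed.

Lemma qpowX u (p : nat) : qp (p%:R * u) = qp u ^+ p.
Proof.
elim: p => [|p IH]; first by rewrite mul0r qpow0.
by rewrite -natr1 mulrDl qpowD IH mul1r exprSr.
Qed.

Lemma qpowZ u (p : int) : qp (p%:~R * u) = qp u ^ p.
Proof.
case: p => p; first exact: qpowX.
by rewrite NegzE mulrNz mulNr qpowN [p.+1%:~R]/(p.+1%:R) qpowX exprnN.
Qed.

Lemma qpow_int (p : int) : qp p%:~R = q ^ p.
Proof. by rewrite -[p%:~R]mulr1 qpowZ qpow1. Qed.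

Lemma qpow_sum (I : Type) (r : seq I) (P : pred I) (F : I -> C) :
  qp (\sum_(i <- r | P i) F i) = \prod_(i <- r | P i) qp (F i).
Proof. exact: (big_morph _ qpowD qpow0). Qed.

End Exponential.

(** * The Koornwinder operator in torus coordinates *)

Section OperatorTranslation.
Variables (R : realType) (logq : R[i]).
Local Notation C := R[i].
Local Notation q := (cexp logq).
Local Notation qp := (qpow logq).
Variables (n k L L' N N' : nat).
Local Notation M := (Params k (L%:R / 2) (L'%:R / 2) (N%:R / 2) (N'%:R / 2) : params R).
Local Notation LL := (fun e : bool => if e then (N, N') else (L, L')).
Local Notation pt := ('I_n -> C).
Local Notation sidx := ('I_n * bool)%type.
Local Notation vec := ('rV[C]_n).
Variable m1 : int.
Hypothesis Hm1 : 2 * m1 = 2 + \sum_(e : bool) ((LL e).1 + (LL e).2)%N%:Z.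
Implicit Types (u v w : C) (x z : vec) (f : vec -> C) (F : pt -> C).

Definition torus_pt z : pt := fun i => qp (2 * z 0 i).
Definition spectral_pt x : pt := fun i => qp ((x + rho n M) 0 i).
(** The factor q^(2(rho, z)) of Q is absorbed in the wave, so that what multiplies it is a Laurent
    polynomial in Z. *)
Definition plane_wave x z : C := qp (2 * dotp (x + rho n M) z).

Lemma tor_torus_pt z : tor (torus_pt z).
Proof. by move=> i; apply: qpow_neq0. Qed.

Lemma tor_spectral_pt x : tor (spectral_pt x).
Proof. by move=> i; apply: qpow_neq0. Qed.

Lemma qpow_half (p : nat) : qp (p%:R / 2) = qp 2^-1 ^+ p.
Proof. exact: qpowX. Qed.

Lemma realC_half (p : nat) : (p%:R / 2 : R)%:C = p%:R / 2 :> C.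
Proof. by rewrite rmorphM fmorphV !rmorph_nat. Qed.

Lemma qpow_half_sqr : qp 2^-1 ^+ 2 = q.
Proof. by rewrite -qpowX divff ?pnatr_eq0 // qpow1. Qed.

(** In terms of s = q^(1/2) and A = q^u every factor is a monomial times a difference in A^2 =
    q^(2u); the monomials collect into q^(-m1). *)
Lemma v_fraction u :
  v_num logq (qp (- (L%:R / 2 : R)%:C)) (qp (- (L'%:R / 2 : R)%:C))
    (qp (- (N%:R / 2 : R)%:C)) (qp (- (N'%:R / 2 : R)%:C)) u / v_den logq u =
  vv q LL (q ^ (- m1)) (qp (2 * u)).
Proof.
have s0 := qpow_neq0 logq 2^-1.
have -> : qp (2 * u) = qp u ^+ 2 by rewrite qpowX.
have A0 := qpow_neq0 logq u.
rewrite /v_num /v_den !realC_half.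
have -> : 2^-1 + u = u + 2^-1 by rewrite addrC.
have -> : - 2^-1 - u = - (u + 2^-1) by rewrite opprD addrC.
rewrite !qpowN !qpowD !qpow_half /vv big_bool /vfac /sgK /= expr1 expr0.
have -> : q ^ (- m1) = (qp 2^-1 ^+ 2 * (qp 2^-1 ^+ L * qp 2^-1 ^+ L' * (qp 2^-1 ^+ N * qp 2^-1 ^+ N')))^-1.
  rewrite -!exprD -[in LHS]qpow_half_sqr [_ ^+ 2]exprnP exprz_exp mulrN -invr_expz exprnP; congr (_ ^ _)^-1.
  by move: Hm1; rewrite big_bool /=; clear; lia.
rewrite -!exprnP -!qpow_half_sqr -!exprM ![(2 * _)%N]mulnC !exprM.
move: (qp 2^-1) (qp u) s0 A0 => s A s0 A0.
have E p : s ^+ p != 0 by rewrite expf_neq0.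
move: (s ^+ L) (s ^+ L') (s ^+ N) (s ^+ N') (E L) (E L') (E N) (E N') => a b c d a0 b0 c0 d0.
have Fm (x : C) : x != 0 -> x^-1 * A - x^-1^-1 * A^-1 = (x * A)^-1 * (A ^+ 2 - x ^+ 2).
  by move=> x0; field; apply/andP.
have Fp (x : C) : x != 0 -> x^-1 * A + x^-1^-1 * A^-1 = (x * A)^-1 * (A ^+ 2 + x ^+ 2).
  by move=> x0; field; apply/andP.
have -> : A - A^-1 = A^-1 * (A ^+ 2 - 1) by field.
have -> : A + A^-1 = A^-1 * (A ^+ 2 - -1) by field.
have -> : A * s - (A * s)^-1 = s / A * (A ^+ 2 - 1 * (s ^+ 2)^-1) by field; apply/andP.
have -> : A * s + (A * s)^-1 = s / A * (A ^+ 2 - -1 * (s ^+ 2)^-1) by field; apply/andP.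
rewrite !Fm // !Fp // !invfM !invrK !mulN1r !mul1r !opprK.
move: (_ - 1)^-1 (_ + 1)^-1 (_ - s^-1 / s)^-1 (_ + s^-1 / s)^-1 => e1 e2 e3 e4.
by field; do ?[apply/andP; split].
Qed.

Lemma half_fraction (A B : C) : B != 0 ->
  (qp (- k%:R) * B - (qp (- k%:R))^-1 * B^-1) / (B - B^-1) = pf q k (B ^+ 2).
Proof.
move=> B0; have := qpow_neq0 logq k%:R.
rewrite /pf /pnum qpowN -invr_expz -exprnP -[k%:R]mulr1 qpowX qpow1 => s0.
have -> : B - B^-1 = B^-1 * (B ^+ 2 - 1) by field.
rewrite invfM invrK; move: (_ - 1)^-1 => e.
by field; apply/andP.
Qed.

Lemma pair_fraction u w :
  pair_num logq (qp (- k%:R)) u w / pair_den logq u w =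
  pf q k (qp (2 * (u + w))) * pf q k (qp (2 * (u - w))).
Proof.
rewrite /pair_num /pair_den ![qp (2 * _)]qpowX -!half_fraction ?qpow_neq0 // -!qpowN.
rewrite !opprB !opprD [- u + w]addrC !opprK invfM; move: (_^-1) (_^-1) => x y; ring.
Qed.

Lemma co_torus_pt z (a : sidx) : co (torus_pt z) a = qp (2 * (if a.2 then - z 0 a.1 else z 0 a.1)).
Proof. by case: a => i []; rewrite /co /torus_pt //= mulrN qpowN. Qed.

Lemma v_at_torus z (a : sidx) :
  v_at logq (qp (- k%:R)) (qp (- (L%:R / 2 : R)%:C)) (qp (- (L'%:R / 2 : R)%:C))
    (qp (- (N%:R / 2 : R)%:C)) (qp (- (N'%:R / 2 : R)%:C)) a.1
    (if a.2 then - z 0 a.1 else z 0 a.1) z =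
  vc q k LL (q ^ (- m1)) a (torus_pt z).
Proof.
rewrite /v_at v_fraction /vc -co_torus_pt; congr (_ * _).
transitivity (\prod_(j < n | j != a.1) \prod_(d : bool) pf q k (co (torus_pt z) a * co (torus_pt z) (j, d))).
  apply: eq_bigr => j _; rewrite pair_fraction big_bool !co_torus_pt /= -!qpowD -!mulrDr.
  exact: mulrC.
by rewrite pair_big_dep /=; apply: eq_big => [[j d]|[j d] _] //=; rewrite ?andbT.
Qed.

Lemma zshift_torus x F i (p : int) z :
  zshift i (p%:~R / 2) (fun z => plane_wave x z * F (torus_pt z)) z =
  plane_wave x z * TT q (spectral_pt x) (unitv (i, false) p) F (torus_pt z).
Proof.
have zE j : (z + (p%:~R / 2) *: basis_vec R i) 0 j = z 0 j + (p%:~R / 2) * (j == i)%:R by rewrite !mxE eqxx.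
rewrite /zshift /TT mulrA; congr (_ * F _).
  rewrite mon_unitv /co /= /plane_wave /spectral_pt -qpowZ -qpowD; congr qp.
  rewrite /dotp (eq_bigr (fun j => (x + rho n M) 0 j * z 0 j + (x + rho n M) 0 j * (p%:~R / 2) * (j == i)%:R)).
    rewrite big_split /= (bigD1 (P := xpredT) (F := fun j => _ * (j == i)%:R) i) //= eqxx mulr1.
    rewrite [X in _ + (_ + X)]big1 => [|j ji]; last by rewrite (negPf ji) mulr0.
    by field.
  by move=> j _; rewrite zE; ring.
apply/funext => j; rewrite /torus_pt /tr /cv zE ffunE /=.
case: (j =P i) => _; rewrite ?mulr0 ?addr0 ?mulr1 ?expr0z ?mulr1 //.
by rewrite mulrDr qpowD; congr (_ * _); rewrite -qpow_int; congr qp; field.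
Qed.

(** Here abcd/q = q^(-m1) and t = q^(-k), so the two geometric sums run over q^(-(m1 + 2ki)) and
    q^(m1 + 2ki); the constant of D is m(rho). *)
Lemma cst_torus_koornwinder :
  qp (- (L%:R / 2 : R)%:C) * qp (- (L'%:R / 2 : R)%:C) * qp (- (N%:R / 2 : R)%:C)
    * qp (- (N'%:R / 2 : R)%:C) * qp (- 1) * (\sum_(i < n) qp (- k%:R) ^+ (2 * i))
  + (qp (- (L%:R / 2 : R)%:C) * qp (- (L'%:R / 2 : R)%:C) * qp (- (N%:R / 2 : R)%:C)
    * qp (- (N'%:R / 2 : R)%:C))^-1 * qp 1 * (\sum_(i < n) qp (- k%:R) ^- (2 * i))
  = cst_torus n q k m1.
Proof.
have m1E : m1%:~R = (L%:R / 2 + L'%:R / 2 + N%:R / 2 + N'%:R / 2 + 1) :> C.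
  have /(congr1 (fun p : int => p%:~R : C)) := Hm1; rewrite big_bool /= !rmorphD rmorphM /=.
  rewrite -!pmulrn !natrD => E; apply: (mulfI (_ : 2 != 0)); first by rewrite pnatr_eq0.
  by rewrite E; field.
rewrite -!qpowD -qpowN /cst_torus addrC [RHS]big_split /= !mulr_sumr; congr (_ + _); apply: eq_bigr => i _.
  rewrite -qpowX -qpowN -!qpowD -qpow_int; congr qp; rewrite intrD m1E !realC_half.
  by rewrite !natrM -pmulrn natrM; ring.
rewrite -qpowX -!qpowD -qpow_int; congr qp; rewrite mulrNz intrD m1E !realC_half.
by rewrite -pmulrn !natrM; ring.
Qed.

(** The hypothesis concerns only z and its unit neighbours, because the iterates of the formula are
    known to have this form at generic points only. *)
Lemma koornwinder_torus x F f z :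
  (forall w : vec, w = z \/ (exists i, w = z + 1 *: basis_vec R i \/ w = z + (- 1) *: basis_vec R i) ->
     f w = plane_wave x w * F (torus_pt w)) ->
  koornwinderM M logq f z =
  plane_wave x z * Dop q k LL (q ^ (- m1)) (cst_torus n q k m1) (spectral_pt x) F (torus_pt z).
Proof.
move=> Hf; pose G z := plane_wave x z * F (torus_pt z).
have f0 : f z = G z by apply: Hf; left.
have fs i (d : bool) : zshift i ((-1) ^+ d) f z = zshift i (((-1) ^+ d * 2)%:~R / 2) G z.
  have -> : ((-1) ^+ d * 2)%:~R / 2 = (-1) ^+ d :> C.
    by rewrite rmorphM rmorphXn /= rmorphN1; field.
  by rewrite /zshift Hf //; right; exists i; case: d; [right|left]; rewrite ?expr1 ?expr0.
rewrite /koornwinderM /koornwinder cst_torus_koornwinder /Dop mulrDr f0.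
congr (_ + _); last by rewrite /G; ring.
rewrite mulr_sumr -[RHS](pair_big xpredT xpredT (fun i d => plane_wave x z * (vc q k LL (q ^ (- m1)) (i, d) (torus_pt z) *
  (TT q (spectral_pt x) (unitv (i, d) 2) F (torus_pt z) - F (torus_pt z))))) /=.
apply: eq_bigr => i _; rewrite big_bool /= [RHS]addrC.
have := fs i false; have := fs i true; rewrite expr0 expr1 => -> ->.
rewrite -[v_plus _ _ _ _ _ _ _ _]/(v_at _ _ _ _ _ _ (i, false).1 (if (i, false).2 then - z 0 (i, false).1 else z 0 (i, false).1) z).
rewrite -[v_minus _ _ _ _ _ _ _ _]/(v_at _ _ _ _ _ _ (i, true).1 (if (i, true).2 then - z 0 (i, true).1 else z 0 (i, true).1) z).
rewrite !v_at_torus !zshift_torus /G.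
have -> : unitv (i, false) (-1 * 2) = unitv (i, true) 2.
  by apply/ffunP => j; rewrite !ffunE.
by ring.
Qed.

Lemma regular_torus z : regular_at logq z -> reg (poles q) (torus_pt z).
Proof.
have Em u : qp u - qp (- u) != 0 -> qp (2 * u) != 1.
  apply: contraNneq; rewrite qpowX qpowN => E; rewrite subr_eq0; apply/eqP.
  by apply: (mulIf (qpow_neq0 logq u)); rewrite mulVf ?qpow_neq0 // -expr2.
have Ep u : qp u + qp (- u) != 0 -> qp (2 * u) != -1.
  apply: contraNneq; rewrite qpowX qpowN => E; rewrite addr_eq0; apply/eqP.
  by apply: (mulIf (qpow_neq0 logq u)); rewrite mulNr mulVf ?qpow_neq0 // -expr2.
have cE a : exists2 u, co (torus_pt z) a = qp (2 * u) & u = z 0 a.1 \/ u = - z 0 a.1.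
  by rewrite co_torus_pt; exists (if a.2 then - z 0 a.1 else z 0 a.1) => //; case: a.2; [right|left].
move=> Hz; split=> [a|a b ab].
  have [u ->] := cE a; move/Hz=> [+ _].
  have -> : v_den logq u = (qp u - qp (- u)) * (qp (2^-1 + u) - qp (- (2^-1 + u)))
      * (qp u + qp (- u)) * (qp (2^-1 + u) + qp (- (2^-1 + u))) by rewrite /v_den opprD.
  rewrite 3!mulf_eq0 -!orbA => /norP[/Em h1 /norP[/Em h2 /norP[/Ep h3 /Ep h4]]].
  have q0 : q != 0 by rewrite -qpow1 qpow_neq0.
  have E : qp (2 * (2^-1 + u)) = qp (2 * u) * q by rewrite mulrDr divff ?pnatr_eq0 // addrC qpowD qpow1.
  rewrite E in h2 h4.
  apply/polesP => -[]; split; rewrite ?expr1 ?expr0 //.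
    by apply: contraNneq h4 => ->; rewrite /sgK expr1 divfK.
  by apply: contraNneq h2 => ->; rewrite /sgK expr0 divfK.
have [u -> /Hz[_ /(_ b.1)]] := cE a; rewrite eq_sym ab => /(_ isT).
have -> : pair_den logq u (z 0 b.1) = (qp (u - z 0 b.1) - qp (- (u - z 0 b.1))) *
    (qp (u + z 0 b.1) - qp (- (u + z 0 b.1))) by rewrite /pair_den opprB opprD [- u + _]addrC.
rewrite mulf_eq0 negb_or => /andP[/Em + /Em]; rewrite mulrBr mulrDr qpowB qpowD co_torus_pt => h1 h2.
case: b ab h1 h2 => j [] /= ab h1 h2; [apply: contraNneq h2|apply: contraNneq h1] => ->.
  by rewrite mulrN -qpowD addNr qpow0.
by rewrite divff ?qpow_neq0.
Qed.

Lemma generic_regular z : generic logq z -> regular_at logq z.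
Proof. by move=> /(_ 0); rewrite map_mx0 addr0. Qed.

Lemma generic_shift z (mu : 'rV[int]_n) : generic logq z -> generic logq (z + map_mx intr mu).
Proof. by move=> Hz nu; have := Hz (mu + nu); rewrite map_mxD addrA. Qed.

Lemma generic_step z i : generic logq z ->
  generic logq (z + 1 *: basis_vec R i) /\ generic logq (z + (- 1) *: basis_vec R i).
Proof.
have E (p : int) : p%:~R *: basis_vec R i = map_mx intr (p *: delta_mx 0 i : 'rV[int]_n).
  by rewrite map_mxZ map_delta_mx.
move=> Hz; split; [have := generic_shift (mu := 1 *: delta_mx 0 i) Hz|have := generic_shift (mu := -1 *: delta_mx 0 i) Hz];
  by rewrite -E.
Qed.
End OperatorTranslation.

(** * The function Q in torus coordinates *)

Section QTranslation.
Variables (R : realType) (logq : R[i]).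
Local Notation C := R[i].
Local Notation q := (cexp logq).
Local Notation qp := (qpow logq).
Variables (n k L L' N N' : nat).
Local Notation M := (Params k (L%:R / 2) (L'%:R / 2) (N%:R / 2) (N'%:R / 2) : params R).
Local Notation LL := (fun e : bool => if e then (N, N') else (L, L')).
Local Notation vec := ('rV[C]_n).
Hypothesis HLL : forall b, odd ((LL b).1 + (LL b).2).
Implicit Types (u v w : C) (x z : vec).
Local Notation torus_pt := (torus_pt logq).

Lemma natr_sub_nat (v p : nat) : ((v%:R / 2 - p%:R / 2 : R) \is a Num.nat) = (p <= v)%N && ~~ odd (v - p).
Proof.
apply/idP/andP => [/natrP[c]|[pv ev]].
  move/(congr1 (fun y : R => y * 2)); rewrite mulrBl !divfK ?pnatr_eq0 // => /eqP.
  rewrite subr_eq -natrM -natrD eqr_nat => /eqP ->.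
  by rewrite leq_addl addnK oddM andbF.
rewrite -mulrBl -natrB // -(odd_double_half (v - p)) (negPf ev) add0n -muln2 natrM mulfK ?pnatr_eq0 //.
Qed.

Lemma preccurly_half (p v w : nat) : preccurly (p%:R / 2 : R) (v%:R / 2) (w%:R / 2) =
  ((p <= v)%N && ~~ odd (v - p)) || ((p <= w)%N && ~~ odd (w - p)).
Proof. by rewrite /preccurly !natr_sub_nat. Qed.

Lemma prec_prod_adm e (F : R -> C) :
  prec_prod ((LL e).1%:R / 2) ((LL e).2%:R / 2) F = \prod_(p <- admseq LL e) F (p%:R / 2).
Proof.
rewrite /prec_prod; have -> : 2 * Num.max ((LL e).1%:R / 2) ((LL e).2%:R / 2) = (maxn (LL e).1 (LL e).2)%:R :> R.
  rewrite -maxr_pMl ?invr_ge0 // mulrC divfK ?pnatr_eq0 //.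
  by rewrite /maxn /Num.max ltr_nat; case: ifP.
rewrite natrK /admseq big_filter /index_iota subSS subn0 big_seq_cond [RHS]big_seq_cond.
apply: eq_bigl => p; rewrite preccurly_half mem_iota /adm; case: ltnP => //.
Qed.

Lemma qminus_pair u w : qminus logq (u - w) * qminus logq (u + w) =
  - (qp (2 * w) + (qp (2 * w))^-1 - (qp (2 * u) + (qp (2 * u))^-1)).
Proof.
have := qpow_neq0 logq u; have := qpow_neq0 logq w.
rewrite /qminus !opprD !opprK !qpowD !qpowN ![qp (2 * _)]qpowX => w0 u0.
by field; apply/andP.
Qed.

Lemma qplus_pair u w : qplus logq (u - w) * qplus logq (u + w) =
  qp (2 * w) + (qp (2 * w))^-1 + (qp (2 * u) + (qp (2 * u))^-1).
Proof.
have := qpow_neq0 logq u; have := qpow_neq0 logq w.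
rewrite /qplus !opprD !opprK !qpowD !qpowN ![qp (2 * _)]qpowX => w0 u0.
by field; apply/andP.
Qed.

Lemma big_posroot1 (T : Type) (idx : T) (op : Monoid.com_law idx) (F : 'I_n -> 'I_n -> bool -> T) :
  \big[op/idx]_(al : posroot1 n) F (val al.1).1 (val al.1).2 al.2 =
  \big[op/idx]_(i < n) \big[op/idx]_(j < n | (i < j)%N) \big[op/idx]_(d : bool) F i j d.
Proof.
rewrite -(pair_big xpredT xpredT (fun p d => F (val p).1 (val p).2 d)) /=.
pose G (p : 'I_n * 'I_n) := \big[op/idx]_(d : bool) F p.1 p.2 d.
rewrite [RHS](pair_big_dep xpredT (fun i j : 'I_n => (i < j)%N) (fun i j => G (i, j))) /=.
rewrite (big_sub [pred p : 'I_n * 'I_n | (p.1 < p.2)%N] G).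
by [].
Qed.

Lemma dotp_basis i z : dotp (basis_vec R i) z = z 0 i.
Proof.
rewrite /dotp (bigD1 i) //= mxE !eqxx mul1r big1 ?addr0 // => j ji.
by rewrite mxE (negPf ji) andbF mul0r.
Qed.

Lemma dotp_lin (u v : vec) c z : dotp (u + c *: v) z = dotp u z + c * dotp v z.
Proof.
by rewrite /dotp mulr_sumr -big_split; apply: eq_bigr => i _; rewrite !mxE mulrDl mulrA.
Qed.

Lemma dotp_rootv1 (al : posroot1 n) z :
  dotp (rootv1 R al) z = z 0 (val al.1).1 + (-1) ^+ al.2 * z 0 (val al.1).2.
Proof. by rewrite /rootv1 dotp_lin !dotp_basis. Qed.

Lemma prodrN_seq (I : Type) (s : seq I) (F : I -> C) :
  \prod_(i <- s) - F i = (-1) ^+ size s * \prod_(i <- s) F i.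
Proof.
elim: s => [|i s IH]; first by rewrite !big_nil mulr1.
by rewrite !big_cons IH exprS; ring.
Qed.

(** For each i, every j with 0 < j ≼ (l, l') contributes a sign by [qminus_pair]; there are l + l' +
    1/2 of them, which the sign prefactor of Q compensates. The signs (-1)^k of e_i + e_j and e_i -
    e_j cancel each other. *)
Lemma Qfun_torus z : Qfun M logq z = qp (2 * dotp (rho n M) z) * Qtor q k LL (torus_pt z).
Proof.
have dotpN (r w : vec) : dotp r (- w) = - dotp r w.
  by rewrite /dotp -sumrN; apply: eq_bigr => i _; rewrite mxE mulrN.
have tz := tor_torus_pt logq z.
have rfacE al : mon (torus_pt z) (- al) = (mon (torus_pt z) al)^-1 by apply: monN.
have qpE (p : nat) : qp (2 * (p%:R / 2 : R)%:C) = q ^ p%:Z.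
  by rewrite -qpow_int realC_half; congr qp; field.
have E0 i : (prec_prod (L%:R / 2) (L'%:R / 2) (fun j => qminus logq (j%:C - dotp (rootv0 R i) z))
     * prec_prod (N%:R / 2) (N'%:R / 2) (fun j => qplus logq (j%:C - dotp (rootv0 R i) z))) *
   (prec_prod (L%:R / 2) (L'%:R / 2) (fun j => qminus logq (j%:C - dotp (rootv0 R i) (- z)))
     * prec_prod (N%:R / 2) (N'%:R / 2) (fun j => qplus logq (j%:C - dotp (rootv0 R i) (- z)))) =
   (-1) ^+ size (admseq LL false) * \prod_(e : bool) \prod_(p <- admseq LL e)
     rfac (unitv (i, false) 1) (sgK C e * (q ^ p%:Z + q ^ (- p%:Z))) (torus_pt z).
  have A0 F := @prec_prod_adm false F; have A1 F := @prec_prod_adm true F.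
  rewrite /= in A0 A1; rewrite !{}A0 !{}A1 big_bool /= mulrACA -!big_split /= [RHS]mulrCA.
  rewrite [LHS]mulrC; congr (_ * _).
    apply: eq_bigr => p _; rewrite dotpN opprK qplus_pair dotp_basis qpE.
    by rewrite /rfac rfacE // mon_unitv expr1z /co /= /sgK expr1 mulN1r opprK invr_expz.
  rewrite -prodrN_seq; apply: eq_bigr => p _; rewrite dotpN opprK qminus_pair dotp_basis qpE.
  by rewrite /rfac rfacE // mon_unitv expr1z /co /= /sgK expr0 mul1r invr_expz.
pose P0 (y : vec) i := prec_prod (L%:R / 2) (L'%:R / 2) (fun j : R => qminus logq (j%:C - dotp (rootv0 R i) y))
     * prec_prod (N%:R / 2) (N'%:R / 2) (fun j : R => qplus logq (j%:C - dotp (rootv0 R i) y)).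
pose P1 (y : vec) al := \prod_(1 <= j < k.+1) qminus logq (j%:R - dotp (rootv1 R al) y).
have cE y : cfun M logq y = (\prod_(i < n) P0 y i) * \prod_(al : posroot1 n) P1 y al by [].
have E1 al : P1 z al * P1 (- z) al = (-1) ^+ k * \prod_(1 <= t < k.+1)
    rfac (root1 (val al.1).1 (val al.1).2 al.2) (q ^ (2 * t%:Z) + q ^ (- (2 * t%:Z))) (torus_pt z).
  transitivity ((-1) ^+ size (index_iota 1 k.+1) * \prod_(1 <= t < k.+1)
      rfac (root1 (val al.1).1 (val al.1).2 al.2) (q ^ (2 * t%:Z) + q ^ (- (2 * t%:Z))) (torus_pt z)).
    rewrite /P1 -big_split -prodrN_seq /=; apply: eq_bigr => t _.
    rewrite dotpN opprK qminus_pair dotp_rootv1 /rfac rfacE mon_root1 // !co_torus_pt /=.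
    have -> : qp (2 * t%:R) = q ^ (2 * t%:Z) by rewrite -qpow_int; congr qp; rewrite intrM.
    rewrite invr_expz -qpowD -mulrDr; congr (- (_ + _ - _)); do ?congr (_^-1); congr (qp (2 * (_ + _)));
    by case: al => p []; rewrite ?expr1 ?expr0 ?mulN1r ?mul1r.
  by rewrite size_iota subn1.
transitivity (qp (2 * dotp (rho n M) z) * (((-1) ^+ (n * Num.truncn (L%:R / 2 + L'%:R / 2 + 2^-1 : R)) *
   \prod_(i < n) (P0 z i * P0 (- z) i)) * \prod_(al : posroot1 n) (P1 z al * P1 (- z) al))).
  by rewrite /Qfun !cE !big_split /=; ring.
congr (_ * _); rewrite /Qtor; congr (_ * _).
  rewrite (eq_bigr _ (fun i _ => E0 i)) big_split /= prodr_const card_ord mulrA -exprM [(n * _)%N]mulnC.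
  suff -> : Num.truncn (L%:R / 2 + L'%:R / 2 + 2^-1 : R) = size (admseq LL false).
    by rewrite -exprD addnn -mul2n exprM sqrrN !expr1n mul1r.
  have /= Hs := size_admseq HLL false.
  have -> : L%:R / 2 + L'%:R / 2 + 2^-1 = (size (admseq LL false))%:R :> R; last by rewrite natrK.
  apply: (mulfI (_ : 2 != 0)); first by rewrite pnatr_eq0.
  by rewrite -natrM Hs !natrD; field.
rewrite (eq_bigr _ (fun al _ => E1 al)) (big_posroot1 _ (fun i j d => (-1) ^+ k * \prod_(1 <= t < k.+1)
    rfac (root1 i j d) (q ^ (2 * t%:Z) + q ^ (- (2 * t%:Z))) (torus_pt z))).
apply: eq_bigr => i _; apply: eq_bigr => j _; rewrite big_split /= big_bool /=.
by rewrite -exprD addnn -mul2n exprM sqrrN !expr1n mul1r.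
Qed.

End QTranslation.

(** * Weighted sums of positive roots *)

Section RootSums.
Variables (R : realType) (logq : R[i]).
Local Notation C := R[i].
Variables (n k L L' N N' : nat).
Local Notation M := (Params k (L%:R / 2) (L'%:R / 2) (N%:R / 2) (N'%:R / 2) : params R).
Local Notation LL := (fun e : bool => if e then (N, N') else (L, L')).
Local Notation sidx := ('I_n * bool)%type.
Local Notation expo := {ffun 'I_n -> int}.
Local Notation vec := ('rV[C]_n).
Variable m1 : int.
Hypothesis Hm1 : 2 * m1 = 2 + \sum_(e : bool) ((LL e).1 + (LL e).2)%N%:Z.
Implicit Types (x z nu : vec) (l : sidx -> int) (c : sidx -> sidx -> int) (v : expo).

Lemma rootv1E (al : posroot1 n) i :
  rootv1 R al 0 i = (i == (val al.1).1)%:R + (-1) ^+ al.2 * (i == (val al.1).2)%:R.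
Proof. by rewrite /rootv1 !mxE. Qed.

(** As e_i + (-1)^d e_j = (-1)^d (e_j + (-1)^d e_i), extending the weights to both orders of a pair
    by this sign merges the two positions that a coordinate can take in a positive root. *)
Lemma root_sum (W : posroot n -> C) (w0 : 'I_n -> C) (w1 : 'I_n -> 'I_n -> bool -> C) i :
  (forall j, W (inl j) = w0 j) ->
  (forall al, W (inr al) = w1 (val al.1).1 (val al.1).2 al.2) ->
  (forall j j' d, w1 j' j d = (-1) ^+ d * w1 j j' d) ->
  (\sum_al W al *: rootv R al) 0 i = w0 i + \sum_(j < n | j != i) \sum_(d : bool) w1 i j d.
Proof.
move=> H0 H1 Hs; rewrite summxE big_sumType /=; congr (_ + _).
  rewrite (bigD1 i) //= !mxE !eqxx mulr1 H0 big1 ?addr0 // => j ji.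
  by rewrite !mxE eq_sym (negPf ji) mulr0.
transitivity (\sum_(al : posroot1 n) w1 (val al.1).1 (val al.1).2 al.2 *
    ((i == (val al.1).1)%:R + (-1) ^+ al.2 * (i == (val al.1).2)%:R)).
  by apply: eq_bigr => al _; rewrite mxE H1 rootv1E.
rewrite (big_posroot1 _ (fun a b d => w1 a b d * ((i == a)%:R + (-1) ^+ d * (i == b)%:R))).
transitivity (\sum_(a < n) \sum_(b < n | (a < b)%N) (i == a)%:R * (\sum_(d : bool) w1 i b d) +
   \sum_(b < n) \sum_(a < n | (a < b)%N) (i == b)%:R * (\sum_(d : bool) w1 i a d)).
  rewrite [X in _ = _ + X](exchange_big_dep xpredT) //= -big_split; apply: eq_bigr => a _.
  rewrite -big_split; apply: eq_bigr => b _ /=; rewrite !mulr_sumr -big_split; apply: eq_bigr => d _ /=.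
  rewrite mulrDr [in LHS]mulrA [w1 a b d * (-1) ^+ d]mulrC -Hs ![w1 _ _ _ * _]mulrC.
  by congr (_ + _); [case: (i =P a) => [->|]|case: (i =P b) => [->|]]; rewrite ?mul0r.
have D F : \sum_(a < n) \sum_(b < n | F a b) (i == a)%:R * (\sum_(d : bool) w1 i b d) =
    \sum_(b < n | F i b) \sum_(d : bool) w1 i b d.
  rewrite (bigD1 i) //= [X in _ + X]big1 ?addr0 => [|a ai].
    by apply: eq_bigr => b _; rewrite eqxx mul1r.
  by rewrite big1 // => b _; rewrite eq_sym (negPf ai) mul0r.
rewrite (D (fun a b => (a < b)%N)) (D (fun b a => (a < b)%N)).
rewrite [RHS](bigID (fun j : 'I_n => (i < j)%N)) /=; congr (_ + _); apply: eq_bigl => j.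
  by case: ltnP => [ij|]; rewrite ?andbF // andbT; case: eqP ij => // ->; rewrite ltnn.
by rewrite -leqNgt ltn_neqAle.
Qed.

Definition rweight l c (al : posroot n) : int :=
  match al with inl i => l (i, false) | inr p => c ((val p.1).1, false) ((val p.1).2, p.2) end.

Lemma root_sum_zval l c i : (forall a b, c a b = c b a) -> (forall a b, c (opp a) (opp b) = - c a b) ->
  (\sum_al (rweight l c al)%:~R *: rootv R al) 0 i = (zval l c (i, false))%:~R.
Proof.
move=> cs ca.
rewrite (root_sum (w0 := fun j => (l (j, false))%:~R) (w1 := fun j j' d => (c (j, false) (j', d))%:~R)) //.
  by rewrite /zval sum_pairs rmorphD rmorph_sum /=; congr (_ + _); apply: eq_bigr => j _; rewrite rmorph_sum.
move=> j j' d; rewrite cs; case: d; rewrite ?expr0 ?expr1 ?mul1r ?mulN1r //.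
by rewrite -[(j, true)]/(opp (j, false)) -[(j', false)]/(opp (j', true)) ca rmorphN.
Qed.

(** The vector (n, ..., 1), positive on all of R_+, so that [rho2] in this direction is 2 rho. *)
Definition domg : expo := [ffun i : 'I_n => (n - i)%N%:Z].

Lemma regh_domg : regh domg.
Proof.
split=> [[i d]|[i d] [j d'] /= ij]; rewrite /eco /sgi /= !ffunE; have := ltn_ord i.
  by move: (nat_of_ord i) => x; case: d; clear; lia.
have := ltn_ord j; have : (i != j :> nat) by [].
by move: (nat_of_ord i) (nat_of_ord j) => x y; case: d; case: d'; clear; lia.
Qed.

Definition mlt (al : posroot n) : int := match al with inl _ => m1 | inr _ => k%:Z end.

Lemma multrE al : multr M al = (mlt al)%:~R :> R.
Proof.
case: al => //= _; have /(congr1 (fun p : int => p%:~R : R)) := Hm1.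
rewrite big_bool /= !rmorphD rmorphM /= -!pmulrn !natrD => E.
by apply: (mulfI (_ : 2 != 0)); [rewrite pnatr_eq0|rewrite E; field].
Qed.

Lemma rhoE i : 2 * rho n M 0 i = (rho2 k m1 domg i)%:~R.
Proof.
pose l a := m1 * sgz (eco domg a).
pose c a b := k%:Z * sgz (eco domg a + eco domg b).
rewrite ffunE; have -> : r2 k m1 domg (i, false) = zval l c (i, false) by rewrite /r2 mulr_sumr.
rewrite -root_sum_zval => [|a b|a b]; last first.
- by rewrite /c !eco_opp -opprD sgzN mulrN.
- by rewrite /c addrC.
rewrite mxE mulrA divff ?pnatr_eq0 // mul1r; congr (fun_of_matrix _ 0 i); apply: eq_bigr => al _.
congr (_ *: _); rewrite multrE rmorph_int; congr _%:~R.
case: al => [j|[[[j j'] /= jj'] d]]; rewrite /mlt /rweight /l /c /eco /sgi /= !ffunE.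
  by rewrite gtr0_sgz ?mulr1 //; have := ltn_ord j; move: (nat_of_ord j) => y; clear; lia.
rewrite gtr0_sgz ?mulr1 //; have := ltn_ord j'; move: jj'; move: (nat_of_ord j) (nat_of_ord j') => y y'.
by case: d; clear; lia.
Qed.
End RootSums.

(** * The shifts nu as lattice points of the zonotope *)

Section ShiftSet.
Variables (R : realType) (logq : R[i]).
Local Notation C := R[i].
Local Notation q := (cexp logq).
Local Notation qp := (qpow logq).
Variables (n k L L' N N' : nat).
Local Notation M := (Params k (L%:R / 2) (L'%:R / 2) (N%:R / 2) (N'%:R / 2) : params R).
Local Notation LL := (fun e : bool => if e then (N, N') else (L, L')).
Local Notation sidx := ('I_n * bool)%type.
Local Notation expo := {ffun 'I_n -> int}.
Local Notation vec := ('rV[C]_n).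
Hypothesis HLL : forall b, odd ((LL b).1 + (LL b).2).
Variable m1 : int.
Hypothesis Hm1 : 2 * m1 = 2 + \sum_(e : bool) ((LL e).1 + (LL e).2)%N%:Z.
Implicit Types (x z nu : vec) (l : sidx -> int) (c : sidx -> sidx -> int) (v eta : expo).
Local Notation domg := (domg n).
Local Notation rho2 := (rho2 k m1 domg).

Definition vecz v : vec := \row_i (v i)%:~R.
(** Inverse of the embedding of the integers by choice, with default value 0 off its image. *)
Definition intof (w : C) : int := xget 0 [set p : int | p%:~R = w]%classic.
(** The index eta = 2 nu - 2 rho of the factor D - m(x + nu); nu = 0 gives -[rho2]. *)
Definition tau nu : expo := [ffun i => 2 * intof (nu 0 i) - rho2 i].

Lemma intofK (p : int) : intof p%:~R = p.
Proof.
rewrite /intof; have /= := @xgetPex _ 0 [set r : int | r%:~R = p%:~R :> C]%classic (ex_intro _ p erefl).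
by move/eqP; rewrite eqr_int => /eqP.
Qed.

Lemma tau_vecz v i : tau (vecz v) i = 2 * v i - rho2 i.
Proof. by rewrite ffunE mxE intofK. Qed.

Lemma vecz_inj : injective vecz.
Proof.
move=> v w E; apply/ffunP => i; move/rowP/(_ i): E; rewrite !mxE => /eqP.
by rewrite eqr_int => /eqP.
Qed.

Lemma vecz0 : vecz 0 = 0.
Proof. by apply/rowP => i; rewrite !mxE ffunE. Qed.

Lemma rootv_int (al : posroot n) : exists v, rootv R al = vecz v.
Proof.
case: al => [j|p].
  exists [ffun i => (i == j)%:Z]; apply/rowP => i.
  by rewrite !mxE ffunE eqxx.
exists [ffun i => (i == (val p.1).1)%:Z + (-1) ^+ p.2 * (i == (val p.1).2)%:Z].
apply/rowP => i; rewrite /= rootv1E mxE ffunE rmorphD rmorphM rmorphXn /= rmorphN1.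
by [].
Qed.

Lemma comb_int (w : posroot n -> nat) : exists v, \sum_al (w al)%:R *: rootv R al = vecz v.
Proof.
have [r Hr] := choice rootv_int.
exists [ffun i => \sum_al (w al)%:Z * r al i]; apply/rowP => i; rewrite mxE summxE ffunE rmorph_sum /=.
by apply: eq_bigr => al _; rewrite Hr !mxE intrM.
Qed.

Lemma nu_seq_int nu : nu \in nu_seq n M -> exists2 v, nu = vecz v & v != 0.
Proof.
rewrite mem_filter mem_undup => /andP[nu0 /mapP[la _ nuE]].
have [v E] := comb_int (fun al => la al); exists v; first by rewrite nuE.
by apply: contraNneq nu0 => v0; rewrite nuE E v0 vecz0.
Qed.

Lemma Em_tau x v : Em q (spectral_pt logq k L L' N N' x) (tau (vecz v)) = mfrak logq (x + vecz v).
Proof.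
rewrite /Em /mfrak -(pair_big xpredT xpredT (fun i d => mon _ (unitv (i, d) 2) * q ^ eco _ (i, d))) /=.
apply: eq_bigr => i _; rewrite big_bool /= !mon_unitv /eco /sgi /= tau_vecz addrC /co /= /spectral_pt.
have E : qp ((x + rho n M) 0 i) ^ 2 * q ^ (2 * v i - rho2 i) = qp (2 * (x + vecz v) 0 i).
  rewrite -qpow_int -exprnP -qpowX -qpowD; congr qp.
  by rewrite rmorphB /= -(rhoE _ _ Hm1) !mxE intrM; ring.
by congr (_ + _) => //; rewrite qpowN -E invfM exprz_inv !invr_expz.
Qed.

Lemma tau0 : tau 0 = - rho2.
Proof. by apply/ffunP => i; rewrite -vecz0 tau_vecz !ffunE mulr0 sub0r. Qed.

Lemma Em_bottom x : Em q (spectral_pt logq k L L' N N' x) (- rho2) = mfrak logq x.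
Proof. by rewrite -tau0 -vecz0 Em_tau vecz0 addr0. Qed.

Lemma tau_neq nu : nu \in nu_seq n M -> tau nu != - rho2.
Proof.
move=> /nu_seq_int[v -> v0]; apply: contraNneq v0 => E; apply/eqP/ffunP => i.
move/ffunP/(_ i): E; rewrite tau_vecz [(- rho2) i]ffunE [(0 : expo) i]ffunE.
by move: (rho2 i) (v i); clear; lia.
Qed.

(** A coefficient in [-m_al, m_al] with the parity of m_al becomes, after adding m_al and halving,
    an integer in {0, ..., m_al}; adding m_al for every positive root translates the point by 2 rho.
    The case nu = 0, absent from [nu_seq], is the separate entry -[rho2]. *)
Lemma inS_tau eta : inS k m1 eta -> eta \in - rho2 :: [seq tau nu | nu <- nu_seq n M].
Proof.
move=> [l [c [[la ll l2] [cs ca cl c2] Hv]]].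
have m1_gt0 := m1_pos HLL Hm1.
pose w al := absz ((rweight l c al + mlt k m1 al) %/ 2)%Z.
have wE al : 2 * (w al)%:Z = rweight l c al + mlt k m1 al /\ (w al < (Num.truncn (multr M al)).+1)%N.
  have tE : Num.truncn (multr M al) = absz (mlt k m1 al).
    rewrite (multrE _ _ Hm1) -[mlt _ _ _ in LHS]gez0_abs; first by rewrite -pmulrn natrK.
    by case: al => //= _; apply: ltW.
  rewrite tE /w; case: al {tE} => [i|[[[i j] /= ij] d]] /=.
    have := la (i, false); have := ll (i, false); have := ll (i, true); have := l2 (i, false).
    rewrite -[opp _]/(i, true); move: (l (i, false)) (l (i, true)) m1_gt0 => y y'; clear; lia.
  have nij : (i, false).1 != (j, d).1 by apply: contraTneq ij => /= ->; rewrite ltnn.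
  have := ca (i, false) (j, d); have := cl _ _ nij; have := c2 _ _ nij.
  have := cl (opp (i, false)) (opp (j, d)) nij.
  move: (c (opp (i, false)) (opp (j, d))) (c (i, false) (j, d)) => y y'; clear; lia.
pose f : {dffun forall al : posroot n, 'I_(Num.truncn (multr M al)).+1} := [ffun al => inord (w al)].
pose nu := \sum_(al : posroot n) (f al)%:R *: rootv R al.
have fE al : f al = w al :> nat.
  by rewrite /f ffunE inordK //; have [] := wE al.
have nuE i : 2 * nu 0 i = (eta i + rho2 i)%:~R.
  have E : 2 *: nu = \sum_al (rweight l c al)%:~R *: rootv R al + 2 *: rho n M.
    rewrite /rho scalerA divff ?pnatr_eq0 // scale1r scaler_sumr -big_split; apply: eq_bigr => al _ /=.
    rewrite scalerA -scalerDl fE (multrE _ _ Hm1) rmorph_int -intrD; have [<- _] := wE al.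
    by rewrite intrM.
  have := congr1 (fun y : vec => y 0 i) E; rewrite mxE => ->.
  by rewrite mxE root_sum_zval // mxE (rhoE _ _ Hm1) -intrD -Hv.
have [nu0|nu0] := eqVneq nu 0.
  rewrite inE; apply/orP; left; apply/eqP/ffunP => i; have := nuE i; rewrite nu0 mxE mulr0 => /esym/eqP.
  by rewrite intr_eq0 [(- rho2) i]ffunE; move: (eta i) (rho2 i); clear; lia.
rewrite inE; apply/orP; right; apply/mapP; exists nu.
  by rewrite mem_filter nu0 mem_undup; apply/mapP; exists f; rewrite ?mem_enum.
have [v nuv] := comb_int (fun al => f al).
rewrite -/nu in nuv.
apply/ffunP => i; have := nuE i; rewrite nuv tau_vecz mxE -[2]/(2%:~R) -intrM => /eqP; rewrite eqr_int.
by move: (eta i) (rho2 i) (v i); clear; lia.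
Qed.
End ShiftSet.

(** * Return to functions of z *)

Section Assembly.
Variables (R : realType) (logq : R[i]).
Local Notation C := R[i].
Local Notation q := (cexp logq).
Local Notation qp := (qpow logq).
Variables (n k L L' N N' : nat).
Local Notation M := (Params k (L%:R / 2) (L'%:R / 2) (N%:R / 2) (N'%:R / 2) : params R).
Local Notation LL := (fun e : bool => if e then (N, N') else (L, L')).
Local Notation expo := {ffun 'I_n -> int}.
Local Notation vec := ('rV[C]_n).
Hypothesis hq : forall p : nat, (0 < p)%N -> q ^+ p != 1.
Hypothesis HLL : forall b, odd ((LL b).1 + (LL b).2).
Variable m1 : int.
Hypothesis Hm1 : 2 * m1 = 2 + \sum_(e : bool) ((LL e).1 + (LL e).2)%N%:Z.
Implicit Types (x z nu : vec) (c : expo -> C).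
Local Notation rho2 := (rho2 k m1 (domg n)).
Local Notation tau := (tau k m1).
Local Notation Zt := (torus_pt logq).
Local Notation Yt := (spectral_pt logq k L L' N N').
Local Notation wave := (plane_wave logq k L L' N N').
Local Notation Dop Y := (Dop q k LL (q ^ (- m1)) (cst_torus n q k m1) Y).

(** Generic points are stable under unit shifts, so the induction hypothesis covers z and all
    neighbours that D evaluates, and no denominator vanishes. *)
Lemma foldr_torus (s : seq expo) (F : seq expo -> expo -> C) x (nus : seq vec) :
  (forall Z, tor Z -> ev s (F [::]) Z = Qtor q k LL Z) ->
  (forall eta D Z, tor Z -> reg (poles q) Z ->
     ev s (F (eta :: D)) Z = Dop (Yt x) (ev s (F D)) Z - Em q (Yt x) eta * ev s (F D) Z) ->
  (forall nu, nu \in nus -> exists v, nu = vecz R v) -> forall z, generic logq z ->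
  foldr (fun nu f z => koornwinderM M logq f z - mfrak logq (x + nu) * f z)
    (fun z => qp (2 * dotp x z) * Qfun M logq z) nus z =
  wave x z * ev s (F [seq tau nu | nu <- nus]) (Zt z).
Proof.
move=> F0 FS; elim: nus => [|nu nus IH] Hnu z gz /=.
  rewrite F0; last exact: tor_torus_pt.
  rewrite Qfun_torus // mulrA -qpowD; congr (qp _ * _); rewrite -mulrDr; congr (_ * _).
  by rewrite /dotp -big_split; apply: eq_bigr => i _; rewrite [(x + _) 0 i]mxE mulrDl.
have {}IH : forall z, generic logq z -> _ := IH (fun nu' h => Hnu nu' (mem_behead (s := nu :: nus) h)).
have [v vE] := Hnu nu (mem_head _ _).
rewrite (koornwinder_torus Hm1 (x := x) (F := ev s (F [seq tau nu | nu <- nus]))); last first.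
  by move=> w [->|[i [->|->]]]; apply: IH => //; have [] := generic_step i gz.
rewrite IH // FS; [|exact: tor_torus_pt|exact/regular_torus/generic_regular].
by rewrite vE (Em_tau logq k Hm1) mulrBr; ring.
Qed.

Lemma BA_conditions_torus x f : cond1 q LL (Yt x) f -> cond2 q k (Yt x) f ->
  BA_conditions M logq (fun z => wave x z * f (Zt z)).
Proof.
move=> H1 H2.
have sh i (p : int) z := zshift_torus logq k L L' N N' x f i p z.
have tz z := tor_torus_pt logq z.
have uN i p : unitv (i, false) (- p) = unitv (i, true) p :> expo.
  by apply/ffunP => j; rewrite !ffunE.
have half (s : R) v w : 0 < s -> preccurly s (v%:R / 2) (w%:R / 2) -> exists2 p : nat, s = p%:R / 2 & (0 < p)%N.
  have one (u d : nat) : 0 < s -> u%:R / 2 - s = d%:R -> exists2 p : nat, s = p%:R / 2 & (0 < p)%N.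
    move=> s0 /(canRL (subrK _)) E; have E2 : u%:R = (2 * d)%:R + 2 * s.
      by rewrite natrM -mulrDr -E mulrC divfK ?pnatr_eq0.
    have du : (2 * d < u)%N by rewrite -(ltr_nat R) E2 ltrDl mulr_gt0.
    exists (u - 2 * d)%N; last by rewrite subn_gt0.
    by rewrite natrB ?(ltnW du) // E2 addrAC subrr add0r mulrC mulKf ?pnatr_eq0.
  by move=> s0; rewrite /preccurly => /orP[] /natrP[d]; apply: one.
have first e z i (s : R) : co (Zt z) (i, false) = sgK C e -> 0 < s ->
    preccurly s ((LL e).1%:R / 2) ((LL e).2%:R / 2) ->
    zshift i s%:C (fun z => wave x z * f (Zt z)) z -
    zshift i (- s%:C) (fun z => wave x z * f (Zt z)) z = 0.
  move=> Ez s0 sp; have [p sE p0] := half _ _ _ s0 sp; apply/eqP; rewrite subr_eq0; apply/eqP.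
  have -> : s%:C = p%:Z%:~R / 2 by rewrite sE realC_half.
  rewrite -mulNr -rmorphN /= !sh; congr (_ * _).
  apply: (H1 _ (i, false) e p) => //.
  by rewrite /adm p0 -(preccurly_half R) -sE.
split=> [z i s Ez|z i s Ez|z i j s ij Ez sk|z i j s ij Ez sk].
- by apply: (first false); rewrite /co /sgK expr0.
- by apply: (first true); rewrite /co /sgK expr1.
- have -> : s%:R = (2 * s%:Z)%:~R / 2 :> C by rewrite intrM mulrC mulKf ?pnatr_eq0.
  apply/eqP; rewrite subr_eq0 !sh; apply/eqP; congr (_ * _).
  by apply: (H2 _ (i, false) (j, false)) => //=; apply: contraTneq ij => ->; rewrite ltnn.
- have sE : s%:R = (2 * s%:Z)%:~R / 2 :> C by rewrite intrM mulrC mulKf ?pnatr_eq0.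
  have -> : - s%:R = (- (2 * s%:Z))%:~R / 2 :> C by rewrite sE mulrNz mulNr.
  rewrite sE {sE}.
  apply/eqP; rewrite subr_eq0 !sh uN; apply/eqP; congr (_ * _).
  apply: (H2 _ (i, false) (j, true)) => //=; first by apply: contraTneq ij => ->; rewrite ltnn.
  by rewrite /co /= /Zt Ez qpowN.
Qed.

(** The torus exponent mu of nu = rho + mu; the shift by rho comes from the plane wave. *)
Definition coefidx nu : expo := [ffun i => intof ((nu - rho n M) 0 i)].

Lemma coefidx_rho v : coefidx (rho n M + vecz R v) = v.
Proof. by apply/ffunP => i; rewrite ffunE addrC addKr mxE intofK. Qed.

Lemma coefidx_Nrho : coefidx (- rho n M) = - rho2.
Proof.
apply/ffunP => i; rewrite !ffunE; have -> : (- rho n M - rho n M) 0 i = (- rho2 i)%:~R.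
  by rewrite mulrNz -(rhoE R k Hm1) !mxE; ring.
by rewrite intofK ffunE.
Qed.

Lemma inS_polytope mu : inS k m1 (dbl mu + rho2) -> polytope M (rho n M + vecz R mu).
Proof.
move=> [l [c [[la ll l2] [cs ca cl c2] Hv]]].
exists (fun al => (rweight l c al)%:~R / 2) => [al|].
  rewrite (multrE R k Hm1) -mulNr -mulrNz !ler_pM2r ?invr_gt0 // !ler_int.
  case: al => [i|[[[i j] /= ij] d]] /=.
    by rewrite ll andbT -lerN2 opprK -la ll.
  have nij : (i, false).1 != (j, d).1 by apply: contraTneq ij => /= ->; rewrite ltnn.
  by rewrite cl // andbT -lerN2 opprK -ca cl.
apply/rowP => i; apply: (mulfI (_ : 2 != 0)); first by rewrite pnatr_eq0.
transitivity ((\sum_al (rweight l c al)%:~R *: rootv R al) 0 i).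
  rewrite root_sum_zval // -Hv /eco /sgi /= !ffunE intrD intrM.
  by rewrite mxE mulrDr (rhoE R k Hm1) !mxE addrC ffunE.
rewrite !summxE mulr_sumr; apply: eq_bigr => al _.
by rewrite !mxE mulrA rmorphM fmorphV rmorph_int rmorph_nat; congr (_ * _); field.
Qed.

Lemma expansion_torus (s : seq expo) (c : vec -> expo -> C) x z : uniq s ->
  (forall mu, c x mu != 0 -> mu \in s /\ inS k m1 (dbl mu + rho2)) ->
  wave x z * ev s (c x) (Zt z) = expansion M logq (fun nu x => c x (coefidx nu)) x z.
Proof.
move=> us Hc; rewrite /expansion.
have -> : wave x z = qp (2 * dotp x z) * qp (2 * dotp (rho n M) z).
  rewrite -qpowD -mulrDr; congr (qp (_ * _)).
  by rewrite /dotp -big_split; apply: eq_bigr => i _; rewrite [(x + _) 0 i]mxE mulrDl.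
rewrite -mulrA; congr (_ * _); rewrite /ev mulr_sumr.
pose r := [seq rho n M + vecz R mu | mu <- s & c x mu != 0].
have ur : uniq r by rewrite map_inj_uniq ?filter_uniq // => mu mu' /addrI /vecz_inj.
have waveE mu : qp (2 * dotp (rho n M + vecz R mu) z) = qp (2 * dotp (rho n M) z) * mon (Zt z) mu.
  have -> : mon (Zt z) mu = qp (\sum_i (mu i)%:~R * (2 * z 0 i)).
    by rewrite qpow_sum; apply: eq_bigr => i _; rewrite qpowZ.
  rewrite -qpowD; congr qp; rewrite /dotp !mulr_sumr -big_split; apply: eq_bigr => i _ /=.
  by rewrite [(_ + vecz R mu) 0 i]mxE [vecz R mu 0 i]mxE; ring.
transitivity (\sum_(nu <- r) c x (coefidx nu) * qp (2 * dotp nu z)).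
  rewrite big_map big_filter [RHS]big_mkcond /=; apply: eq_bigr => mu _.
  by case: (eqVneq (c x mu) 0) => [->|_] /=; rewrite ?mul0r ?mulr0 // coefidx_rho waveE mulrCA.
(* The support r is enlarged to all points of rho + Z^n in the polytope; the added terms have
   coefficient 0. *)
rewrite fsbig_seq //; apply: fsbig_widen.
  move=> nu /mapP[mu]; rewrite mem_filter => /andP[/Hc[_ /inS_polytope P] _] ->; split=> //.
  by exists (\row_i mu i); congr (_ + _); apply/rowP => i; rewrite !mxE.
move=> nu [[[mu nuE] _] nr]; apply/eqP; rewrite mulf_eq0; apply/orP; left.
apply: contraT => cn; case: nr; apply/mapP; exists (coefidx nu).
  by rewrite mem_filter cn; have [] := Hc _ cn.
rewrite nuE; have -> : map_mx intr mu = vecz R [ffun i => mu 0 i].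
  by apply/rowP => i; rewrite !mxE ffunE.
by rewrite coefidx_rho.
Qed.

Lemma q_neq0 : q != 0.
Proof. by rewrite -qpow1 qpow_neq0. Qed.

(** At x = p (1, ..., n) the point Y lies on the curve Y(0) y^h at y = q^p, and [cofin_Em_neq]
    separates nu = 0 from every other nu for all but finitely many y. *)
Lemma exists_product_neq0 : exists x,
  \prod_(nu <- nu_seq n M) (mfrak logq x - mfrak logq (x + nu)) != 0.
Proof.
have H nu : nu \in nu_seq n M -> cofin (fun y => Em q (cv (Yt 0) (stdh n) y) (- rho2) !=
    Em q (cv (Yt 0) (stdh n) y) (tau nu)).
  by move=> /(tau_neq m1); rewrite eq_sym; apply: (cofin_Em_neq q_neq0 hq); apply: tor_spectral_pt.
have [p Hp] := cofin_qpow q_neq0 hq (cofin_forall_seq H).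
pose x : vec := \row_i (p * i.+1)%:R; exists x.
have xE : Yt x = cv (Yt 0) (stdh n) (q ^+ p).
  apply/funext => i; rewrite /cv /spectral_pt ffunE -!exprnP -exprM [q ^+ _]exprnP -qpow_int -qpowD.
  by congr qp; rewrite !mxE -pmulrn; ring.
rewrite prodf_seq_neq0; apply/allP => nu nuS /=; have [v nuv _] := nu_seq_int nuS.
by have := Hp _ nuS; rewrite subr_eq0 -xE nuv (Em_tau logq k Hm1) (Em_bottom logq k Hm1).
Qed.

Theorem baker_akhiezer_half_integers : exists (Psi coef : vec -> vec -> C),
  [/\ (forall x, mero_eq logq (psi_formula M logq x) (Psi x)),
      is_BA M logq Psi coef,
      (forall x, coef (- rho n M) x =
         \prod_(nu <- nu_seq n M) (mfrak logq x - mfrak logq (x + nu)))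
      /\ (exists x, \prod_(nu <- nu_seq n M) (mfrak logq x - mfrak logq (x + nu)) != 0) &
      forall x, mero_eq logq (koornwinderM M logq (Psi x)) (fun z => mfrak logq x * Psi x z)].
Proof.
pose etas := [seq tau nu | nu <- nu_seq n M].
have Heta eta : inS k m1 eta -> eta \in - rho2 :: etas by apply: inS_tau.
have [s [F [us F1 F2 F3 F4]]] := torus_baker_akhiezer q_neq0 hq HLL Hm1 (@regh_domg n) Heta.
have tY x := tor_spectral_pt logq k L L' N N' x.
pose c x := F (Yt x) etas.
have cN x : c x (- rho2) = \prod_(nu <- nu_seq n M) (mfrak logq x - mfrak logq (x + nu)).
  rewrite /c F4 // big_map; apply: eq_big_seq => nu /nu_seq_int[v -> _].
  by rewrite (Em_tau logq k Hm1) (Em_bottom logq k Hm1).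
(* A plane wave times a Laurent polynomial, defined at every z; the iterated formula is compared
   with it only at generic z. *)
pose Psi x z := wave x z * ev s (c x) (Zt z).
have [x0 Hx0] := exists_product_neq0.
exists Psi, (fun nu x => c x (coefidx nu)); split.
- move=> x z gz; have [G1 G2] := F1 _ (tY x).
  by apply: foldr_torus => // nu /nu_seq_int[v -> _]; exists v.
- split=> [x z||x].
  + by apply: expansion_torus => // mu; have [_] := F3 _ (tY x); apply.
  + have c0 : c x0 (- rho2) != 0 by rewrite cN.
    have [_ /(_ _ c0)[sb _]] := F3 _ (tY x0).
    have [v Hv] := ev_neq0_qpow q_neq0 hq us sb c0.
    exists x0, (\row_i ((v i)%:~R / 2)); rewrite mulf_neq0 ?qpow_neq0 //.
    have -> // : Zt (\row_i ((v i)%:~R / 2)) = (fun i => q ^ v i).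
    by apply/funext => i; rewrite /torus_pt mxE mulrC divfK ?pnatr_eq0 // qpow_int.
  + by have [h1 h2] := F2 _ (tY x); apply: BA_conditions_torus.
- by split=> [x|]; [rewrite coefidx_Nrho cN|apply: exists_product_neq0].
- move=> x z gz; have [H _] := F3 _ (tY x).
  rewrite (koornwinder_torus Hm1 (x := x) (F := ev s (c x))) //.
  rewrite H ?(Em_bottom logq k Hm1); first by rewrite /Psi mulrCA.
    exact: tor_torus_pt.
  exact/regular_torus/generic_regular.
Qed.

End Assembly.

Lemma half_natE (R : realType) (y : R) : 2 * y \is a Num.nat -> exists p : nat, y = p%:R / 2.
Proof. by move=> /natrP[p E]; exists p; rewrite -E mulrC mulKf ?pnatr_eq0. Qed.

Lemma odd_half_sum (R : realType) (L L' : nat) :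
  (2^-1 + L%:R / 2 + L'%:R / 2 : R) \is a Num.int -> odd (L + L').
Proof.
move=> /intrP[p E]; have : (1 + L%:Z + L'%:Z)%:~R = (2 * p)%:~R :> R.
  by rewrite intrM -E !intrD -!pmulrn; field.
by move=> /eqP; rewrite eqr_int; clear; lia.
Qed.

Theorem theorem6p7 (R : realType) (n : nat) (q logq : R[i])
    (k : nat) (l l' m m' : R)
    (hlogq : cexp logq = q)
    (hq : forall N : nat, (0 < N)%N -> q ^+ N != 1)
    (hl : 2 * l \is a Num.nat) (hl' : 2 * l' \is a Num.nat)
    (hm : 2 * m \is a Num.nat) (hm' : 2 * m' \is a Num.nat)
    (hll' : 2^-1 + l + l' \is a Num.int)
    (hmm' : 2^-1 + m + m' \is a Num.int) :
  let M := Params k l l' m m' in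
  let D := @koornwinderM R n M logq in
  let psi := @psi_formula R n M logq in
  exists (Psi coef : 'rV[R[i]]_n -> 'rV[R[i]]_n -> R[i]),
    [/\ (forall x, mero_eq logq (psi x) (Psi x)),
        is_BA M logq Psi coef,
        (forall x, coef (- rho n M) x =
           \prod_(nu <- nu_seq n M) (mfrak logq x - mfrak logq (x + nu)))
        /\ (exists x, \prod_(nu <- nu_seq n M)
                        (mfrak logq x - mfrak logq (x + nu)) != 0) &
        forall x, mero_eq logq (D (Psi x)) (fun z => mfrak logq x * Psi x z)].
Proof.
move=> M D psi; subst q.
have [L lE] := half_natE hl; have [L' lE'] := half_natE hl'.
have [N mE] := half_natE hm; have [N' mE'] := half_natE hm'.
rewrite /psi /D /M {psi D M}; subst l l' m m'.
move/odd_half_sum in hll'; move/odd_half_sum in hmm'.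
(* L + L' and N + N' are both odd, so their sum is even and the halving is exact. *)
pose m1 : int := (1 + (L + L' + N + N')./2)%N%:Z.
apply: (@baker_akhiezer_half_integers _ _ n k _ _ _ _ hq _ m1) => [[]//|].
rewrite big_bool /= /m1; clear -hll' hmm'; lia.
Qed.
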